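(* Let $p$ be an odd prime. Let $K/\mathbb{Q}$ be a meta-abelian Galois extension which is only tamely ramified at $p$ and unramified everywhere else. Then $K$ is contained in the Hilbert class field of $\mathbb{Q}(\zeta_p)$.
   Context: A Galois extension is meta-abelian if its Galois group $G$ satisfies $G''=1$ (the second derived subgroup is trivial). ''Unramified everywhere else'' means unramified at all finite primes other than $p$; ramification at the infinite place is allowed. $\zeta_p$ is a primitive $p$-th root of unity, and the Hilbert class field is the maximal unramified abelian extension. *)

(* Defs.v *)
From HB Require Import structures.
From mathcomp Require Import all_boot all_order all_algebra all_field.
From mathcomp Require Import boolp.

Set Implicit Arguments.
Unset Strict Implicit.
Unset Printing Implicit Defensive.

Import Order.TTheory GRing.Theory Num.Theory.
Local Open Scope ring_scope.

(* Algebraic extensions of Q, finite or infinite, are taken inside the fixed  *)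
(* algebraic closure algC of Q: a field is a predicate K : divringClosed algC,*)
(* the rational field being Crat.                                             *)

Section SubfieldType.
Variable K : divringClosed algC.

Definition fieldOf : predArgType := {x : algC | x \in K}.
HB.instance Definition _ := SubChoice.on fieldOf.
HB.instance Definition _ := [SubChoice_isSubIntegralDomain of fieldOf by <:].
HB.instance Definition _ := [SubIntegralDomain_isSubField of fieldOf by <:].

Definition integers : {pred algC} := [predI K & Aint].

Lemma integers_subring_closed : subring_closed integers.
Proof.
split=> [|x y /andP[Kx Ax] /andP[Ky Ay]|x y /andP[Kx Ax] /andP[Ky Ay]].
- by apply/andP; split; apply: rpred1.
- by apply/andP; split; apply: rpredB.
- by apply/andP; split; apply: rpredM.
Qed.
HB.instance Definition _ :=
  GRing.isSubringClosed.Build algC integers integers_subring_closed.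

Definition ringOfIntegers : predArgType := {x : algC | x \in integers}.
HB.instance Definition _ := SubChoice.on ringOfIntegers.
HB.instance Definition _ := [SubChoice_isSubComNzRing of ringOfIntegers by <:].

End SubfieldType.

Section GeneratedSubfield.
Variable S : algC -> Prop.

Definition subfield_gen : {pred algC} := fun x =>
  `[< forall M : divringClosed algC, (forall y, S y -> y \in M) -> x \in M >].

Lemma subfield_gen_divring_closed : divring_closed subfield_gen.
Proof.
split=> [|x y /asboolP Sx /asboolP Sy|x y /asboolP Sx /asboolP Sy];
  apply/asboolP => M SM; first exact: rpred1.
- by apply: rpredB; [apply: Sx | apply: Sy].
- by apply: rpred_div; [apply: Sx | apply: Sy].
Qed.
HB.instance Definition _ :=
  GRing.isDivringClosed.Build algC subfield_gen subfield_gen_divring_closed.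

End GeneratedSubfield.

(* Q(z) *)
Definition rat_adjoin (z : algC) : divringClosed algC :=
  subfield_gen (fun x => x = z).

Definition finite_extension (F E : divringClosed algC) : Prop :=
  exists (n : nat) (b : 'I_n -> fieldOf E), forall x : fieldOf E,
    exists c : 'I_n -> fieldOf F, val x = \sum_(i < n) val (c i) * val (b i).

(* Algebraicity and separability are automatic for subfields of algC.         *)
Definition galois_extension (F E : divringClosed algC) : Prop :=
  {subset F <= E} /\
  forall f : {poly fieldOf F}, irreducible_poly f ->
  forall x : algC, x \in E -> root (map_poly val f) x ->
  forall y : algC, root (map_poly val f) y -> y \in E.

(* s is an element of Gal(E / F). *)
Definition Galois (F E : divringClosed algC) (s : fieldOf E -> fieldOf E) :=
  [/\ bijective s, zmod_morphism s, monoid_morphism s &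
      forall x : fieldOf E, val x \in F -> s x = x].

(* The commutator subgroup of a group G of bijections of T. Bijections are    *)
(* considered up to pointwise equality.                                       *)
Inductive derived (T : Type) (G : (T -> T) -> Prop) : (T -> T) -> Prop :=
| derived_commutator s s' t t' of G s & G t & cancel s s' & cancel s' s
    & cancel t t' & cancel t' t : derived G (s' \o t' \o s \o t)
| derived_comp s t of derived G s & derived G t : derived G (s \o t)
| derived_inv s s' of derived G s & cancel s s' & cancel s' s : derived G s'.

Definition abelian_extension (F E : divringClosed algC) : Prop :=
  galois_extension F E /\
  forall s t, @Galois F E s -> @Galois F E t -> s \o t =1 t \o s.

Definition meta_abelian_extension (F E : divringClosed algC) : Prop :=
  galois_extension F E /\
  forall s, derived (derived (@Galois F E)) s -> s =1 id.

(* P ^ e, the ideal generated by the products of e elements of P.             *)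
Definition ideal_pow (R : comNzRingType) (P : {pred R}) (e : nat) (x : R) :=
  exists (n : nat) (c : 'I_n -> R) (a : 'I_n -> 'I_e -> R),
    (forall i j, a i j \in P) /\ x = \sum_(i < n) c i * \prod_(j < e) a i j.

(* For a prime P of the ring of integers of E with contraction p to that of   *)
(* F, p lies in P ^ e (equivalently, so does the ideal generated by p).       *)
Definition contraction_le_pow (F E : divringClosed algC)
    (P : {pred ringOfIntegers E}) (e : nat) : Prop :=
  forall x : ringOfIntegers E, x \in P -> val x \in F -> ideal_pow P e x.

(* e(P / p) = e, for E / F finite. *)
Definition ramification_index (F E : divringClosed algC)
    (P : {pred ringOfIntegers E}) (e : nat) : Prop :=
  contraction_le_pow F P e /\ ~ contraction_le_pow F P e.+1.

Definition finite_subextension (F E M : divringClosed algC) : Prop :=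
  [/\ {subset F <= M}, {subset M <= E} & finite_extension F M].

(* As usual, an infinite extension is unramified, or tamely ramified, when    *)
(* all its finite subextensions are. Residue fields of primes are finite, so  *)
(* the separability of residue extensions is automatic.                       *)
Definition unramified_at (l : nat) (K : divringClosed algC) : Prop :=
  forall M, finite_subextension Crat K M ->
  forall P : prime_idealr (ringOfIntegers M), l%:R \in P ->
  ramification_index Crat P 1.

Definition tamely_ramified_at (l : nat) (K : divringClosed algC) : Prop :=
  forall M, finite_subextension Crat K M ->
  forall P : prime_idealr (ringOfIntegers M), l%:R \in P ->
  exists2 e : nat, ramification_index Crat P e & ~~ (l %| e)%N.

Definition unramified_finite_places (F E : divringClosed algC) : Prop :=
  forall M, finite_subextension F E M ->
  forall P : prime_idealr (ringOfIntegers M),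
  (exists2 x, x \in P & x != 0) -> ramification_index F P 1.

(* No real place of F becomes complex in E; every embedding of E in C is the  *)
(* restriction of an endomorphism of algC.                                    *)
Definition unramified_infinite_places (F E : divringClosed algC) : Prop :=
  forall s : {rmorphism algC -> algC},
  (forall x, x \in F -> s x \is Num.real) ->
  forall x, x \in E -> s x \is Num.real.

Definition unramified_extension (F E : divringClosed algC) : Prop :=
  unramified_finite_places F E /\ unramified_infinite_places F E.

(* The maximal unramified abelian extension of F, as the compositum of all    *)
(* unramified abelian extensions of F.                                        *)
Definition hilbert_class_field (F : divringClosed algC) : divringClosed algC :=
  subfield_gen (fun x => exists E : divringClosed algC,
    [/\ abelian_extension F E, unramified_extension F E & x \in E]).

(* Main.v *)
(* Write QQ for the rationals. It suffices to treat L = F(zeta) with F a finite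
   Galois subextension of K / QQ. Let G = Gal(L / QQ), and let I be the inertia
   group in G of a prime Q of L above p. Away from p all inertia groups are
   trivial; I has order prime to p, hence is cyclic, I = <t>. The inertia groups
   above p are conjugate, so all of them lie in I G', and Minkowski's theorem
   for the abelian extension L^(I G') / QQ yields G = I G'. As G' is abelian, it
   follows that a |-> [a, t] is an automorphism of G', whence I :&: G' = 1.
   The tame character of I on the fixed field of G' takes its values in the
   prime field, as the traces over I are rational; thus t^(p-1) lies in G', so
   #|G : G'| <= p - 1 and G' = Gal(L / QQ(zeta)). Hence L / QQ(zeta) is abelian,
   and it is unramified because I meets Gal(L / QQ(zeta)) trivially.

   For Minkowski's theorem, a cyclic unramified extension of prime degree has
   ring of integers self-dual for the trace form, hence an integral basis of
   discriminant +1 or -1. In the real case Minkowski's linear forms theorem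
   then gives a nonzero integer x with a conjugate smaller than 1 and with all
   |x_i^2 - 1| < 1, so that x^2 = 1, a contradiction; in the imaginary
   quadratic case 4 a c - b^2 = 1 is impossible modulo 4.

   That Q is unramified over a subfield is expressed by the least positive
   value on L of a valuation at Q being attained in that subfield. *)

Require Import Defs.
From HB Require Import structures.
From mathcomp Require Import all_boot all_order all_fingroup all_algebra all_solvable all_field.
From mathcomp Require Import boolp zify ring lra.
From mathcomp Require classical_sets.
Set Implicit Arguments.
Unset Strict Implicit.
Unset Printing Implicit Defensive.
Import Order.TTheory GRing.Theory Num.Theory.
Local Open Scope ring_scope.

(** * Integers and primes of a Galois number field *)

(** The field [K] may be infinite, and the hypotheses on ramification concern only its finite
    subextensions. The argument therefore takes one element [x] of [K] at a time and works in the
    splitting field [L] of its minimal polynomial times [X^p - 1], with [F] the part of [L] lying in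
    [K]. Tameness is given for [F], not for [L = F(zeta)]; it passes to [L] because an automorphism
    of order [p] must fix [zeta]. No factorization of ideals is used. An integer relation with a
    coefficient prime to [l] shows that the localization at [Q] is a valuation ring, and the
    conjugates of an element bound the denominators of its value, which makes the valuation
    discrete. It is not normalized, so ramification is read off from least positive values on
    subfields. Where an element avoiding several primes would be wanted, the candidates become the
    coefficients of one polynomial and Gauss's lemma is applied. In Minkowski's theorem, a box of
    volume 1 and a lattice of determinant 1 do not conflict by themselves: they give a unit. The box
    is made unequal so that this unit is near 1 or -1 at every place, yet different from both. *)

Section IntegersOfNumberField.
Variables (L : splittingFieldType rat) (iota : {rmorphism L -> algC}).
Local Notation gT := (gal_of {:L}).

Lemma galois_rat : galois 1%AS {:L}.
Proof.
rewrite /galois sub1v normalFieldf andbT /=.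
apply/separableP => y _; apply: pcharf0_separable => q.
by rewrite (fmorph_pchar (in_alg L)) pchar_num.
Qed.

Lemma gal_fixed_rat (x : L) : (forall g : gT, g x = x) -> exists r : rat, x = ratr r.
Proof.
move=> fx; have : x \in fixedField 'Gal({:L} / 1%AS)%g.
  by apply/fixedFieldP; rewrite ?memvf.
have /galois_fixedField -> := galois_rat.
by case/vlineP=> r ->; exists r; rewrite alg_num_field.
Qed.

Definition intO : {pred L} := [pred x | iota x \in Aint].

Lemma intO_subring : subring_closed intO.
Proof.
by split=> [|x y|x y]; rewrite !inE ?rmorph1 ?rmorphB ?rmorphM //=; [apply: rpredB|apply: rpredM].
Qed.
HB.instance Definition _ := GRing.isSubringClosed.Build L intO intO_subring.

Lemma intO_gal (g : gT) x : x \in intO -> g x \in intO.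
Proof.
rewrite !inE => Ax.
have [p [Dp mon_p] dv_p] := minCpolyP (iota x).
have := Ax; rewrite unfold_in => /floorpP[q Dq].
apply: (@root_monic_Aint (map_poly intr q)); last first.
- by apply/polyOverP=> i; rewrite coef_map /= rpred_int.
- by rewrite -Dq minCpoly_monic.
have : root (map_poly iota (map_poly intr q)) (iota x).
  rewrite -map_poly_comp (eq_map_poly (g := intr)); last by move=> z /=; rewrite rmorph_int.
  by rewrite -Dq root_minCpoly.
rewrite fmorph_root -(fmorph_root g) -map_poly_comp.
rewrite -(fmorph_root iota) -map_poly_comp.
rewrite (eq_map_poly (g := intr)) // => z /=; by rewrite !rmorph_int.
Qed.

Lemma intO_galE (g : gT) x : (g x \in intO) = (x \in intO).
Proof.
apply/idP/idP; last exact: intO_gal.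
by move/(intO_gal g^-1%g); rewrite -galM ?memvf // mulgV gal_id.
Qed.

Lemma intO_fixed x : x \in intO -> (forall g : gT, g x = x) -> exists z : int, x = z%:~R.
Proof.
move=> Ox /gal_fixed_rat[r Dx]; move: Ox; rewrite inE Dx fmorph_rat => Ar.
have /intrP[z Dz] : (ratr r : algC) \in Num.int by apply: Cint_rat_Aint; rewrite ?Crat_rat.
by exists z; apply: (fmorph_inj iota); rewrite fmorph_rat Dz rmorph_int.
Qed.

(* The product of the conjugates of p has rational integer coefficients. *)
Lemma intO_root p x : p \is monic -> p \is a polyOver intO -> root p x -> x \in intO.
Proof.
move=> mp Op px0; pose F := \prod_(g : gT) map_poly g p.
have OF : F \is a polyOver intO.
  apply: rpred_prod => g _; apply/polyOverP=> i; rewrite coef_map intO_gal //.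
  exact: (polyOverP Op).
have fixF (h : gT) : map_poly h F = F.
  rewrite /F rmorph_prod /= [RHS](reindex_inj (mulIg h)) /=; apply: eq_bigr => g _.
  by rewrite -map_poly_comp; apply: eq_map_poly => y /=; rewrite galM ?memvf.
have /fin_all_exists[c Dc] (i : 'I_(size F)) : exists z : int, F`_i = z%:~R.
  apply: intO_fixed; first exact: (polyOverP OF).
  by move=> g; rewrite -coef_map fixF.
rewrite inE; apply: (@root_monic_Aint (map_poly iota F)).
- rewrite fmorph_root /F (bigD1 1%g) //= rootM; apply/orP; left.
  by rewrite map_poly_id // => y _; rewrite gal_id.
- rewrite map_monic /F; apply: monic_prod => g _; by rewrite map_monic.
- apply/polyOverP=> i; rewrite coef_map /=.
  have [lti|gei] := ltnP i (size F); last by rewrite nth_default // rmorph0 rpred0.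
  by rewrite (Dc (Ordinal lti)) rmorph_int rpred_int.
Qed.

(** With [n + 1] the degree of [p] and [a] its leading coefficient, [a^n p(X/a)] is monic over
    [intO] and vanishes at [a x]. *)
Lemma intO_lead p x : p \is a polyOver intO -> root p x -> lead_coef p * x \in intO.
Proof.
move=> Op px0; have [->|p0] := eqVneq p 0; first by rewrite lead_coef0 mul0r rpred0.
have sp : (1 < size p)%N.
  rewrite ltnNge; apply: contra p0 => sp; move: px0; rewrite (size1_polyC sp) rootC => /eqP->.
  by rewrite polyC0.
set a := lead_coef p; have a0 : a != 0 by rewrite lead_coef_eq0.
set n := (size p).-2; have Dn : size p = n.+2 by rewrite /n; case: (size p) sp => [|[]].
pose q := 'X^(n.+1) + \poly_(i < n.+1) (p`_i * a ^+ (n - i)).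
have sq : (size (\poly_(i < n.+1) (p`_i * a ^+ (n - i)))%R <= n.+1)%N by apply: size_poly.
apply: (@intO_root q).
- by rewrite monicE lead_coefDl ?lead_coefXn // size_polyXn.
- have Oa : a \in intO by rewrite /a lead_coefE; exact: (polyOverP Op).
  rewrite rpredD ?rpredX ?polyOverX //; apply/polyOverP=> i; rewrite coef_poly.
  by case: ifP => _; rewrite ?rpred0 // rpredM ?rpredX //; exact: (polyOverP Op).
rewrite rootE hornerD hornerXn horner_poly.
move: px0; rewrite rootE horner_coef Dn big_ord_recr /= => /eqP/(congr1 ( *%R (a ^+ n))).
rewrite mulr0 mulrDr mulr_sumr => E; apply/eqP; rewrite -[RHS]E addrC; congr (_ + _).
  apply: eq_bigr => -[i /= lti] _.
  have -> : a ^+ n = a ^+ (n - i) * a ^+ i by rewrite -exprD subnK.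
  by rewrite exprMn; ring.
have -> : p`_n.+1 = a by rewrite /a lead_coefE Dn.
by rewrite exprMn exprS; ring.
Qed.

Lemma int_relation (x : L) : exists2 q : {poly int}, q != 0 & root (map_poly intr q) x.
Proof.
have [p [Dp mon_p] _] := minCpolyP (iota x).
have [q [a a0 Dq]] := rat_poly_scale p.
exists q.
  by apply: contraTneq mon_p => q0; rewrite Dq q0 map_poly0 scaler0 monicE lead_coef0 eq_sym oner_eq0.
have EQ (f : {rmorphism int -> algC}) : map_poly f q = map_poly intr q.
  by apply: eq_map_poly => z; rewrite -[z in f z]intz rmorph_int.
rewrite -(fmorph_root iota) -map_poly_comp EQ.
have : root (minCpoly (iota x)) (iota x) by exact: root_minCpoly.
rewrite Dp Dq map_polyZ rootZ; last by rewrite fmorph_eq0 invr_eq0 intr_eq0.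
by rewrite -map_poly_comp EQ.
Qed.

Lemma polyOver_intO_int (q : {poly int}) : map_poly intr q \is a polyOver intO.
Proof. by apply/polyOverP=> i; rewrite coef_map /= rpred_int. Qed.

Lemma intr_inj_num : injective (intr : int -> L).
Proof. by move=> a b /(congr1 iota); rewrite !rmorph_int => /intr_inj. Qed.

Lemma natr_num_eq0 (n : nat) : (n%:R == 0 :> L) = (n == 0%N).
Proof. by rewrite -(fmorph_eq0 iota) rmorph_nat pnatr_eq0. Qed.

Lemma intr_num_eq0 (n : int) : (n%:~R == 0 :> L) = (n == 0).
Proof. by rewrite -(fmorph_eq0 iota) rmorph_int intr_eq0. Qed.

Lemma intO_nat_mul (x : L) : exists2 k : nat, (0 < k)%N & k%:R * x \in intO.
Proof.
have [q q0 qx] := int_relation x.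
have := intO_lead (polyOver_intO_int q) qx.
rewrite lead_coef_map_inj //; last exact: intr_inj_num.
set c := lead_coef q => Oc; exists `|c|%N; first by rewrite absz_gt0 lead_coef_eq0.
have -> : (`|c|%N%:R : L) = (`|c|)%:~R by rewrite -abszE.
by have [c0|c0] := ger0P c; rewrite ?rmorphN ?mulNr ?rpredN.
Qed.

End IntegersOfNumberField.

Section PrimesOfNumberField.
Variables (L : splittingFieldType rat) (iota : {rmorphism L -> algC}).
Local Notation O := (intO iota).

(** Prime ideals of [intO] are predicates on [L], so that conjugation by the Galois group and
    localization take place inside one field. *)
Record primeO (Q : {pred L}) : Prop := PrimeO {
  primeO_sub : {subset Q <= O};
  primeO_0 : 0 \in Q;
  primeO_D : forall x y, x \in Q -> y \in Q -> x + y \in Q;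
  primeO_M : forall a x, a \in O -> x \in Q -> a * x \in Q;
  primeO_1 : 1 \notin Q;
  primeO_P : forall x y, x \in O -> y \in O -> x * y \in Q -> x \in Q \/ y \in Q }.

Import classical_sets.
Lemma primeO_exists (J : L -> Prop) :
    (forall x, J x -> x \in O) -> J 0 -> (forall x y, J x -> J y -> J (x + y)) ->
    (forall a x, a \in O -> J x -> J (a * x)) -> ~ J 1 ->
  exists2 Q : {pred L}, primeO Q & forall x, J x -> x \in Q.
Proof.
move=> JO J0 JD JM J1.
pose ideal (A : set L) := [/\ forall x, A x -> x \in O, A 0, forall x y, A x -> A y -> A (x + y),
  forall a x, a \in O -> A x -> A (a * x) & ~ A 1].
(* Zorn's lemma is applied to the sets whose union with [J] is a proper ideal: the empty chain is
   then admissible, its union giving [J] itself. *)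
have [F FP totF|A [PA maxA]] := @Zorn_bigcup L (fun A => ideal (setU A J)).
  split.
  - by move=> x [[X FX Xx]|/JO//]; have [+ _ _ _ _] := FP _ FX; apply; left.
  - by right.
  - move=> x y [[X FX Xx]|Jx] [[Y FY Yy]|Jy].
    + have [/(_ _ Xx) Yx|/(_ _ Yy) Xy] := totF _ _ FX FY.
        have [_ _ /(_ x y) + _ _] := FP _ FY; case; [by left|by left| |by right].
        by left; exists Y.
      have [_ _ /(_ x y) + _ _] := FP _ FX; case; [by left|by left| |by right].
      by left; exists X.
    + have [_ _ /(_ x y) + _ _] := FP _ FX; case; [by left|by right| |by right].
      by left; exists X.
    + have [_ _ /(_ x y) + _ _] := FP _ FY; case; [by right|by left| |by right].
      by left; exists Y.
    + by right; apply: JD.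
  - move=> a x Oa [[X FX Xx]|Jx]; last by right; apply: JM.
    have [_ _ _ /(_ a x Oa) + _] := FP _ FX; case; [by left| |by right].
    by left; exists X.
  - move=> [[X FX X1]|//].
    by have [_ _ _ _] := FP _ FX; case; left.
have {}maxA B : ideal B -> (forall x, (setU A J) x -> B x) -> forall x, B x -> (setU A J) x.
  move=> idB sAB x Bx; apply: contrapT => nAx.
  have BJ : setU B J = B.
    by apply/funext => y; apply/propext; split => [[//|Jy]|]; [apply: sAB; right|left].
  apply: (maxA B); last by rewrite BJ.
  by split=> [y Ay|sBA]; [apply: sAB; left|apply: nAx; left; apply: sBA].
case: PA => QO Q0 QD QM Q1.
pose Q : {pred L} := fun x => `[< (setU A J) x >].
have QE x : (x \in Q) = `[< (setU A J) x >] by [].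
exists Q; last by move=> x Jx; rewrite QE; apply/asboolP; right.
split.
- by move=> x /asboolP/QO.
- exact/asboolP.
- by move=> x y /asboolP Qx /asboolP Qy; apply/asboolP/QD.
- by move=> a x Oa /asboolP Qx; apply/asboolP/QM.
- exact/asboolP.
move=> x y Ox Oy Qxy.
have [Qx|nQx] := boolP (x \in Q); [by left|right].
(* The ideal [Q + x O]. If it contains 1, multiplying by [y] puts [y] in [Q]; otherwise maximality
   puts [x] in [Q]. *)
pose B : set L := fun z => exists q a, [/\ (setU A J) q, a \in O & z = q + a * x].
have [B1|nB1] := pselect (B 1).
  have [q [a [Qq Oa D1]]] := B1.
  rewrite -[y]mul1r D1 mulrDl; apply/asboolP; apply: QD.
    by rewrite mulrC; apply: QM.
  by rewrite -mulrA; apply: QM => //; apply/asboolP.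
case/asboolP: nQx; apply: (maxA B).
- split=> //.
  + by move=> z [q [a [Qq Oa ->]]]; apply: rpredD; [apply: QO|apply: rpredM].
  + by exists 0, 0; split; rewrite ?rpred0 // mul0r addr0.
  + move=> z1 z2 [q1 [a1 [Qq1 Oa1 ->]]] [q2 [a2 [Qq2 Oa2 ->]]].
    by exists (q1 + q2), (a1 + a2); split; [apply: QD|apply: rpredD|ring].
  + move=> b z Ob [q [a [Qq Oa ->]]].
    by exists (b * q), (b * a); split; [apply: QM|apply: rpredM|ring].
- by move=> z Qz; exists z, 0; rewrite rpred0 mul0r addr0.
- by exists 0, 1; rewrite rpred1 mul1r add0r.
Qed.

End PrimesOfNumberField.

Section PrimeTheory.
Variables (L : splittingFieldType rat) (iota : {rmorphism L -> algC}).
Local Notation O := (intO iota).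
Variables (Q : {pred L}) (prQ : primeO iota Q).

Lemma primeO_N x : x \in Q -> - x \in Q.
Proof. by rewrite -mulN1r; apply: (primeO_M prQ); rewrite rpredN1. Qed.

Lemma primeO_B x y : x \in Q -> y \in Q -> x - y \in Q.
Proof. by move=> Qx /primeO_N; apply: (primeO_D prQ). Qed.

Lemma primeO_sum (I : Type) (r : seq I) (P : pred I) (F : I -> L) :
  (forall i, P i -> F i \in Q) -> \sum_(i <- r | P i) F i \in Q.
Proof. by move=> QF; elim/big_ind: _ => //; [exact: (primeO_0 prQ)|exact: (primeO_D prQ)]. Qed.

Lemma primeO_prod (I : finType) (P : pred I) (F : I -> L) :
    (forall i, P i -> F i \in O) -> \prod_(i | P i) F i \in Q -> exists2 i, P i & F i \in Q.
Proof.
move=> OF; pose R y := y \in O /\ (y \in Q -> exists2 i, P i & F i \in Q).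
suffices [] : R (\prod_(i | P i) F i) by [].
elim/big_rec: _ => [|i y Pi [Oy IH]].
  by split; rewrite ?rpred1 // (negPf (primeO_1 prQ)).
split; first by rewrite rpredM ?OF.
by case/(primeO_P prQ (OF i Pi) Oy) => // QF; exists i.
Qed.

Variables (l : nat) (pr_l : prime l) (Ql : l%:R \in Q).

Lemma primeO_int (z : int) : (z%:~R \in Q) = (l %| z)%Z.
Proof.
apply/idP/idP => [Qz|/dvdzP[c ->]]; last first.
  by rewrite rmorphM /=; apply: (primeO_M prQ); rewrite ?rpred_int.
apply: contraT => ndv; case/negP: (primeO_1 prQ).
have /coprimezP[[u w] /= D1] : coprimez l z by rewrite coprimezE prime_coprime.
have -> : 1 = u%:~R * l%:R + w%:~R * z%:~R :> L by rewrite -[l%:R]/(l%:~R) -!rmorphM -rmorphD D1.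
by apply: (primeO_D prQ); apply: (primeO_M prQ); rewrite ?rpred_int.
Qed.

Definition locO x := exists a s, [/\ a \in O, s \in O, s \notin Q & x * s = a].

Lemma locO_intO x : x \in O -> locO x.
Proof. by move=> Ox; exists x, 1; rewrite mulr1 rpred1 (primeO_1 prQ). Qed.

Lemma locOM x y : locO x -> locO y -> locO (x * y).
Proof.
move=> [a [s [Oa Os Qs Da]]] [b [t [Ob Ot Qt Db]]].
exists (a * b), (s * t); split; rewrite ?rpredM //; last by rewrite -Da -Db; ring.
by apply/negP => /(primeO_P prQ Os Ot)[]; apply/negP.
Qed.

Lemma locOD x y : locO x -> locO y -> locO (x + y).
Proof.
move=> [a [s [Oa Os Qs Da]]] [b [t [Ob Ot Qt Db]]].
exists (a * t + b * s), (s * t); split; rewrite ?rpredD ?rpredM //; last by rewrite -Da -Db; ring.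
by apply/negP => /(primeO_P prQ Os Ot)[]; apply/negP.
Qed.

Lemma locO_frac x : locO x -> exists a s, [/\ a \in O, s \in O, s \notin Q & x = a / s].
Proof.
move=> [a [s [Oa Os Qs Da]]]; exists a, s; split=> //.
by rewrite -Da mulfK //; apply: contraNneq Qs => ->; apply: (primeO_0 prQ).
Qed.

(** The localization of the integers of [F] at the prime below [Q]. Numerator and denominator are
    both taken in [F], which is what later provides integral uniformizers of [F]. *)
Definition locF (F : {pred L}) x :=
  exists a s, [/\ a \in [predI O & F], s \in [predI O & F], s \notin Q & x * s = a].

Lemma locF_locO (F : {pred L}) x : locF F x -> locO x.
Proof. by move=> [a [s [/andP[Oa _] /andP[Os _] Qs Da]]]; exists a, s. Qed.

(** If [a] is the leading coefficient, [a x] is integral. Should [a] or [a x] lie outside [Q], then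
    [x = (a x) / a] or its inverse is a fraction of the required form; should both lie in [Q], the
    degree can be lowered without changing the coefficients modulo [Q]. *)
Lemma locF_horner (F : divringClosed L) x (f : {poly L}) : x \in F -> x != 0 ->
    f \is a polyOver F -> f \is a polyOver O -> root f x ->
  (exists i, f`_i \notin Q) -> locF F x \/ locF F x^-1.
Proof.
move=> Fx x0; have [n] := ubnP (size f); elim: n f => // n IH f /ltnSE sf Ff Of fx [i Qi].
have Of_ j : f`_j \in O by exact: (polyOverP Of).
have Ff_ j : f`_j \in F by exact: (polyOverP Ff).
set a := lead_coef f; have Oa : a \in [predI O & F] by rewrite /a lead_coefE; apply/andP; split; [exact: Of_|exact: Ff_].
have [/= Oa1 Fa1] := andP Oa.
have Oy : a * x \in [predI O & F].
  by apply/andP; split; [exact: intO_lead|rewrite /= rpredM].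
have [/= Oy1 Fy1] := andP Oy.
have f0 : f != 0 by apply: contraNneq Qi => ->; rewrite coef0 (primeO_0 prQ).
have sf1 : (1 < size f)%N.
  rewrite ltnNge; apply: contra f0 => sf1; move: fx; rewrite (size1_polyC sf1) rootC => /eqP->.
  by rewrite polyC0.
have [Qa|nQa] := boolP (a \in Q); last by left; exists (a * x), a; split=> //; rewrite mulrC.
have [Qy|nQy] := boolP (a * x \in Q); last first.
  by right; exists a, (a * x); split=> //; rewrite mulrCA mulVf ?mulr1.
have Df : size f = (size f).-2.+2 by move: sf1; case: (size f) => [|[]].
set m := (size f).-2 in Df.
(* The leading term [a X^(m+1)] is traded for [(a x) X^m], which has the same value at [x]. *)
pose h := f - a *: 'X^(m.+1) + (a * x) *: 'X^m.
have ch j : h`_j = f`_j - a * (j == m.+1)%:R + a * x * (j == m)%:R.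
  by rewrite /h coefD coefB !coefZ !coefXn.
have Da : f`_m.+1 = a by rewrite /a lead_coefE Df.
apply: (IH h).
- rewrite (leq_trans _ sf) // Df ltnS; apply/leq_sizeP => j; rewrite leq_eqVlt => /predU1P[<-|ltj].
    by rewrite ch eqxx Da gtn_eqF // mulr1 mulr0 addr0 subrr.
  rewrite ch (gtn_eqF ltj) (gtn_eqF (ltnW ltj)) !mulr0 subr0 addr0.
  by apply/leq_sizeP: ltj; rewrite Df.
- apply/polyOverP => j; rewrite ch.
  by apply: rpredD; [apply: rpredB; [exact: Ff_|apply: rpredM]|apply: rpredM]; rewrite ?rpred_nat.
- apply/polyOverP => j; rewrite ch.
  by apply: rpredD; [apply: rpredB; [exact: Of_|apply: rpredM]|apply: rpredM]; rewrite ?rpred_nat.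
- rewrite rootE /h !(hornerD, hornerN) !hornerZ !hornerXn (rootP fx) exprS; apply/eqP; ring.
have nei : i != m.+1 by apply: contraNneq Qi => ->; rewrite Da.
exists i; rewrite ch (negPf nei) mulr0 subr0.
have [_|_] := eqVneq i m; rewrite /= ?mulr0 ?addr0 ?mulr1 //.
by apply: contra Qi => Q1; rewrite -(addrK (a * x) f`_i) primeO_B.
Qed.

(** A primitive integer relation of [x] has a coefficient not divisible by [l], that is, outside
    [Q]. So the localization is a valuation ring of [F]. *)
Lemma locF_total (F : divringClosed L) x : x \in F -> x != 0 -> locF F x \/ locF F x^-1.
Proof.
move=> Fx x0; have [q q0 qx] := int_relation iota x.
have zc0 : zcontents q != 0 by rewrite zcontents_eq0.
apply: (@locF_horner F x (map_poly intr (zprimitive q))) => //.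
- by apply/polyOverP => i; rewrite coef_map /= rpred_int.
- exact: polyOver_intO_int.
- move: qx; rewrite {1}[q]zpolyEprim map_polyZ rootZ //=.
  by rewrite intr_num_eq0.
apply: contrapT => nex.
have : (l %| zcontents (zprimitive q))%Z.
  rewrite dvdz_contents; apply/polyOverP => i; rewrite -primeO_int.
  by apply: contrapT => /negP nQ; apply: nex; exists i; rewrite coef_map.
rewrite zcontents_primitive (negPf q0) /= dvdz1 absz_nat => /eqP l1.
by move: pr_l; rewrite l1.
Qed.

Lemma locO_total x : x != 0 -> locO x \/ locO x^-1.
Proof.
move=> x0.
by have [/locF_locO|/locF_locO] := @locF_total {:L}%AS x (memvf x) x0; [left|right].
Qed.

Lemma locO_lV : ~ locO (l%:R^-1).
Proof.
move=> [a [s [Oa Os Qs Da]]]; case/negP: Qs.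
have l0 : l%:R != 0 :> L by rewrite natr_num_eq0 // -lt0n prime_gt0.
have -> : s = a * l%:R by rewrite -Da mulrC mulVKf.
exact: (primeO_M prQ).
Qed.

End PrimeTheory.

(** * Valuations *)

Section Valuation.
Variables (F : fieldType) (v : F -> int).

Record valuation : Prop := Valuation {
  valM : forall x y, x != 0 -> y != 0 -> v (x * y) = v x + v y;
  valD : forall x y k, x != 0 -> y != 0 -> x + y != 0 -> k <= v x -> k <= v y -> k <= v (x + y) }.

(* The value of 0 is a junk integer, hence the separate treatment of 0. *)
Definition vge (k : int) (x : F) : bool := (x == 0) || (k <= v x).

Hypothesis hv : valuation.

Lemma val1 : v 1 = 0.
Proof. have : v 1 = v 1 + v 1 by rewrite -(valM hv) ?oner_neq0 // mulr1. lia. Qed.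

Lemma valV x : x != 0 -> v x^-1 = - v x.
Proof.
by move=> x0; apply/eqP; rewrite -addr_eq0 addrC -(valM hv) ?invr_neq0 // mulfV // val1.
Qed.

Lemma valX x n : x != 0 -> v (x ^+ n) = v x * n%:Z.
Proof.
move=> x0; elim: n => [|n IH]; first by rewrite expr0 val1; lia.
by rewrite exprS valM ?expf_neq0 // IH; lia.
Qed.

Lemma valN1 : v (-1) = 0.
Proof.
have n1 : -1 != 0 :> F by rewrite oppr_eq0 oner_neq0.
have : v (-1) + v (-1) = 0 by rewrite -(valM hv) // mulrNN mulr1 val1.
lia.
Qed.

Lemma vge0 k : vge k 0. Proof. by rewrite /vge eqxx. Qed.

Lemma vge_le k j x : j <= k -> vge k x -> vge j x.
Proof. by rewrite /vge; case: eqP => //= _; lia. Qed.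

Lemma vgeM k j x y : vge k x -> vge j y -> vge (k + j) (x * y).
Proof.
rewrite /vge mulf_eq0; case: (eqVneq x 0) => //= x0; case: (eqVneq y 0) => //= y0.
by rewrite (valM hv) //; lia.
Qed.

Lemma vgeD k x y : vge k x -> vge k y -> vge k (x + y).
Proof.
rewrite /vge; case: (eqVneq x 0) => [->|x0] /=; first by rewrite add0r.
case: (eqVneq y 0) => [->|y0] /=; first by rewrite addr0 (negPf x0).
by case: (eqVneq (x + y) 0) => //= xy0; apply: (valD hv).
Qed.

Lemma vge_1 : vge 0 1. Proof. by rewrite /vge val1 orbT. Qed.

Lemma vgeN k x : vge k (- x) = vge k x.
Proof.
suffices H y : vge k y -> vge k (- y) by apply/idP/idP => /H; rewrite ?opprK.
by rewrite -mulN1r -{2}[k]add0r; apply: vgeM; rewrite /vge valN1 orbT.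
Qed.

Lemma vgeB k x y : vge k x -> vge k y -> vge k (x - y).
Proof. by move=> vx vy; rewrite vgeD // vgeN. Qed.

Lemma vge_sum (I : Type) (r : seq I) (P : pred I) (f : I -> F) k :
  (forall i, P i -> vge k (f i)) -> vge k (\sum_(i <- r | P i) f i).
Proof. by move=> H; elim/big_ind: _ => //; [exact: vge0|exact: vgeD]. Qed.

Lemma vge0M x y : vge 0 x -> vge 0 y -> vge 0 (x * y).
Proof. exact: (@vgeM 0 0). Qed.

Lemma vge0X x n : vge 0 x -> vge 0 (x ^+ n).
Proof. by move=> vx; elim: n => [|n IH]; rewrite ?vge_1 // exprS vge0M. Qed.

Lemma vge_nat n : vge 0 n%:R.
Proof. by elim: n => [|n IH]; rewrite ?vge0 // -natr1 vgeD ?vge_1. Qed.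

Lemma vge_int n : vge 0 n%:~R.
Proof. by case: n => n; rewrite ?NegzE ?rmorphN ?vgeN vge_nat. Qed.

Lemma vgeMl k x y : vge 0 x -> vge k y -> vge k (x * y).
Proof. by move=> vx vy; rewrite -[k]add0r vgeM. Qed.

Lemma vgeMr k x y : vge k x -> vge 0 y -> vge k (x * y).
Proof. by move=> vx vy; rewrite mulrC vgeMl. Qed.

Lemma vge_div k x y : y != 0 -> vge (k + v y) x -> vge k (x / y).
Proof.
move=> y0 vx; rewrite (_ : k = k + v y + (- v y)); last by lia.
by apply: vgeM => //; rewrite /vge valV // lexx orbT.
Qed.

Lemma val_ge k x : x != 0 -> vge k x -> k <= v x.
Proof. by rewrite /vge => /negPf->. Qed.

Lemma vge1_1 : ~~ vge 1 1.
Proof. by rewrite /vge oner_eq0 val1. Qed.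

(** In a vanishing sum the least value is attained twice: a single term of least value would be
    minus a sum of terms of greater value. *)
Lemma val_sum_eq (I : finType) (f : I -> F) (i0 : I) :
    f i0 != 0 -> \sum_i f i = 0 -> exists i j, [/\ i != j, f i != 0, f j != 0 & v (f i) = v (f j)].
Proof.
move=> f0 sf; have [i fi mini] := @arg_minP _ _ _ i0 (fun i => f i != 0) (fun i => v (f i)) f0.
apply: contrapT => nex; have vlt j : j != i -> vge (v (f i) + 1) (f j).
  move=> ji; rewrite /vge; have [//|fj] := eqVneq (f j) 0.
  rewrite /=; have : v (f i) <= v (f j) by exact: mini.
  rewrite le_eqVlt => /orP[/eqP E|]; last by lia.
  by case: nex; exists j, i.
have : vge (v (f i) + 1) (- f i).
  move: sf; rewrite (bigD1 i) //= addrC => /eqP; rewrite addr_eq0 => /eqP <-.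
  by apply: vge_sum => j; apply: vlt.
by rewrite vgeN /vge (negPf fi) /=; lia.
Qed.

End Valuation.

(** * The valuation attached to a prime *)

Section ValuationOfPrime.
Variables (L : splittingFieldType rat) (iota : {rmorphism L -> algC}).
Local Notation gT := (gal_of {:L}).
Local Notation O := (intO iota).
Variables (Q : {pred L}) (prQ : primeO iota Q) (l : nat) (pr_l : prime l) (Ql : l%:R \in Q).

Local Notation loc := (locO iota Q).
Definition loc_unit x := [/\ x != 0, loc x & loc x^-1].

Lemma loc_unitM x y : loc_unit x -> loc_unit y -> loc_unit (x * y).
Proof.
move=> [x0 lx lxV] [y0 ly lyV]; split; first by rewrite mulf_neq0.
  exact: locOM.
by rewrite invfM; apply: locOM.
Qed.

Lemma loc_unitV x : loc_unit x -> loc_unit x^-1.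
Proof. by case=> x0 lx lxV; split; rewrite ?invrK ?invr_neq0. Qed.

Lemma loc_unit1 : loc_unit 1.
Proof. by split; rewrite ?invr1 ?oner_neq0 //; apply: locO_intO (rpred1 _). Qed.

Lemma loc_unitX x n : loc_unit x -> loc_unit (x ^+ n).
Proof.
by move=> ux; elim: n => [|n IH]; [exact: loc_unit1|rewrite exprS; apply: loc_unitM].
Qed.

Let l0 : l%:R != 0 :> L.
Proof. by rewrite natr_num_eq0 // -lt0n prime_gt0. Qed.

Lemma loc_unit_lX (k : int) : loc_unit (l%:R ^ k) -> k = 0.
Proof.
wlog: k / 0 <= k => [H uk|k0].
  have [k0|k0] := leP 0 k; first exact: H.
  apply: oppr_inj; rewrite oppr0; apply: H; first by lia.
  by rewrite -exprz_inv exprz_inv -invr_expz; apply: loc_unitV.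
case: k k0 => // [[//|n]] _ [_ _]; rewrite -exprnP exprS invfM => lV.
case: (locO_lV prQ pr_l Ql); rewrite -[_^-1](divfK (expf_neq0 n l0)).
by apply: locOM => //; apply: locO_intO (rpredX _ (rpred_nat _ _)).
Qed.

Lemma loc_unit_nat m : (0 < m)%N -> exists k : nat, loc_unit (m%:R / l%:R ^+ k).
Proof.
move=> m0; have [m' ndv Dm] := pfactor_coprime pr_l m0.
exists (logn l m); rewrite {1}Dm natrM natrX mulfK ?expf_neq0 //.
have nQ : m'%:R \notin Q.
  by rewrite -[m'%:R]/(m'%:~R) (primeO_int prQ pr_l Ql) dvdzE -prime_coprime.
have m'0 : m'%:R != 0 :> L by apply: contraNneq nQ => ->; apply: primeO_0 prQ.
split=> //; first exact: locO_intO (rpred_nat _ _).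
by exists 1, m'%:R; rewrite mulVf ?rpred1 ?rpred_nat.
Qed.

Lemma loc_unit_rat (r : rat) : r != 0 -> exists k : int, loc_unit (ratr r / l%:R ^ k).
Proof.
move=> r0; have n0 : (0 < `|numq r|)%N by rewrite absz_gt0 numq_eq0.
have d0 : (0 < `|denq r|)%N by rewrite absz_gt0 denq_neq0.
have [k uk] := loc_unit_nat n0; have [j uj] := loc_unit_nat d0.
exists (k%:Z - j%:Z).
have : loc_unit (((-1) ^+ (r < 0)%R * (`|numq r|%:R / l%:R ^+ k)) / (`|denq r|%:R / l%:R ^+ j)).
  apply: loc_unitM (loc_unitV uj); apply: loc_unitM uk; apply: loc_unitX.
  by split; rewrite ?invrN1 ?oppr_eq0 ?oner_eq0 //; apply: locO_intO (rpredN1 _).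
congr loc_unit.
have -> : l%:R ^ (k%:Z - j%:Z) = l%:R ^+ k / l%:R ^+ j :> L by rewrite expfzDr // -exprnN.
have -> : ratr r = (-1) ^+ (r < 0)%R * `|numq r|%:R / `|denq r|%:R :> L.
  rewrite /ratr -{1}[denq r]absz_denq; congr (_ / _).
  by rewrite {1}[numq r]intEsign rmorphM rmorphXn /= rmorphN1 -numq_lt0.
rewrite !invfM !invrK; ring.
Qed.

(** Divisibility in a valuation ring is total, so some member of a finite family divides all others.
    It stands for a term of least value while no valuation is available. *)
Lemma loc_min (s : seq L) x0 : x0 \in s -> x0 != 0 ->
  exists2 y, y \in s /\ y != 0 & forall z, z \in s -> loc (z / y).
Proof.
elim: s x0 => // a s IH x0; rewrite inE => xs nx0.
have loc1 : loc 1 by apply: locO_intO (rpred1 _).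
have loc0 : loc 0 by apply: locO_intO (rpred0 _).
have [/hasP[x1 s1 nx1]|/hasPn sn] := boolP (has (fun x => x != 0) s).
  have [y [ys y0] miny] := IH _ s1 nx1.
  have [a0|a0] := eqVneq a 0.
    exists y; first by rewrite inE ys orbT.
    by move=> z; rewrite inE => /predU1P[->|/miny//]; rewrite a0 mul0r.
  have ay : a / y != 0 by rewrite mulf_neq0 ?invr_neq0.
  have [lay|lya] := locO_total prQ pr_l Ql ay.
    exists y; first by rewrite inE ys orbT.
    by move=> z; rewrite inE => /predU1P[->|/miny].
  exists a; first by rewrite inE eqxx.
  move=> z; rewrite inE => /predU1P[->|/miny zy]; first by rewrite divff.
  have -> : z / a = (z / y) * (a / y)^-1 by rewrite invf_div mulrA divfK.
  exact: locOM.
have a0 : a != 0.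
  by case/predU1P: xs => [<- //|xs]; move/negP: (sn _ xs); rewrite nx0.
exists a; first by rewrite inE eqxx.
move=> z; rewrite inE => /predU1P[->|/sn]; first by rewrite divff.
by rewrite negbK => /eqP->; rewrite mul0r.
Qed.

Lemma loc_nonunitD x y : loc x -> loc y -> ~ loc_unit x -> ~ loc_unit y -> ~ loc_unit (x + y).
Proof.
move=> lx ly ux uy [xy0 _ lV].
have [x0|x0] := eqVneq x 0; first by apply: uy; split=> //; rewrite x0 add0r in xy0 lV.
have [y0|y0] := eqVneq y 0; first by apply: ux; split=> //; rewrite y0 addr0 in xy0 lV.
have loc1 : loc 1 by apply: locO_intO (rpred1 _).
have xy : x / y != 0 by rewrite mulf_neq0 ?invr_neq0.
have [lxy|lyx] := locO_total prQ pr_l Ql xy.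
  apply: uy; split=> //; have -> : y^-1 = (x / y + 1) / (x + y) by field; rewrite xy0.
  by apply: locOM => //; apply: locOD.
apply: ux; split=> //; rewrite invf_div in lyx.
have -> : x^-1 = (1 + y / x) / (x + y) by field; rewrite xy0.
by apply: locOM => //; apply: locOD.
Qed.

(** The principle of [val_sum_eq] in terms of divisibility, since the valuation is still to be
    constructed from it. *)
Lemma loc_sum_eq (I : finType) (f : I -> L) (i0 : I) :
    f i0 != 0 -> \sum_i f i = 0 ->
  exists i j, [/\ i != j, f i != 0, f j != 0 & loc_unit (f i / f j)].
Proof.
move=> f0 sf; have cf i : f i \in codom f by apply: codom_f.
have [_ [/codomP[i ->] fi] mini] := loc_min (cf i0) f0.
apply: contrapT => nex.
have loc0 : loc 0 by apply: locO_intO (rpred0 _).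
pose R x := loc x /\ ~ loc_unit x.
have : R (\sum_(j | j != i) f j / f i).
  elim/big_ind: _ => [|x y [lx ux] [ly uy]|j ji].
  - by split=> // -[]; rewrite eqxx.
  - by split; [apply: locOD|apply: loc_nonunitD].
  split; first exact: mini.
  by move=> u; apply: nex; exists j, i; split=> //; apply: contraTneq fi => fj0; case: u; rewrite fj0 mul0r eqxx.
move: sf; rewrite (bigD1 i) //= addrC => /eqP; rewrite addr_eq0 -mulr_suml => /eqP->.
rewrite mulNr divff // => -[_]; apply.
by split; rewrite ?invrN1 ?oppr_eq0 ?oner_eq0 //; apply: locO_intO (rpredN1 _).
Qed.

(** The product of the [X - g x] has rational coefficients. Two of its terms at [x] are associates,
    and their quotient is a power of [x], with exponent at most the degree up to sign, times a
    rational number, itself a unit times a power of [l]. Values thus have bounded denominators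
    relative to that of [l]. *)
Lemma loc_unit_power x : x != 0 ->
  exists d k, [/\ (0 < d <= #|{: gT}|)%N & loc_unit (x ^+ d / l%:R ^ k)].
Proof.
move=> x0; pose F := \prod_(g : gT) ('X - (g x)%:P).
have fixF (h : gT) : map_poly h F = F.
  rewrite /F rmorph_prod /= [RHS](reindex_inj (mulIg h)) /=; apply: eq_bigr => g _.
  by rewrite rmorphB /= map_polyX map_polyC /= galM ?memvf.
have sF : size F = #|{: gT}|.+1 by rewrite /F size_prod_XsubC -sum1_size -sum1_card.
have mF : F \is monic by apply: monic_prod_XsubC.
have rF i : exists r : rat, F`_i = ratr r.
  by apply: gal_fixed_rat => g; rewrite -coef_map fixF.
have F0 : \sum_(i < #|{: gT}|.+1) F`_i * x ^+ i = 0.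
  rewrite -sF -horner_coef /F horner_prod (bigD1 1%g) //= !hornerE gal_id subrr mul0r //.
have [|i [j [ij fi fj uij]]] := loc_sum_eq (i0 := ord_max) _ F0.
  by rewrite /= -[#|_|]/(#|{: gT}|.+1.-1) -sF -lead_coefE (monicP mF) mul1r expf_neq0.
wlog ltij : i j ij fi fj uij / (i < j)%N.
  move=> H; have := ij; rewrite -val_eqE neq_ltn => /orP[|ltji]; first exact: H.
  by apply: (H j i); rewrite // 1?eq_sym // -invf_div; apply: loc_unitV.
have {}rF (a : 'I_(#|{: gT}|.+1)) : F`_a != 0 -> exists2 r : rat, r != 0 & F`_a = in_alg L r.
  move=> Fa; have [r Dr] := rF a; exists r; last by rewrite Dr /= alg_num_field.
  by apply: contraNneq Fa => r0; rewrite Dr -alg_num_field r0 scale0r.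
have Fnz (a : 'I_(#|{: gT}|.+1)) : F`_a * x ^+ a != 0 -> F`_a != 0.
  by rewrite mulf_eq0 negb_or => /andP[].
have [[r r0 Dr] [s s0 Ds]] := (rF i (Fnz i fi), rF j (Fnz j fj)).
have [k uk] := loc_unit_rat (mulf_neq0 r0 (invr_neq0 s0)).
exists (j - i)%N, k; rewrite subn_gt0 ltij (leq_trans (leq_subr _ _)) -1?ltnS //; split=> //.
have : loc_unit ((F`_i * x ^+ i / (F`_j * x ^+ j))^-1 * (ratr (r / s) / l%:R ^ k)).
  by apply: loc_unitM => //; apply: loc_unitV.
congr loc_unit; rewrite Dr Ds -alg_num_field -in_algE fmorph_div.
have -> : x ^+ j = x ^+ (j - i) * x ^+ i by rewrite -exprD subnK // ltnW.
have r0' : in_alg L r != 0 by rewrite fmorph_eq0.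
have s0' : in_alg L s != 0 by rewrite fmorph_eq0.
have xi : x ^+ i != 0 by rewrite expf_neq0.
have lk : l%:R ^ k != 0 :> L by rewrite expfz_neq0.
have xji : x ^+ (j - i) != 0 by rewrite expf_neq0.
by field; apply/and5P; split; assumption.
Qed.

(* With N = n! for n the degree, the value of x is the k such that x^N / l^k is a unit at Q. *)
Lemma valuation_exists : exists v : L -> int,
  [/\ valuation v, 0 < v l%:R, forall x, x != 0 -> (0 <= v x <-> loc x)
    & forall x, x \in O -> vge v 1 x = (x \in Q)].
Proof.
have [N N0 exk] : exists2 N, (0 < N)%N & forall x, exists k : int, x != 0 -> loc_unit (x ^+ N / l%:R ^ k).
  exists #|{: gT}|`!; first exact: fact_gt0.
  move=> x; have [->|x0] := eqVneq x 0; first by exists 0.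
  have [d [k [/dvdn_fact/dvdnP[c ->] u]]] := loc_unit_power x0.
  exists (k * c) => _; rewrite mulnC exprM -exprz_exp -exprnP.
  by have := loc_unitX c u; rewrite exprMn exprVn.
have [v Dv] := choice exk.
have v_uniq x k : x != 0 -> loc_unit (x ^+ N / l%:R ^ k) -> v x = k.
  move=> x0 uk; apply/eqP; rewrite -subr_eq0; apply/eqP/loc_unit_lX.
  have xN : x ^+ N != 0 by rewrite expf_neq0.
  have lk : l%:R ^ k != 0 :> L by rewrite expfz_neq0.
  have lv : l%:R ^ v x != 0 :> L by rewrite expfz_neq0.
  have := loc_unitM uk (loc_unitV (Dv _ x0)); congr loc_unit.
  by rewrite expfzDr // -invr_expz; field; rewrite xN lk lv.
have loc_l k : 0 <= k -> loc (l%:R ^ k).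
  by case: k => // k _; apply: locO_intO => //; rewrite -exprnP rpredX ?rpred_nat.
have locX x n : loc x -> loc (x ^+ n).
  move=> lx; elim: n => [|n IH]; rewrite ?expr0 ?exprS; last exact: locOM.
  by apply: locO_intO => //; apply: rpred1.
have vP x : x != 0 -> reflect (loc x) (0 <= v x).
  move=> x0; have [_ u uV] := Dv x x0.
  have lv k : l%:R ^ k != 0 :> L by rewrite expfz_neq0.
  apply: (iffP idP) => [v0|lx].
    have lxN : loc (x ^+ N) by rewrite -(divfK (lv (v x)) (x ^+ N)); apply: locOM => //; apply: loc_l.
    have [//|lxV] := locO_total prQ pr_l Ql x0.
    (* If [x^-1] is in the localization, so is [x = x^N * (x^-1)^(N-1)]. *)
    rewrite -[x](mulfK (expf_neq0 N.-1 x0)) -exprS prednK // -exprVn.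
    by apply: locOM => //; apply: locX.
  rewrite leNgt; apply/negP => v0; case: (locO_lV prQ pr_l Ql).
  have lxN := locX x N lx.
  (* With [v x] negative, [x^N] is a unit times a negative power of [l], so that [l^-1] would lie in
     the localization. *)
  have -> : l%:R^-1 = (x ^+ N / l%:R ^ v x)^-1 * x ^+ N * l%:R ^ (- v x - 1) :> L.
    have xN : x ^+ N != 0 by rewrite expf_neq0.
    rewrite invf_div divfK // -expfzDr // -[LHS]exprN1; congr (_ ^ _); lia.
  by apply: locOM => //; [apply: locOM|apply: loc_l; lia].
have hv : valuation v.
  have vM x y : x != 0 -> y != 0 -> v (x * y) = v x + v y.
    move=> x0 y0; apply: v_uniq; first by rewrite mulf_neq0.
    have := loc_unitM (Dv x x0) (Dv y y0); congr loc_unit.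
    by rewrite expfzDr // exprMn invfM; ring.
  split=> // x y k x0 y0 xy0.
  wlog: x y x0 y0 xy0 / v x <= v y => [H kx ky|vxy kx _].
    have [vxy|vyx] := leP (v x) (v y); first exact: H.
    by rewrite addrC; apply: H; rewrite 1?addrC ?(ltW vyx).
  apply: le_trans kx _.
  have vV z : z != 0 -> v z^-1 = - v z.
    move=> z0; have := vM _ _ z0 (invr_neq0 z0); rewrite divff //.
    have -> : v 1 = 0 by have := vM _ _ (oner_neq0 L) (oner_neq0 L); rewrite mulr1 => /eqP; rewrite -subr_eq subrr => /eqP.
    by move/esym/eqP; rewrite addrC addr_eq0 => /eqP.
  have lyx : loc (y / x).
    by apply/vP; rewrite ?mulf_neq0 ?invr_neq0 // vM ?invr_neq0 // vV // subr_ge0.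
  rewrite -subr_ge0 -vV // -vM ?invr_neq0 //; apply/vP; first by rewrite mulf_neq0 ?invr_neq0.
  by rewrite mulrDl divff //; apply: locOD => //; apply: locO_intO => //; apply: rpred1.
have vl : v l%:R = N.
  by apply: v_uniq => //; rewrite -exprnP divff ?expf_neq0 //; apply: loc_unit1.
exists v; split=> // [|x x0|x Ox]; first by rewrite vl ltz_nat.
  by split=> /(vP x x0).
rewrite /vge; have [->|x0] /= := eqVneq x 0; first by rewrite (primeO_0 prQ).
apply/idP/idP => [v1|Qx].
  apply: contraLR v1 => nQx; rewrite -ltNge.
  have lV : loc x^-1 by exists 1, x; rewrite mulVf ?rpred1.
  have /(vP _ (invr_neq0 x0)) := lV; rewrite (valV hv) //; lia.
have v0 : 0 <= v x by apply/vP => //; apply: locO_intO.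
rewrite leNgt; apply/negP => v1; have vx : v x = 0 by lia.
have /(vP _ (invr_neq0 x0)) [a [s [Oa Os nQs Da]]] : 0 <= v x^-1 by rewrite (valV hv) // vx.
by case/negP: nQs; rewrite -[s](mulVKf x0) Da mulrC; apply: (primeO_M prQ).
Qed.

End ValuationOfPrime.

(** * Inertia and tame ramification *)

Section TameInertia.
Variables (L : fieldType) (v : L -> int) (hv : valuation v).

Lemma vge_binomial k x y n : 0 <= k -> vge v 0 x -> vge v k y ->
  vge v (k + k) ((x + y) ^+ n - x ^+ n - n%:R * x ^+ n.-1 * y).
Proof.
move=> k0 vx vy; have vy0 := vge_le k0 vy.
case: n => [|n]; first by rewrite !expr0 subrr !mul0r subr0 vge0.
elim: n => [|n IH].
  by rewrite !expr1 expr0 (_ : _ - _ = 0) ?vge0 //; ring.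
rewrite (_ : _ - _ = (x + y) * ((x + y) ^+ n.+1 - x ^+ n.+1 - n.+1%:R * x ^+ n * y)
   + n.+1%:R * x ^+ n * (y * y)); last by rewrite /= -[n.+2%:R]natr1 !exprS; ring.
apply: (vgeD hv); first by apply: (vgeMl hv) => //; apply: (vgeD hv).
apply: (vgeMl hv); last exact: (vgeM hv).
by apply: (vge0M hv); [apply: (vge_nat hv)|apply: (vge0X hv)].
Qed.

Variables (s : {rmorphism L -> L}) (F : divringClosed L) (d : int) (pi : L) (q : nat).
Hypotheses (vs : forall x, x != 0 -> v (s x) = v x).
Hypotheses (inert : forall x, vge v 0 x -> vge v 1 (s x - x)).
Hypotheses (sF : forall x, x \in F -> s x \in F).
Hypotheses (d0 : 0 < d) (Fpi : pi \in F) (pi0 : pi != 0) (vpi : v pi = d).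
Hypotheses (dmin : forall x, x \in F -> vge v 1 x -> vge v d x).
Hypotheses (vq : vge v 1 q%:R) (resF : forall x, x \in F -> vge v 0 x -> vge v 1 (x ^+ q - x)).

(** [P n] says that [s] acts trivially on the integral elements of [F] modulo [pi^n], as in the
    ramification group of index [n - 1]; the residue of [1 + c] is the tame character of [s]. *)
Let P (n : nat) := forall x, x \in F -> vge v 0 x -> vge v (n%:Z * d) (s x - x).
Let c := s pi / pi - 1.

Let Fc : c \in F. Proof. by rewrite rpredB ?rpred1 ?rpred_div ?sF. Qed.
Let Dspi : s pi = pi * (1 + c). Proof. by rewrite /c addrC subrK mulrC divfK. Qed.

Let P1 : P 1.
Proof.
by move=> x Fx vx; rewrite mul1r; apply: dmin; [rewrite rpredB ?sF|apply: inert].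
Qed.

(** Write [x = x^q + pi y]. The displacement of [x^q] gains a factor [pi]: its linear term carries
    [q], and the other terms are at least quadratic in [s x - x]. That of [pi y] is
    [s pi (s y - y) + pi c y], with a factor [pi] in both terms. *)
Let P_step n : (0 < n)%N -> P n -> vge v (n%:Z * d) c -> P n.+1.
Proof.
move=> n0 Pn vc x Fx vx.
have v0nd : 0 <= n%:Z * d by rewrite mulr_ge0 // ltW.
have Dnd : n.+1%:Z * d = n%:Z * d + d by lia.
have led : d <= n%:Z * d by rewrite ler_peMl // ltW.
pose y := (x - x ^+ q) / pi.
have Fy : y \in F by rewrite rpred_div // rpredB // rpredX.
have vy : vge v 0 y.
  apply: (vge_div hv) => //; rewrite add0r vpi; apply: dmin; first by rewrite rpredB ?rpredX.
  by rewrite -(vgeN hv) opprB; apply: resF.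
have Dx : x = x ^+ q + pi * y by rewrite mulrC divfK // addrC subrK.
pose e := s x - x; have ve : vge v (n%:Z * d) e by apply: Pn.
have -> : s x - x = ((x + e) ^+ q - x ^+ q - q%:R * x ^+ q.-1 * e) + q%:R * x ^+ q.-1 * e
    + (s pi * (s y - y) + pi * c * y).
  have Dsx : s x = (x + e) ^+ q + s pi * s y.
    by rewrite {1}Dx rmorphD rmorphXn rmorphM /= /e [x + _]addrC subrK.
  transitivity ((x + e) ^+ q + s pi * s y - (x ^+ q + pi * y)); first by congr (_ - _).
  by rewrite Dspi; ring.
rewrite Dnd; apply: (vgeD hv); [apply: (vgeD hv)|apply: (vgeD hv)].
- by apply: vge_le (vge_binomial q v0nd vx ve); rewrite lerD2l.
- rewrite addrC; apply: (vgeM hv) => //; apply: (vgeMr hv); last exact: (vge0X hv).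
  by apply: dmin; rewrite ?rpred_nat.
- rewrite addrC; apply: (vgeM hv); last exact: Pn.
  by rewrite /vge -vpi vs // lexx orbT.
apply: (vgeMr hv) => //; rewrite addrC; apply: (vgeM hv) => //.
by rewrite /vge -vpi lexx orbT.
Qed.

Let vc_prev n : P n.+2 -> vge v (n.+1%:Z * d) c.
Proof.
move=> Pn; have -> : c = (s pi - pi) / pi by rewrite mulrBl divff.
apply: (vge_div hv) => //; rewrite vpi (_ : _ + d = n.+2%:Z * d); last by lia.
by apply: Pn => //; rewrite /vge vpi ltW ?orbT.
Qed.

(** [P_step] needs [c] to have value [n d], while [P n] alone gives [(n - 1) d]. Once this gap is
    closed, which is the role of tameness, [s x - x] has arbitrarily large value and must vanish. *)
Let fixed_of_c : vge v 1 c -> (forall n, P n.+2 -> vge v (n.+2%:Z * d) c) ->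
  forall x, x \in F -> s x = x.
Proof.
move=> vc1 vcn; have allP n : P n.+1.
  elim: n => [|n IH] //; apply: P_step => //.
  case: n IH => [|n] IH; last exact: vcn.
  by rewrite mul1r; apply: dmin.
have fix0 x : x \in F -> vge v 0 x -> s x = x.
  move=> Fx vx; apply/eqP; rewrite -subr_eq0; apply: contraT => nz.
  have := allP `|v (s x - x)|%N x Fx vx; rewrite /vge (negPf nz) /=.
  have : 0 <= v (s x - x) by apply: (val_ge nz); apply: vge_le (inert vx).
  by nia.
move=> x Fx; have [vx|] := boolP (vge v 0 x); first exact: fix0.
rewrite /vge negb_or => /andP[x0 vx]; apply: invr_inj; rewrite -fmorphV.
by apply: fix0; rewrite ?rpredV // /vge (valV hv) // orbC; lia.
Qed.

Let le_double n : n.+2%:Z <= n.+1%:Z + n.+1%:Z. Proof. by clear; lia. Qed.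

(** The unit [u = l / pi^e] of [F] satisfies [u = s u (1 + c)^e]. As [s u] is close to [u],
    [(1 + c)^e] is equally close to 1; its linear term [e c] dominates the rest, and [e] is a
    unit. *)
Lemma tame_index_fixed (l e : nat) : v l%:R = e%:Z * d -> l%:R != 0 :> L ->
  ~~ vge v 1 e%:R -> vge v 1 c -> forall x, x \in F -> s x = x.
Proof.
move=> vl l0 ve vc; apply: fixed_of_c => // n Pn; have vcn := vc_prev Pn.
pose u := l%:R / pi ^+ e.
have pie : pi ^+ e != 0 by rewrite expf_neq0.
have u0 : u != 0 by rewrite mulf_neq0 ?invr_neq0.
have Fu : u \in F by rewrite rpred_div ?rpredX ?rpred_nat.
have vu : v u = 0 by rewrite (valM hv) ?invr_neq0 // (valV hv) // (valX hv) // vl vpi mulrC subrr.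
have su0 : s u != 0 by rewrite fmorph_eq0.
have vsu : v (s u) = 0 by rewrite vs.
have c1 : 1 + c != 0 by rewrite /c addrC subrK mulf_neq0 ?invr_neq0 ?fmorph_eq0.
have Dsu : s u * (1 + c) ^+ e = u.
  rewrite /u fmorph_div rmorph_nat rmorphXn /= Dspi exprMn invfM mulrA divfK //.
  by rewrite expf_neq0.
have v1 : vge v (n.+2%:Z * d) ((1 + c) ^+ e - 1).
  have -> : (1 + c) ^+ e - 1 = (s u - u) / (- s u).
    by rewrite -{2}Dsu; field; rewrite oppr_eq0.
  apply: (vge_div hv); first by rewrite oppr_eq0.
  rewrite -mulN1r (valM hv) ?oppr_eq0 ?oner_eq0 // (valN1 hv) vsu !addr0.
  by apply: Pn => //; rewrite /vge vu orbT.
have vcge0 : 0 <= n.+1%:Z * d by rewrite mulr_ge0 // ltW.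
have := vge_binomial e vcge0 (vge_1 hv) vcn; rewrite !expr1n mulr1 => v2.
have v3 : vge v (n.+2%:Z * d) (e%:R * c).
  rewrite -(subKr ((1 + c) ^+ e - 1) (e%:R * c)); apply: (vgeB hv) => //.
  by apply: vge_le v2; rewrite -mulrDl ler_pM2r // le_double.
have e0 : e%:R != 0 :> L by apply: contraNneq ve => ->; rewrite vge0.
rewrite -[c](mulKf e0) [_^-1 * _]mulrC; apply: (vge_div hv) => //.
move: ve (vge_nat hv e); rewrite /vge (negPf e0) /= => ve1 ve0.
have -> : v e%:R = 0 by clear -ve1 ve0; lia.
by rewrite addr0.
Qed.

(** The iterate [s^m] sends [pi] to [pi r] with [r] congruent to [1 + m c]; here [r = 1] and [m] is
    a unit. *)
Lemma tame_order_fixed (m : nat) : iter m s pi = pi ->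
  ~~ vge v 1 m%:R -> vge v 1 c -> forall x, x \in F -> s x = x.
Proof.
move=> smpi vm vc; apply: fixed_of_c => // n Pn; have vcn := vc_prev Pn.
have vc0 : vge v 0 c by apply: vge_le vc.
have [r [Dr _ _ vr]] : exists r, [/\ iter m s pi = pi * r, r \in F, vge v 0 r
    & vge v (n.+2%:Z * d) (r - 1 - m%:R * c)].
  elim: m {smpi vm} => [|m [r [Dr Fr vr vrm]]].
    by exists 1; rewrite /= mulr1 rpred1 (vge_1 hv) subrr mul0r subr0 vge0.
  exists ((1 + c) * s r); split.
  - by rewrite iterS Dr rmorphM /= Dspi mulrA.
  - by rewrite rpredM ?sF // rpredD ?rpred1.
  - apply: (vge0M hv); first by apply: (vgeD hv) => //; apply: vge_1.
    by rewrite -[s r](subrK r); apply: (vgeD hv) => //; apply: vge_le (inert vr).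
  have -> : (1 + c) * s r - 1 - m.+1%:R * c =
      (1 + c) * (s r - r) + (1 + c) * (r - 1 - m%:R * c) + m%:R * (c * c).
    by rewrite -natr1; ring.
  have v1c : vge v 0 (1 + c) by apply: (vgeD hv) => //; apply: vge_1.
  apply: (vgeD hv); [apply: (vgeD hv)|].
  - by apply: (vgeMl hv) => //; apply: Pn.
  - exact: (vgeMl hv).
  apply: (vgeMl hv); first exact: (vge_nat hv).
  by apply: vge_le (vgeM hv vcn vcn); rewrite -mulrDl ler_pM2r // le_double.
have r1 : r = 1 by apply: (mulfI pi0); rewrite -Dr smpi mulr1.
have v3 : vge v (n.+2%:Z * d) (m%:R * c).
  by move: vr; rewrite r1 subrr sub0r (vgeN hv).
have m0 : m%:R != 0 :> L by apply: contraNneq vm => ->; rewrite vge0.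
rewrite -[c](mulKf m0) [_^-1 * _]mulrC; apply: (vge_div hv) => //.
move: vm (vge_nat hv m); rewrite /vge (negPf m0) /= => vm1 vm0.
have -> : v m%:R = 0 by clear -vm1 vm0; lia.
by rewrite addr0.
Qed.

End TameInertia.

(** * The residue field of a valuation *)

Section ResidueField.
Local Open Scope quotient_scope.
Variables (L : fieldType) (v : L -> int) (hv : valuation v).

Definition valuation_ring of valuation v : {pred L} := vge v 0.
Local Notation R := (valuation_ring hv).

Lemma valuation_ring_subring_closed : subring_closed R.
Proof. by split; [exact: vge_1|exact: vgeB|exact: vge0M]. Qed.
HB.instance Definition _ := GRing.isSubringClosed.Build L R valuation_ring_subring_closed.

Definition valring : predArgType := {x : L | x \in R}.
HB.instance Definition _ := SubChoice.on valring.
HB.instance Definition _ := [SubChoice_isSubComNzRing of valring by <:].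

Definition max_ideal : {pred valring} := fun x => vge v 1 (val x).

Lemma max_ideal_idealr_closed : idealr_closed max_ideal.
Proof.
split; first exact: vge0.
  exact: (vge1_1 hv).
move=> a x y mx my; apply: (vgeD hv) => //; apply: (vgeMl hv) => //.
exact: (valP a).
Qed.
HB.instance Definition _ := isIdealr.Build valring max_ideal max_ideal_idealr_closed.

Local Notation k := {ideal_quot max_ideal}.

Definition residue_inv (x : k) : k :=
  \pi_k (if x == 0 then 0 else insubd (0 : valring) (val (generic_quotient.repr x))^-1).

Lemma residue_mulVf x : x != 0 -> residue_inv x * x = 1.
Proof.
rewrite /residue_inv => x0; rewrite (negPf x0).
move: x0; rewrite -{1 3}[x]reprK; move: (generic_quotient.repr x) => {x} x.
rewrite -(rmorph0 \pi_k) -Quotient.idealrBE subr0 => nx.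
have vx : vge v 0 (val x) by exact: (valP x).
have x0 : val x != 0 by apply: contraNneq nx => x0; rewrite unfold_in x0 vge0.
have v0 : v (val x) = 0.
  by move: nx vx; rewrite unfold_in /vge (negPf x0) /=; lia.
have Vx : (val x)^-1 \in R by rewrite unfold_in /vge (valV hv) // v0 oppr0 lexx orbT.
rewrite -rmorphM -(rmorph1 \pi_k); congr (\pi_k _); apply: val_inj.
by rewrite -[LHS]/(val (insubd (0 : valring) (val x)^-1) * val x) insubdK // mulVf.
Qed.

Lemma residue_invr0 : residue_inv 0 = 0.
Proof. by rewrite /residue_inv eqxx rmorph0. Qed.

HB.instance Definition _ := GRing.ComNzRing_isField.Build k residue_mulVf residue_invr0.

(** An element of negative value gets the default residue 0, hence the hypotheses [vge v 0]
    below. *)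
Definition residue (x : L) : k := \pi_k (insubd (0 : valring) x).

Lemma residueE (x : valring) : residue (val x) = \pi_k x.
Proof. by rewrite /residue valKd. Qed.

Lemma residue1 : residue 1 = 1.
Proof. by rewrite -[1 in LHS]/(val (1 : valring)) residueE rmorph1. Qed.

Lemma residueB x y : vge v 0 x -> vge v 0 y -> residue (x - y) = residue x - residue y.
Proof.
move=> vx vy; rewrite -[x]/(val (exist _ x vx : valring)) -[y]/(val (exist _ y vy : valring)).
by rewrite -rmorphB !residueE rmorphB.
Qed.

Lemma residueM x y : vge v 0 x -> vge v 0 y -> residue (x * y) = residue x * residue y.
Proof.
move=> vx vy; rewrite -[x]/(val (exist _ x vx : valring)) -[y]/(val (exist _ y vy : valring)).
by rewrite -rmorphM !residueE rmorphM.
Qed.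

Lemma residue_eq0 x : vge v 0 x -> (residue x == 0) = vge v 1 x.
Proof.
move=> vx; rewrite -[x]/(val (exist _ x vx : valring)) residueE.
by rewrite -(rmorph0 \pi_k) -Quotient.idealrBE subr0.
Qed.

Lemma residue_eq x y : vge v 0 x -> vge v 0 y -> (residue x == residue y) = vge v 1 (x - y).
Proof.
by move=> vx vy; rewrite -subr_eq0 -residueB // residue_eq0 // (vgeB hv).
Qed.

Lemma residueX x n : vge v 0 x -> residue (x ^+ n) = residue x ^+ n.
Proof.
move=> vx; elim: n => [|n IH]; first by rewrite !expr0 residue1.
by rewrite !exprS residueM ?IH // (vge0X hv).
Qed.

Lemma residue0 : residue 0 = 0.
Proof. by apply/eqP; rewrite residue_eq0 vge0. Qed.

Lemma residueD x y : vge v 0 x -> vge v 0 y -> residue (x + y) = residue x + residue y.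
Proof.
by move=> vx vy; rewrite -[y in LHS]opprK residueB ?(vgeN hv) // -[- y]sub0r residueB ?vge0 // residue0 sub0r opprK.
Qed.

Lemma residue_nat n : residue n%:R = n%:R.
Proof.
elim: n => [|n IH]; first exact: residue0.
by rewrite -!natr1 residueD ?(vge_1 hv) ?(vge_nat hv) // IH residue1.
Qed.

Lemma residue_int n : residue n%:~R = n%:~R.
Proof.
case: n => n; first exact: residue_nat.
by rewrite NegzE !rmorphN /= -[- _%:~R]sub0r residueB ?vge0 ?(vge_nat hv) // residue0 sub0r residue_nat.
Qed.

End ResidueField.

Lemma expr_pchar_inj (k : fieldType) (l n : nat) (x y : k) : l \in [pchar k] ->
  x ^+ (l ^ n) = y ^+ (l ^ n) -> x = y.
Proof.
move=> chl; elim: n => [|n IH]; first by rewrite expn0 !expr1.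
by rewrite expnSr !exprM => /(fmorph_inj (pFrobenius_aut chl))/IH.
Qed.

(** The [n + 1] elements [y^(l^i)], [i <= n], are roots of a polynomial of degree [n], so two of
    them coincide. As the Frobenius map is injective, [y^(l^k) = y] for some [k] between 1 and [n],
    and [k] divides [n!]. *)
Lemma root_int_finite_order (k : fieldType) (l n : nat) (h : {poly int}) (y : k) :
    l \in [pchar k] -> h \is monic -> size h = n.+1 -> root (map_poly intr h) y ->
  y ^+ (l ^ n`!) = y.
Proof.
move=> chl mh sh hy; pose f : {poly k} := map_poly intr h.
have sf : size f = n.+1.
  by rewrite size_map_poly_id0 ?sh //= (monicP mh) rmorph1 oner_eq0.
have f0 : f != 0 by rewrite -size_poly_eq0 sf.
have fr i : root f (y ^+ (l ^ i)).
  elim: i => [|i IH]; first by rewrite expn0 expr1.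
  rewrite expnSr exprM -[_ ^+ l]/(pFrobenius_aut chl _).
  suffices {1}<- : map_poly (pFrobenius_aut chl) f = f by rewrite fmorph_root.
  by rewrite -map_poly_comp; apply: eq_map_poly => z /=; rewrite rmorph_int.
have : ~~ uniq (mkseq (fun i => y ^+ (l ^ i)) n.+1).
  apply/negP => u; have al : all (root f) (mkseq (fun i => y ^+ (l ^ i)) n.+1).
    by apply/allP => z /mapP[i _ ->].
  by have := max_poly_roots f0 al u; rewrite size_mkseq sf ltnn.
case/(uniqPn 0) => i [j]; rewrite size_mkseq => -[ltij ltj].
rewrite !nth_mkseq ?(ltn_trans ltij) // => E.
have {E} E : y ^+ (l ^ (j - i)) = y.
  by apply: (@expr_pchar_inj _ l i _ _ chl); rewrite -exprM -expnD subnK // ltnW.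
have /dvdn_fact/dvdnP[c ->] : (0 < j - i <= n)%N.
  by rewrite subn_gt0 ltij (leq_trans (leq_subr _ _)).
elim: c => [|c IH]; first by rewrite mul0n expn0 expr1.
by rewrite mulSn expnD exprM E.
Qed.

(** The valuation is not normalized and its values on [F] are not known beforehand, so a uniformizer
    of [F] is an element of least positive value. *)
Definition uniformizer (L : fieldType) (v : L -> int) (F : divringClosed L) (pi : L) : Prop :=
  [/\ pi \in F, pi != 0, 0 < v pi & forall x, x \in F -> vge v 1 x -> vge v (v pi) x].

(** * Inertia groups and the tame character *)

Section InertiaTheory.
Variables (L : splittingFieldType rat) (iota : {rmorphism L -> algC}).
Local Notation gT := (gal_of {:L}).
Local Notation O := (intO iota).

Lemma gal_fixed_poly (f : {poly L}) : f \is a polyOver O ->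
  (forall g : gT, map_poly g f = f) -> exists h : {poly int}, f = map_poly intr h.
Proof.
move=> Of fixf; have /fin_all_exists[c Dc] (i : 'I_(size f)) : exists z : int, f`_i = z%:~R.
  by apply: intO_fixed (polyOverP Of i) _ => g; rewrite -coef_map fixf.
exists (\poly_(i < size f) oapp c 0 (insub i)); apply/polyP => i; rewrite coef_map coef_poly /=.
have [lti|gei] := ltnP i (size f); last by rewrite nth_default.
by rewrite insubT; exact: (Dc (Ordinal lti)).
Qed.

Definition gal_poly (x : L) : {poly L} := \prod_(g : gT) ('X - (g x)%:P).

Lemma gal_poly_fixed x (h : gT) : map_poly h (gal_poly x) = gal_poly x.
Proof.
rewrite /gal_poly rmorph_prod /= [RHS](reindex_inj (mulIg h)) /=; apply: eq_bigr => g _.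
by rewrite rmorphB /= map_polyX map_polyC /= galM ?memvf.
Qed.

Lemma gal_poly_root x : root (gal_poly x) x.
Proof.
by rewrite rootE /gal_poly horner_prod (bigD1 1%g) //= !hornerE gal_id subrr mul0r.
Qed.

Lemma size_gal_poly x : size (gal_poly x) = #|{: gT}|.+1.
Proof. by rewrite size_prod_XsubC -sum1_size -sum1_card. Qed.

Lemma gal_poly_int x : x \in O -> exists2 f : {poly int}, f \is monic & gal_poly x = map_poly intr f.
Proof.
move=> Ox; have [|h Dh] := @gal_fixed_poly (gal_poly x) _ (gal_poly_fixed x).
  by apply: rpred_prod => g _; rewrite polyOverXsubC intO_gal.
exists h => //; have : gal_poly x \is monic by apply: monic_prod_XsubC.
have inj := intr_inj_num iota.
by rewrite Dh !monicE lead_coef_map_inj // -[1]/(1%:~R) (inj_eq inj).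
Qed.

Section Inertia.
Variables (Q : {pred L}) (prQ : primeO iota Q).

Definition inertia : {set gT} := [set g : gT | `[< forall x, x \in O -> g x - x \in Q >]].

Lemma inertiaP (g : gT) : reflect (forall x, x \in O -> g x - x \in Q) (g \in inertia).
Proof. by rewrite inE; apply: asboolP. Qed.

Lemma inertia_group_set : group_set inertia.
Proof.
apply/group_setP; split.
  by apply/inertiaP => x Ox; rewrite gal_id subrr (primeO_0 prQ).
move=> g h /inertiaP Ig /inertiaP Ih; apply/inertiaP => x Ox.
rewrite galM ?memvf // -(subrK ((g : gT) x) (h _)) -addrA; apply: (primeO_D prQ); last exact: Ig.
by apply: Ih; rewrite intO_gal.
Qed.
Canonical inertia_group := group inertia_group_set.

Lemma inertia_mem g x : g \in inertia -> x \in O -> (g x \in Q) = (x \in Q).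
Proof.
move=> /inertiaP Ig Ox; have Q1 := Ig x Ox; apply/idP/idP => [Qg|Qx].
  by rewrite -(subKr (g x) x) (primeO_B prQ).
by rewrite -(subrK x (g x)) (primeO_D prQ).
Qed.

Variables (l : nat) (pr_l : prime l) (Ql : l%:R \in Q).
Variables (v : L -> int) (hv : valuation v).
Hypotheses (v_l : 0 < v l%:R) (v_loc : forall x, x != 0 -> (0 <= v x <-> locO iota Q x)).
Hypothesis (v_Q : forall x, x \in O -> vge v 1 x = (x \in Q)).

Lemma val_num_neq0 : l%:R != 0 :> L.
Proof. by rewrite (natr_num_eq0 iota) -lt0n prime_gt0. Qed.

Lemma vge_intO x : x \in O -> vge v 0 x.
Proof.
move=> Ox; rewrite /vge; have [//|x0] := eqVneq x 0; apply/v_loc => //.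
exact: locO_intO prQ _ Ox.
Qed.

Lemma vge0_loc x : vge v 0 x -> locO iota Q x.
Proof.
rewrite /vge; have [-> _|x0 /=] := eqVneq x 0; last by move/v_loc; apply.
by apply: locO_intO prQ _ _; apply: rpred0.
Qed.

Lemma notin_val x : x \in O -> x \notin Q -> x != 0 /\ v x = 0.
Proof.
move=> Ox nQ; have x0 : x != 0 by apply: contraNneq nQ => ->; apply: primeO_0 prQ.
split=> //; have := vge_intO Ox; move: nQ; rewrite -v_Q // /vge (negPf x0) /=; clear; lia.
Qed.

(** Up to sign of the exponents, [x^(v l)] and [l^(v x)] have the same value, and [g] fixes [l]. It
    is therefore enough that [g] preserves the localization, hence its units. *)
Lemma val_inertia (g : gT) x : g \in inertia -> x != 0 -> v (g x) = v x.
Proof.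
move=> Ig x0.
have gnz y : y != 0 -> g y != 0 by rewrite fmorph_eq0.
have loc_g y : locO iota Q y -> locO iota Q (g y).
  move=> [a [s [Oa Os Qs Da]]]; exists (g a), (g s).
  by split; rewrite ?intO_gal ?inertia_mem // -rmorphM Da.
have unit_g y : y != 0 -> v y = 0 -> v (g y) = 0.
  move=> y0 vy; apply/eqP; rewrite eq_le; apply/andP; split; last first.
    by apply/v_loc; rewrite ?gnz //; apply/loc_g/v_loc; rewrite ?vy.
  rewrite -oppr_ge0 -(valV hv) ?gnz // -fmorphV.
  apply/v_loc; rewrite ?gnz ?invr_neq0 //; apply/loc_g/v_loc; rewrite ?invr_neq0 //.
  by rewrite (valV hv) // vy oppr0.
pose a := v x; pose N := v l%:R; pose n := `|N|%N; pose k := `|a|%N.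
have Dn : n%:Z = N by rewrite /n gez0_abs // ltW.
have l0 := val_num_neq0; have vg0 := valX hv.
pose y := if 0 <= a then x ^+ n / l%:R ^+ k else x ^+ n * l%:R ^+ k.
have vxn z : z != 0 -> v (z ^+ n / l%:R ^+ k) = v z * N - N * k%:Z.
  by move=> z0; rewrite (valM hv) ?invr_neq0 ?expf_neq0 // (valV hv) ?expf_neq0 // !vg0 // Dn.
have vxm z : z != 0 -> v (z ^+ n * l%:R ^+ k) = v z * N + N * k%:Z.
  by move=> z0; rewrite (valM hv) ?expf_neq0 // !vg0 // Dn.
have [a0|a0] := leP 0 a.
  have := unit_g (x ^+ n / l%:R ^+ k); rewrite mulf_neq0 ?invr_neq0 ?expf_neq0 // vxn //.
  rewrite fmorph_div !rmorphXn rmorph_nat vxn ?gnz // /k gez0_abs // -/a mulrC subrr => /(_ isT erefl).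
  by move/eqP; rewrite mulrC -mulrBr mulf_eq0 gt_eqF //= subr_eq0 => /eqP.
have := unit_g (x ^+ n * l%:R ^+ k); rewrite mulf_neq0 ?expf_neq0 // vxm //.
rewrite rmorphM !rmorphXn rmorph_nat vxm ?gnz // /k lez0_abs ?(ltW a0) // -/a.
rewrite mulrC mulrN subrr => /(_ isT erefl).
by move/eqP; rewrite mulrC -mulrBr mulf_eq0 gt_eqF //= subr_eq0 => /eqP.
Qed.

Lemma inertia_vge (g : gT) x : g \in inertia -> vge v 0 x -> vge v 1 (g x - x).
Proof.
move=> Ig /vge0_loc/(locO_frac prQ)[a [s [Oa Os nQs ->]]].
have nQg : g s \notin Q by rewrite inertia_mem.
have [[s0 vs] [gs0 vgs]] := (notin_val Os nQs, notin_val (intO_gal g Os) nQg).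
have -> : g (a / s) - a / s = ((g a - a) * s - a * (g s - s)) / (g s * s).
  by rewrite fmorph_div; field; rewrite s0 gs0.
apply: (vge_div hv); first by rewrite mulf_neq0.
rewrite (valM hv) // vs vgs !addr0 v_Q; last by rewrite rpredB ?rpredM ?rpredB ?intO_gal.
have /inertiaP Ig' := Ig.
by apply: (primeO_B prQ); [rewrite mulrC|]; apply: (primeO_M prQ); rewrite ?Ig'.
Qed.

(** An element of least positive value is a fraction [a / s] over the integers of [F] with [s]
    outside [Q], and its numerator has the same value; this makes the uniformizer integral. *)
Lemma uniformizer_exists (F : divringClosed L) : exists pi,
  [/\ pi \in [predI O & F], pi != 0, 0 < v pi & forall x, x \in F -> vge v 1 x -> vge v (v pi) x].
Proof.
pose P (n : nat) := `[< exists x, [/\ x \in F, x != 0 & v x = n.+1%:Z] >].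
have exP : exists n, P n.
  exists `|v l%:R|.-1%N; apply/asboolP; exists l%:R; rewrite rpred_nat val_num_neq0; split=> //.
  by case: (v _) v_l => // -[|m].
case: (ex_minnP exP) => n /asboolP[x [Fx x0 vx]] minn.
have lx : locF iota Q F x.
  have [//|lV] := locF_total prQ pr_l Ql Fx x0.
  have /(v_loc (invr_neq0 x0)) := locF_locO lV; rewrite (valV hv) // vx; clear; lia.
have [a [s [/andP[Oa Fa] /andP[Os Fs] nQs Da]]] := lx.
have [s0 vs] := notin_val Os nQs.
have va : v a = n.+1%:Z by rewrite -Da (valM hv) // vs vx addr0.
exists a; split; first by apply/andP.
- by rewrite -Da mulf_neq0.
- by rewrite va.
move=> y Fy; rewrite va /vge; have [//|y0 /= vy] := eqVneq y 0.
have : (n <= `|v y|.-1)%N.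
  by apply: minn; apply/asboolP; exists y; split=> //; move: vy; clear; lia.
by move: vy; clear; lia.
Qed.

Section Uniformizer.
Variables (F : divringClosed L) (pi : L).
Hypotheses (Fpi : pi \in F) (pi0 : pi != 0) (vpi : 0 < v pi)
  (pi_min : forall x, x \in F -> vge v 1 x -> vge v (v pi) x).

Lemma uniformizer_dvd x : x \in F -> x != 0 -> exists z : int, v x = z * v pi.
Proof.
move=> Fx x0; exists (v x %/ v pi)%Z.
have vz (z : int) : v (pi ^ z) = z * v pi.
  case: z => z; first by rewrite -exprnP (valX hv) // mulrC.
  by rewrite NegzE -exprnN (valV hv) ?expf_neq0 // (valX hv) //; lia.
have Dv := divz_eq (v x) (v pi); set z := (v x %/ v pi)%Z in Dv *.
pose y := x * pi ^ (- z).
have y0 : y != 0 by rewrite mulf_neq0 // expfz_neq0.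
have vy : v y = (v x %% v pi)%Z by rewrite (valM hv) ?expfz_neq0 // vz {1}Dv; clear; lia.
have Fy : y \in F.
  by rewrite rpredM //; case: (- z) => m; rewrite ?NegzE -?exprnN ?rpredV rpredX.
have := pi_min Fy; rewrite /vge (negPf y0) /= vy.
have r_ge0 := modz_ge0 (v x) (lt0r_neq0 vpi); have r_lt := ltz_pmod (v x) vpi.
move=> r1; suffices r0 : (v x %% v pi)%Z = 0 by rewrite {1}Dv r0 addr0.
by move: r_ge0 r_lt r1; move: (v x %% v pi)%Z (v pi) => r d; clear; lia.
Qed.

(* The tame character. *)
Definition theta (g : gT) := residue hv (g pi / pi).

Lemma theta_unit (g : gT) : g \in inertia -> vge v 0 (g pi / pi).
Proof.
move=> Ig; apply: (vge_div hv) => //; rewrite add0r -(val_inertia Ig pi0).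
by rewrite /vge lexx orbT.
Qed.

Lemma thetaM : {in inertia &, {morph theta : g h / (g * h)%g >-> g * h}}.
Proof.
move=> g h Ig Ih; rewrite /theta.
have -> : (g * h)%g pi / pi = h (g pi / pi) * (h pi / pi).
  by rewrite galM ?memvf // fmorph_div mulrA divfK // fmorph_eq0.
have vg := theta_unit Ig; have vh := theta_unit Ih.
have vhg : vge v 0 (h (g pi / pi)).
  rewrite -(subrK (g pi / pi) (h _)); apply: (vgeD hv) => //.
  exact: vge_le (inertia_vge Ih vg).
by rewrite residueM //; congr (_ * _); apply/eqP; rewrite residue_eq // inertia_vge.
Qed.

Lemma theta_eq1 (g : gT) : g \in inertia -> (theta g == 1) = vge v 1 (g pi / pi - 1).
Proof.
by move=> Ig; rewrite /theta -[1 in LHS](residue1 hv) residue_eq ?theta_unit ?(vge_1 hv).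
Qed.

End Uniformizer.

Lemma residue_horner (h : {poly int}) x : vge v 0 x ->
  residue hv (map_poly intr h).[x] = (map_poly intr h).[residue hv x].
Proof.
move=> vx; suffices [] : vge v 0 (map_poly intr h).[x] /\
  residue hv (map_poly intr h).[x] = (map_poly intr h).[residue hv x] by [].
elim/poly_ind: h => [|h c [vh IH]]; first by rewrite !map_poly0 !horner0 vge0 residue0.
rewrite !rmorphD !rmorphM /= !map_polyX !map_polyC /= !hornerD !hornerM !hornerX !hornerC.
have vhx := vge0M hv vh vx.
by rewrite (vgeD hv) ?(vge_int hv) // residueD ?(vge_int hv) // residueM // IH residue_int.
Qed.

Lemma vge_l : vge v 1 l%:R.
Proof. by rewrite v_Q // rpred_nat. Qed.

Lemma residue_pchar : l \in [pchar {ideal_quot @max_ideal _ _ hv}].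
Proof. by rewrite inE pr_l -(residue_nat hv) residue_eq0 ?(vge_nat hv) // vge_l. Qed.

(** Residues of integral elements are roots of monic integer polynomials of degree [n], the order of
    the Galois group. The number [q = l^(n!)] is an exponent that fixes every residue and need not
    be the size of the residue field. *)
Lemma residue_finite : exists q, [/\ (1 < q)%N, vge v 1 q%:R &
  forall x, vge v 0 x -> vge v 1 (x ^+ q - x)].
Proof.
pose n := #|{: gT}|; have n0 : (0 < n`!)%N by apply: fact_gt0.
have l1 := prime_gt1 pr_l.
exists (l ^ n`!)%N; split.
- by rewrite -(exp1n n`!) ltn_exp2r.
- by rewrite -(prednK n0) expnS natrM (vgeMr hv) ?(vge_nat hv) ?vge_l.
have resO x : x \in O -> residue hv x ^+ (l ^ n`!) = residue hv x.
  move=> Ox; have [h mh Dh] := gal_poly_int Ox.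
  apply: (@root_int_finite_order _ l n h _ residue_pchar mh).
    by rewrite -(size_gal_poly x) Dh size_map_inj_poly //; apply: intr_inj_num iota.
  have := gal_poly_root x; rewrite Dh !rootE -residue_horner ?vge_intO //.
  by move=> /eqP->; rewrite residue0.
move=> x vx; have := vge0_loc vx; case/(locO_frac prQ)=> a [s [Oa Os nQs Dx]].
have [s0 vs] := notin_val Os nQs.
have [va vs0] := (vge_intO Oa, vge_intO Os).
rewrite -residue_eq ?(vge0X hv) // residueX //.
have rs0 : residue hv s != 0 by rewrite residue_eq0 // v_Q.
have -> : residue hv x = residue hv a / residue hv s.
  by apply: (mulIf rs0); rewrite -residueM // Dx divfK // divfK.
by rewrite expr_div_n !resO.
Qed.

(** Wild inertia is trivial on [F], here by tameness of [F]. The companion [inertia_tame_order]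
    starts instead from the order of [g], and so applies to fields whose ramification index has not
    been computed, such as [L]. *)
Lemma inertia_tame_index (F : divringClosed L) pi (e : nat) (g : gT) :
    (forall h : gT, forall x, x \in F -> h x \in F) ->
    uniformizer v F pi ->
    v l%:R = e%:Z * v pi -> ~~ (l %| e)%N -> g \in inertia -> theta pi g = 1 ->
  forall x, x \in F -> g x = x.
Proof.
move=> stF [Fpi pi0 vpi minpi] vle nle Ig thg.
have [q [q1 vq resq]] := residue_finite.
pose s : {rmorphism L -> L} := GRing.RMorphism.clone _ _ (g : L -> L) _.
have ne : ~~ vge v 1 e%:R.
  by rewrite v_Q ?rpred_nat // -[e%:R]/(e%:~R) (primeO_int prQ pr_l Ql) dvdzE.
apply: (@tame_index_fixed _ v hv s F (v pi) pi q _ _ _ _ _ _ _ _ _ _ l e) => //.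
- by move=> x x0; apply: val_inertia.
- by move=> x; apply: inertia_vge.
- by move=> x Fx; apply: stF.
- by move=> x _; apply: resq.
- exact: val_num_neq0.
- by rewrite -(theta_eq1 pi0) ?thg.
Qed.

Lemma inertia_tame_order (F : divringClosed L) pi (g : gT) :
    (forall h : gT, forall x, x \in F -> h x \in F) ->
    uniformizer v F pi ->
    ~~ (l %| #[g]%g)%N -> g \in inertia -> theta pi g = 1 ->
  forall x, x \in F -> g x = x.
Proof.
move=> stF [Fpi pi0 vpi minpi] no Ig thg.
have [q [q1 vq resq]] := residue_finite.
pose s : {rmorphism L -> L} := GRing.RMorphism.clone _ _ (g : L -> L) _.
have ne : ~~ vge v 1 #[g]%g%:R.
  by rewrite v_Q ?rpred_nat // -[_%:R]/(#[g]%g%:~R) (primeO_int prQ pr_l Ql) dvdzE.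
apply: (@tame_order_fixed _ v hv s F (v pi) pi q _ _ _ _ _ _ _ _ _ _ #[g]%g) => //.
- by move=> x x0; apply: val_inertia.
- by move=> x; apply: inertia_vge.
- by move=> x Fx; apply: stF.
- by move=> x _; apply: resq.
- have iterg n x : iter n s x = (g ^+ n)%g x.
    elim: n => [|n IH]; first by rewrite gal_id.
    by rewrite iterS IH expgSr galM ?memvf.
  by rewrite iterg expg_order gal_id.
- by rewrite -(theta_eq1 pi0) ?thg.
Qed.

End Inertia.
End InertiaTheory.

(** * Unramified primes *)

Lemma polyOver_mul_cancel (L : fieldType) (F : divringClosed L) (f y : {poly L}) :
  f != 0 -> f \is a polyOver F -> f * y \is a polyOver F -> y \is a polyOver F.
Proof.
move=> f0 Ff; have [n] := ubnP (size y); elim: n y => // n IH y /ltnSE sy Ffy.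
have [->|y0] := eqVneq y 0; first exact: rpred0.
have Fl : lead_coef y \in F.
  rewrite -(mulKf (_ : lead_coef f != 0) (lead_coef y)) ?lead_coef_eq0 // -lead_coefM.
  by rewrite rpredM ?rpredV // lead_coefE (polyOverP _).
pose z := y - lead_coef y *: 'X^((size y).-1).
have Dy : y = z + lead_coef y *: 'X^((size y).-1) by rewrite subrK.
have Fz : lead_coef y *: 'X^((size y).-1) \is a polyOver F.
  by rewrite polyOverZ // rpredX // polyOverX.
rewrite Dy rpredD //; apply: IH; last by rewrite mulrBr rpredB // rpredM.
rewrite (leq_trans _ sy) // [X in (_ < X)%N](_ : _ = (size y).-1.+1).
  rewrite ltnS; apply/leq_sizeP => j; rewrite leq_eqVlt coefB coefZ coefXn => /predU1P[<-|ltj].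
    by rewrite eqxx mulr1 -lead_coefE subrr.
  rewrite gtn_eqF // mulr0 subr0 nth_default //.
  by move: ltj; rewrite -ltnS prednK // size_poly_gt0.
by rewrite prednK // size_poly_gt0.
Qed.

Section ConjugatePrimes.
Variables (L : splittingFieldType rat) (iota : {rmorphism L -> algC}).
Local Notation gT := (gal_of {:L}).
Local Notation O := (intO iota).

Lemma primeO_gal (Q : {pred L}) (g : gT) : primeO iota Q -> primeO iota [pred x | g x \in Q].
Proof.
move=> prQ; split.
- by move=> x /(primeO_sub prQ); rewrite intO_galE.
- by rewrite inE rmorph0 (primeO_0 prQ).
- by move=> x y; rewrite !inE rmorphD; apply: (primeO_D prQ).
- by move=> a x Oa; rewrite !inE rmorphM; apply: (primeO_M prQ); rewrite intO_gal.
- by rewrite inE rmorph1 (primeO_1 prQ).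
move=> x y Ox Oy; rewrite !inE rmorphM; apply: (primeO_P prQ); exact: intO_gal.
Qed.

Variables (Q : {pred L}) (prQ : primeO iota Q).

(* Gauss's lemma. *)
Lemma primeO_poly (f g : {poly L}) : f \is a polyOver O -> g \is a polyOver O ->
  (forall i, (f * g)`_i \in Q) -> (forall i, f`_i \in Q) \/ (forall i, g`_i \in Q).
Proof.
move=> Of Og Qfg; apply: contrapT => /not_orP[nf ng].
have least (h : {poly L}) : ~ (forall i, h`_i \in Q) ->
    exists2 n, h`_n \notin Q & forall i, (i < n)%N -> h`_i \in Q.
  move=> /existsNP[i /negP nQ]; have exn : exists n, h`_n \notin Q by exists i.
  case: (ex_minnP exn) => n nQn minn; exists n => // j ltj.
  by apply: contraLR ltj => /minn; rewrite -leqNgt.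
have [i nfi fi] := least f nf; have [j ngj gj] := least g ng.
have Ofg a b : f`_a * g`_b \in O by rewrite rpredM ?(polyOverP _).
have := Qfg (i + j)%N; rewrite coefM.
rewrite (bigD1 (Ordinal (leq_addr j i.+1))) //= addKn => Qs.
suffices : f`_i * g`_j \in Q.
  by case/(primeO_P prQ (polyOverP Of i) (polyOverP Og j)); apply/negP.
rewrite -(addrK (\sum_(k < (i + j).+1 | k != Ordinal (leq_addr j i.+1)) f`_k * g`_(i + j - k)) (_ * _)).
apply: (primeO_B prQ) => //; apply: (primeO_sum prQ) => k; rewrite -val_eqE /= neq_ltn => /orP[ltk|ltk].
  by rewrite mulrC; apply: (primeO_M prQ); rewrite ?(polyOverP Og) ?fi.
apply: (primeO_M prQ); rewrite ?(polyOverP Of) // gj //.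
by have := ltn_ord k; clear -ltk; lia.
Qed.

Lemma primeO_poly_prod (I : finType) (P : pred I) (f : I -> {poly L}) :
  (forall i, P i -> f i \is a polyOver O) -> (forall j, (\prod_(i | P i) f i)`_j \in Q) ->
  exists2 i, P i & forall j, (f i)`_j \in Q.
Proof.
move=> Of; pose R h := h \is a polyOver O /\
  ((forall j, h`_j \in Q) -> exists2 i, P i & forall j, (f i)`_j \in Q).
suffices [] : R (\prod_(i | P i) f i) by [].
elim/big_rec: _ => [|i h Pi [Oh IH]].
  by split=> [|/(_ 0%N)]; rewrite ?rpred1 // coef1 (negPf (primeO_1 prQ)).
split; first by rewrite rpredM ?Of.
by case/(primeO_poly (Of i Pi) Oh) => // Qf; exists i.
Qed.

Variables (l : nat) (pr_l : prime l) (Ql : l%:R \in Q).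

(** Otherwise there are [b g] in [P] with [g (b g)] outside [Q], for all [g]. Let [f] have the [b g]
    as coefficients. Its norm has integer coefficients in [P], hence divisible by [l] and in [Q]; by
    Gauss's lemma some conjugate [g f] has all its coefficients in [Q], among them [g (b g)]. *)
Lemma conj_prime (F : divringClosed L) (P : {pred L}) :
    {subset P <= [predI O & F]} -> 0 \in P -> (forall x y, x \in P -> y \in P -> x + y \in P) ->
    (forall a x, a \in [predI O & F] -> x \in P -> a * x \in P) -> 1 \notin P -> l%:R \in P ->
  exists g : gT, forall x, x \in P -> g x \in Q.
Proof.
move=> POF P0 PD PM P1 Pl; apply: contrapT => nex.
have /fin_all_exists2[b Pb nQb] (g : gT) : exists2 x, x \in P & g x \notin Q.
  apply: contrapT => nx; apply: nex; exists g => x Px.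
  by apply: contrapT => /negP nQ; apply: nx; exists x.
pose f := \poly_(i < #|{: gT}|) oapp (fun k : 'I_#|{: gT}| => b (enum_val k)) 0 (insub i).
have Pf i : f`_i \in P.
  by rewrite coef_poly; case: ltnP => // lti; rewrite insubT /=.
have fb g : f`_(enum_rank g) = b g.
  by rewrite coef_poly ltn_ord valK /= enum_rankK.
have Of : f \is a polyOver O by apply/polyOverP => i; have /andP[] := POF _ (Pf i).
have Ff : f \is a polyOver F by apply/polyOverP => i; have /andP[] := POF _ (Pf i).
pose N := \prod_(g : gT) map_poly g f.
have ON : N \is a polyOver O.
  by apply: rpred_prod => g _; apply/polyOverP=> i; rewrite coef_map intO_gal ?(polyOverP Of).
have [h Dh] : exists h : {poly int}, N = map_poly intr h.
  apply: (gal_fixed_poly ON) => g.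
  rewrite /N rmorph_prod /= [RHS](reindex_inj (mulIg g)) /=; apply: eq_bigr => k _.
  by rewrite -map_poly_comp; apply: eq_map_poly => y /=; rewrite galM ?memvf.
(* The cofactor has its coefficients in [F], because the norm and [f] do. This matters as [P] is an
   ideal of the integers of [F] only. *)
pose Y := \prod_(g : gT | g != 1%g) map_poly g f.
have DN : N = f * Y.
  rewrite /N (bigD1 1%g) //=; congr (_ * _).
  by rewrite map_poly_id // => y _; rewrite gal_id.
have OY : Y \is a polyOver O.
  by apply: rpred_prod => g _; apply/polyOverP=> i; rewrite coef_map intO_gal ?(polyOverP Of).
have f0 : f != 0.
  apply: contraNneq (nQb 1%g) => f0; rewrite -fb f0 coef0 rmorph0; exact: primeO_0 prQ.
have FY : Y \is a polyOver F.
  apply: (polyOver_mul_cancel f0 Ff); rewrite -DN Dh.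
  by apply/polyOverP => i; rewrite coef_map /= rpred_int.
have PN i : N`_i \in P.
  rewrite DN coefM; elim/big_ind: _ => // j _; rewrite mulrC; apply: PM => //.
  by apply/andP; rewrite /= (polyOverP OY) (polyOverP FY).
have QN i : N`_i \in Q.
  have := PN i; rewrite Dh coef_map /= (primeO_int prQ pr_l Ql); set z := h`_i => Pz.
  apply: contraT => ndv; case/negP: P1.
  have /coprimezP[[u w] /= D1] : coprimez l z by rewrite coprimezE prime_coprime.
  have -> : 1 = u%:~R * l%:R + w%:~R * z%:~R :> L by rewrite -[l%:R]/(l%:~R) -!rmorphM -rmorphD D1.
  by apply: PD; apply: PM => //; apply/andP; split; rewrite ?rpred_int //= rpred_int.
have [g _ Qg] : exists2 g : gT, true & forall j, (map_poly g f)`_j \in Q.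
  apply: primeO_poly_prod QN => g _.
  by apply/polyOverP=> i; rewrite coef_map intO_gal ?(polyOverP Of).
by case/negP: (nQb g); rewrite -fb -coef_map.
Qed.

End ConjugatePrimes.

Section Unramified.
Variables (L : splittingFieldType rat) (iota : {rmorphism L -> algC}).
Local Notation gT := (gal_of {:L}).
Local Notation O := (intO iota).

Definition fixO (N : {set gT}) : {pred L} := [pred x | (x \in O) && [forall n in N, n x == x]].

Lemma fixOP (N : {set gT}) x : reflect (x \in O /\ forall n, n \in N -> n x = x) (x \in fixO N).
Proof.
apply: (iffP andP) => [[Ox /forall_inP fx]|[Ox fx]]; split=> //; first by move=> n /fx/eqP.
by apply/forall_inP => n /fx/eqP.
Qed.

Lemma fixO_subring_closed N : subring_closed (fixO N).
Proof.
split=> [|x y /fixOP[Ox fx] /fixOP[Oy fy]|x y /fixOP[Ox fx] /fixOP[Oy fy]]; apply/fixOP.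
- by split=> [|n _]; rewrite ?rpred1 ?rmorph1.
- by split=> [|n Nn]; rewrite ?rpredB // rmorphB /= fx ?fy.
- by split=> [|n Nn]; rewrite ?rpredM // rmorphM /= fx ?fy.
Qed.
HB.instance Definition _ N := GRing.isSubringClosed.Build L (fixO N) (fixO_subring_closed N).

(** The product vanishes when [h] is one of the listed automorphisms, and at [h = 1] it avoids a
    prime as soon as each factor does. Written as a sum of terms [a * h b], it isolates the identity
    term of a trace. *)
Lemma separating_sum (R : subringClosed L) (r : seq (gT * L)) :
    (forall gx, gx \in r -> gx.2 \in R /\ gx.1 gx.2 \in R) ->
  exists2 s : seq (L * L), forall ab, ab \in s -> ab.1 \in R /\ ab.2 \in R &
    forall h : gT, \sum_(ab <- s) ab.1 * h ab.2 = \prod_(gx <- r) (h gx.2 - gx.1 gx.2).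
Proof.
elim: r => [_|[g x] r IH Rr].
  exists [:: (1, 1)] => [ab|h]; first by rewrite inE => /eqP->; rewrite rpred1.
  by rewrite big_seq1 big_nil /= rmorph1 mulr1.
have [s Rs Ds] := IH (fun gx rgx => Rr gx (mem_behead (s := _ :: _) rgx)).
have /= [Rx Rgx] := Rr _ (mem_head _ _).
exists ([seq (ab.1, ab.2 * x) | ab <- s] ++ [seq (- g x * ab.1, ab.2) | ab <- s]).
  move=> ab; rewrite mem_cat => /orP[] /mapP[cd /Rs[Rc Rd] ->] /=; first by rewrite Rc rpredM.
  by rewrite Rd rpredM ?rpredN.
move=> h; rewrite big_cat !big_map big_cons -Ds /= mulr_sumr -big_split /=.
by apply: eq_bigr => ab _; rewrite rmorphM; ring.
Qed.

(* The inertia group of Q surjects onto that of the prime below in the fixed field of N. *)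
Lemma inertia_fixed (N : {group gT}) (Q : {pred L}) (s : gT) : primeO iota Q ->
    (forall g : gT, inertia iota [pred x | g x \in Q] \subset N) -> s \notin N ->
  exists2 x, x \in fixO N & s x - x \notin Q.
Proof.
move=> prQ IN nNs; apply: contrapT => nex.
have Qs x : x \in fixO N -> s x - x \in Q.
  by move=> fx; apply: contrapT => /negP nQ; apply: nex; exists x.
(* As [s n^-1] is not in [N], it is outside the inertia group of the conjugate of [Q] by [n]. *)
have /fin_all_exists[b Pb] (n : gT) : exists x, n \in N -> x \in O /\ s x - n x \notin Q.
  have [Nn|nNn] := boolP (n \in N); last by exists 0.
  have : (s * n^-1)%g \notin inertia iota [pred x | n x \in Q].
    by apply: contra nNs => /(subsetP (IN n)); rewrite groupMr ?groupV.
  move/inertiaP/existsNP => [x /not_implyP[Ox nQ]]; exists x => _; split=> //.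
  apply/negP => Qx; apply: nQ; rewrite inE rmorphB /= -galM ?memvf // -mulgA mulVg mulg1.
  by [].
pose f := \poly_(i < #|{: gT}|) oapp (fun k : 'I_#|{: gT}| =>
   if enum_val k \in N then b (enum_val k) else 0) 0 (insub i).
have fb n : n \in N -> f`_(enum_rank n) = b n.
  by move=> Nn; rewrite coef_poly ltn_ord valK /= enum_rankK Nn.
have Of : f \is a polyOver O.
  apply/polyOverP => i; rewrite coef_poly; case: ltnP => [lti|_]; last exact: rpred0.
  by rewrite insubT /=; case: ifP => [Nk|_]; [have [] := Pb _ Nk|rewrite rpred0].
have Ogf (g : gT) (h : {poly L}) : h \is a polyOver O -> map_poly g h \is a polyOver O.
  by move=> Oh; apply/polyOverP=> i; rewrite coef_map intO_gal ?(polyOverP Oh).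
(* The coefficients of [H] are fixed by [N], so by assumption [s] does not change them modulo [Q].
   As [s H] vanishes at [s f], so does [H] modulo [Q]: the product of the [s f - n f] is zero there,
   and Gauss's lemma gives one zero factor, against the choice of the [b n]. *)
pose H : {poly {poly L}} := \prod_(n in N) ('X - (map_poly n f)%:P).
have HO i : H`_i \is a polyOver O.
  rewrite /H; elim/big_rec: _ i => [|n h _ IH] i.
    by rewrite coef1; case: eqP => _; rewrite ?rpred1 ?rpred0.
  rewrite coefM; apply: rpred_sum => k _; rewrite rpredM ?IH //.
  by rewrite coefB coefX coefC; case: eqP => _; case: eqP => _; rewrite ?subr0 ?sub0r ?rpredB ?rpredN ?rpred1 ?rpred0 ?Ogf.
have Hfix (m : gT) : m \in N -> map_poly (map_poly m) H = H.
  move=> Nm; rewrite /H rmorph_prod /= [RHS](reindex_inj (mulIg m)) /=.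
  under [RHS]eq_bigl => n do rewrite groupMr //.
  apply: eq_bigr => n _; rewrite rmorphB /= map_polyX map_polyC /= -map_poly_comp; congr (_ - _%:P).
  by apply: eq_map_poly => y /=; rewrite galM ?memvf.
have HN i j : H`_i`_j \in fixO N.
  apply/fixOP; split=> [|m Nm]; first exact: (polyOverP (HO i)).
  by rewrite -coef_map -coef_map Hfix.
have f1 : map_poly (1%g : gT) f = f by rewrite map_poly_id // => y _; rewrite gal_id.
pose sf := map_poly s f; have Osf : sf \is a polyOver O by apply: Ogf.
have [n Nn Qn] : exists2 n, n \in N & forall j, (sf - map_poly n f)`_j \in Q.
  apply: (primeO_poly_prod prQ) => [n _|j]; first by rewrite rpredB ?Ogf.
  have -> : \prod_(n in N) (sf - map_poly n f) = H.[sf] - (map_poly (map_poly s) H).[sf].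
    rewrite /H rmorph_prod !horner_prod /= [X in _ - X](bigD1 1%g) //=.
    rewrite rmorphB /= map_polyX map_polyC /= !hornerE f1.
    by rewrite subrr mul0r subr0; apply: eq_bigr => n _; rewrite !hornerE.
  rewrite !horner_coef size_map_inj_poly ?rmorph0 //; last exact: map_poly_inj.
  rewrite -sumrB coef_sum; apply: (primeO_sum prQ) => i _.
  rewrite coef_map -mulrBl coefM; apply: (primeO_sum prQ) => k _.
  rewrite mulrC; apply: (primeO_M prQ); first by rewrite (polyOverP (rpredX _ Osf)).
  by rewrite coefB coef_map -opprB; apply/(primeO_N prQ)/Qs.
have [_] := Pb n Nn; case/negP.
by have := Qn (enum_rank n); rewrite coefB !coef_map /= fb.
Qed.

(* The fixed field of N is unramified: its integers are self-dual for the trace form. *)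
Lemma unramified_self_dual (N : {group gT}) (s : gT) (q : nat) :
    (forall g : gT, g \in 'N(N)%g) ->
    (forall l Q, prime l -> l%:R \in Q -> primeO iota Q -> inertia iota Q \subset N) ->
    (forall i, (0 < i < q)%N -> (s ^+ i)%g \notin N) -> (0 < q)%N ->
  forall y, (forall n, n \in N -> n y = y) ->
    (forall b, b \in fixO N -> exists z : int, \sum_(i < q) (s ^+ i)%g (y * b) = z%:~R) ->
  y \in O.
Proof.
move=> nN IN sN q0 y fy Ty.
have stabN (g : gT) x : x \in fixO N -> g x \in fixO N.
  move=> /fixOP[Ox fx]; apply/fixOP; split=> [|n Nn]; first exact: intO_gal.
  rewrite -galM ?memvf // -[(g * n)%g](mulgKV g) galM ?memvf //.
  congr (g _); apply: fx.
  by rewrite -{1}[g]invgK -mulgA -conjgE memJ_norm // groupV nN.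
apply: contrapT => nOy.
(* The ideal of denominators of [y]. If it is proper, it lies in some [Q], and the contradiction is
   a denominator outside [Q]. *)
pose J u := u \in O /\ u * y \in O.
have [|||||Q prQ JQ] := @primeO_exists L iota J.
- by move=> x [].
- by split; rewrite ?mul0r rpred0.
- by move=> u w [Ou Ouy] [Ow Owy]; split; rewrite ?mulrDl rpredD.
- by move=> a u Oa [Ou Ouy]; split; rewrite -?mulrA rpredM.
- by case=> _; rewrite mul1r => /nOy.
have [l pr_l Ql] : exists2 l, prime l & l%:R \in Q.
  have [k k0 Oky] := intO_nat_mul iota y.
  have : k%:R \in Q by apply: JQ; split; rewrite ?rpred_nat.
  elim/ltn_ind: k k0 {Oky} => k IH k0 Qk.
  have [k1|k1] := leqP k 1.
    have Dk : k = 1%N by clear -k0 k1; lia.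
    by move: Qk; rewrite Dk (negPf (primeO_1 prQ)).
  have pk := pdiv_prime k1; have [Qp|nQp] := boolP ((pdiv k)%:R \in Q); first by exists (pdiv k).
  move: Qk; rewrite -(divnK (pdiv_dvd k)) natrM => /(primeO_P prQ (rpred_nat _ _) (rpred_nat _ _)).
  case=> [Qd|]; last by rewrite (negPf nQp).
  apply: IH Qd; first by rewrite ltn_Pdiv // prime_gt1.
  by rewrite divn_gt0 ?pdiv_gt0 // dvdn_leq // pdiv_dvd.
have exx (i : 'I_q) : exists x, (0 < i)%N -> x \in fixO N /\ (s ^+ i)%g x - x \notin Q.
  have [i0|i0] := posnP i; first by exists 0; rewrite i0.
  have [||x fx nQx] := @inertia_fixed N Q (s ^+ i)%g prQ; last by exists x.
    move=> g; apply: (IN l) => //; first by rewrite inE rmorph_nat.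
    exact: primeO_gal.
  by apply: sN; rewrite i0 /=.
have [x Px] := fin_all_exists exx.
pose r := [seq ((s ^+ (nat_of_ord i))%g, x i) | i : 'I_q <- enum 'I_q & (0 < i)%N].
have [|S RS DS] := @separating_sum (fixO N) r.
  move=> gx /mapP[i]; rewrite mem_filter => /andP[i0 _] -> /=.
  by have [fx _] := Px i i0; split=> //; apply: stabN.
have D0 (j : 'I_q) : (0 < j)%N -> \sum_(ab <- S) ab.1 * (s ^+ j)%g ab.2 = 0.
  move=> j0; rewrite DS (big_rem ((s ^+ j)%g, x j)) /=; first by rewrite subrr mul0r.
  by apply/mapP; exists j; rewrite // mem_filter j0 mem_enum.
pose u := \sum_(ab <- S) ab.1 * ab.2.
have nQu : u \notin Q.
  rewrite /u; under eq_bigr => ab _ do rewrite -[ab.2](gal_id {:L}%AS).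
  rewrite DS big_map big_filter big_enum_cond; apply/negP => /(primeO_prod prQ)[i /andP[_ i0]|i /andP[_ i0]].
    by have [/fixOP[Ox _] _] := Px i i0; rewrite gal_id rpredB ?intO_gal.
  have [_ nQx] := Px i i0; rewrite gal_id -opprB => /(primeO_N prQ).
  by rewrite opprK (negPf nQx).
have RS' ab : ab \in S -> ab.1 \in O /\ ab.2 \in O.
  by move=> /RS[/fixOP[Oa _] /fixOP[Ob _]].
have Ou : u \in O.
  by rewrite /u big_seq; apply: rpred_sum => ab /RS'[Oa Ob]; rewrite rpredM.
case/negP: nQu; apply: JQ; split=> //.
(* Expanding the traces and exchanging the sums, the coefficient of [(s^i) y] is the separating sum
   at [s^i]: zero for [i > 0] and [u] for [i = 0]. *)
have -> : u * y = \sum_(ab <- S) ab.1 * \sum_(i < q) (s ^+ i)%g (y * ab.2).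
  under eq_bigr => ab _ do rewrite mulr_sumr.
  rewrite exchange_big /= (bigD1 (Ordinal q0)) //= [X in _ = _ + X]big1 => [|j j0]; last first.
    under eq_bigr => ab _ do rewrite rmorphM mulrCA.
    by rewrite -mulr_sumr D0 ?mulr0 // lt0n.
  rewrite addr0 /u mulr_suml; apply: eq_bigr => ab _; rewrite gal_id; ring.
rewrite big_seq; apply: rpred_sum => ab Sab; have [Oa _] := RS' _ Sab; have [_ Rb] := RS _ Sab.
by rewrite rpredM //; have [z ->] := Ty _ Rb; rewrite rpred_int.
Qed.

End Unramified.

Section MinimalValue.
Variables (L : splittingFieldType rat) (iota : {rmorphism L -> algC}).
Local Notation gT := (gal_of {:L}).
Local Notation O := (intO iota).
Variables (Q : {pred L}) (prQ : primeO iota Q).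

(* A conjugate of Q contained in Q equals Q, the group being finite. *)
Lemma primeO_conj_sub (g : gT) : (forall x, x \in O -> g x \in Q -> x \in Q) ->
  forall x, x \in Q -> g x \in Q.
Proof.
move=> gQ x Qx; have Ox := primeO_sub prQ Qx.
have gnQ n y : y \in O -> (g ^+ n)%g y \in Q -> y \in Q.
  elim: n y => [|n IH] y Oy; first by rewrite gal_id.
  by rewrite expgSr galM ?memvf // => /(gQ _ (intO_gal _ Oy))/(IH _ Oy).
apply: (gnQ #[g]%g.-1); first exact: intO_gal.
by rewrite -galM ?memvf // -expgS prednK ?order_gt0 // expg_order gal_id.
Qed.

Variables (l : nat) (pr_l : prime l) (Ql : l%:R \in Q).
Variables (v : L -> int) (hv : valuation v).
Hypotheses (v_l : 0 < v l%:R) (v_loc : forall x, x != 0 -> (0 <= v x <-> locO iota Q x)).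
Hypothesis (v_Q : forall x, x \in O -> vge v 1 x = (x \in Q)).

(* If the inertia group of Q in A = Gal(L / F) is trivial, then Q is unramified over F. *)
Lemma unramified_min_val (A : {group gT}) (k : int) :
    (forall g, g \in A -> g \in inertia iota Q -> g = 1%g) ->
    (forall z, z \in fixO iota A -> vge v 1 z -> vge v k z) ->
  forall y, vge v 1 y -> vge v k y.
Proof.
move=> IA kmin y0 vy0.
have [a [s [Oa Os nQs Dy]]] : exists a s, [/\ a \in O, s \in O, s \notin Q & y0 = a / s].
  by apply: (locO_frac prQ); apply: (vge0_loc prQ v_loc); apply: vge_le vy0.
have vmulr u x : u \in O -> u \notin Q -> vge v k (x * u) -> vge v k x.
  move=> Ou nQu vxu; have [u0 vu] := notin_val prQ v_loc v_Q Ou nQu.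
  by rewrite -[x](mulfK u0); apply: (vge_div hv) => //; rewrite vu addr0.
have [s0 vs] := notin_val prQ v_loc v_Q Os nQs.
suffices va : vge v k a by rewrite Dy; apply: (vge_div hv) => //; rewrite vs addr0.
have Qa : a \in Q.
  by rewrite -v_Q // -(divfK s0 a) -Dy (vgeMr hv) // (vge_intO prQ v_loc).
(* The traces below must have positive value, so every conjugate of the element must lie in [Q].
   Multiplying [a] by suitable elements outside [Q] achieves this without changing its value. *)
have ext (g : gT) : exists t, [/\ t \in O, t \notin Q & g (a * t) \in Q].
  have [gQ|] := pselect (forall x, x \in O -> g x \in Q -> x \in Q).
    by exists 1; rewrite rpred1 (primeO_1 prQ) mulr1 (primeO_conj_sub gQ).
  move/existsNP => [t /not_implyP[Ot /not_implyP[Qgt /negP nQt]]]; exists t; split=> //.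
  by rewrite rmorphM; apply: (primeO_M prQ); rewrite ?intO_gal.
have [t Pt] := fin_all_exists ext.
pose T := \prod_(g : gT) t g.
have OT : T \in O by apply: rpred_prod => g _; have [] := Pt g.
have nQT : T \notin Q.
  apply/negP => /(primeO_prod prQ)[g _|g _]; first by have [] := Pt g.
  by have [_ /negPf->] := Pt g.
have QaT (g : gT) : g (a * T) \in Q.
  rewrite /T (bigD1 g) //= mulrA rmorphM mulrC; apply: (primeO_M prQ); last by have [] := Pt g.
  by apply/intO_gal/rpred_prod => h _; have [] := Pt h.
apply: (vmulr T) => //; set y := a * T in QaT *.
have exx (g : gT) : exists x, g \in A -> g != 1%g -> x \in O /\ g x - x \notin Q.
  have [Ag|_] := boolP (g \in A); last by exists 0.
  have [_|g1] := eqVneq g 1%g; first by exists 0.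
  have : g \notin inertia iota Q by apply: contraNN g1 => /(IA _ Ag)/eqP.
  by move/inertiaP/existsNP => [x /not_implyP[Ox /negP nQ]]; exists x.
have [x Px] := fin_all_exists exx.
pose r := [seq (g, x g) | g : gT <- enum (A :\ 1%g)].
have [|S RS DS] := @separating_sum L (intO iota) r.
  move=> gx /mapP[g]; rewrite mem_enum !inE => /andP[g1 Ag] -> /=.
  by have [Ox _] := Px g Ag g1; split=> //; apply: intO_gal.
have D0 (h : gT) : h \in A -> h != 1%g -> \sum_(ab <- S) ab.1 * h ab.2 = 0.
  move=> Ah h1; rewrite DS (big_rem (h, x h)) /=; first by rewrite subrr mul0r.
  by apply/mapP; exists h; rewrite // mem_enum !inE h1.
pose u := \sum_(ab <- S) ab.1 * ab.2.
have Ou : u \in O.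
  by rewrite /u big_seq; apply: rpred_sum => ab /RS[Oa' Ob]; rewrite rpredM.
have nQu : u \notin Q.
  rewrite /u; under eq_bigr => ab _ do rewrite -[ab.2](gal_id {:L}%AS).
  rewrite DS big_map big_enum /=; apply/negP => /(primeO_prod prQ)[g|g]; rewrite in_setD1 => /andP[g1 Ag].
    by have [Ox _] := Px g Ag g1; rewrite gal_id rpredB ?intO_gal.
  have [_ nQx] := Px g Ag g1; rewrite gal_id -opprB => /(primeO_N prQ).
  by rewrite opprK (negPf nQx).
apply: (vmulr u) => //.
(* The separating sum again: [y u] is a combination of traces over [A], which lie in the fixed field
   and have positive value, hence value at least [k]; and [u] is a unit at [Q]. *)
have -> : y * u = \sum_(ab <- S) ab.1 * \sum_(g in A) g (y * ab.2).
  under eq_bigr => ab _ do rewrite mulr_sumr.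
  rewrite exchange_big /= (bigD1 1%g) //= [X in _ = _ + X]big1 => [|g /andP[Ag g1]]; last first.
    under eq_bigr => ab _ do rewrite rmorphM mulrCA.
    by rewrite -mulr_sumr D0 ?mulr0.
  rewrite addr0 /u mulr_sumr; apply: eq_bigr => ab _; rewrite gal_id; ring.
rewrite big_seq; apply: (vge_sum hv) => ab /RS[Oa' Ob].
apply: (vgeMl hv); first exact: (vge_intO prQ v_loc).
apply: kmin.
  apply/fixOP; split=> [|h Ah].
    by apply: rpred_sum => g _; rewrite intO_gal // rpredM // rpredM.
  rewrite rmorph_sum /= [RHS](reindex_inj (mulIg h)) /=.
  under [RHS]eq_bigl => g do rewrite groupMr //.
  by apply: eq_bigr => g _; rewrite galM ?memvf.
apply: (vge_sum hv) => g _; rewrite v_Q; last by rewrite intO_gal // rpredM // rpredM.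
by rewrite rmorphM mulrC; apply: (primeO_M prQ); [exact: intO_gal|exact: QaT].
Qed.

End MinimalValue.

(** * Minkowski's theorem *)

Lemma card_dffun_ord n (K : 'I_n -> nat) :
  #|{dffun forall j : 'I_n, 'I_(K j).+1}| = (\prod_j (K j).+1)%N.
Proof.
by rewrite card_dep_ffun foldrE big_map big_enum /=; apply: eq_bigr => j _; rewrite card_ord.
Qed.

Lemma unitmx_int_det n (U : 'M[int]_n) : U \in unitmx -> `|\det U|%N = 1%N.
Proof. by rewrite unitmxE => /orP[] /eqP->. Qed.

(* The rows of an integer matrix A generate a lattice of index |det A|. *)
Lemma lattice_pigeonhole n (A : 'M[int]_n) (K : 'I_n -> nat) :
    \det A != 0 -> (`|\det A| < \prod_j (K j).+1)%N ->
  exists2 w : 'rV[int]_n, w != 0 & forall j, (`|(w *m A) 0%R j| <= K j)%N.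
Proof.
move=> dA ltA; have [U uU [V uV [d _ DA]]] := int_Smith_normal_form A.
have Dd : \matrix_(i, j) (d`_i *+ (i == j :> nat)) = diag_mx (\row_(i < n) d`_i).
  by apply/matrixP => i j; rewrite !mxE val_eqE.
pose e (i : 'I_n) : int := d`_i.
have ddet : (`|\det A| = \prod_(i < n) `|e i|)%N.
  rewrite DA Dd !det_mulmx !abszM (unitmx_int_det uU) (unitmx_int_det uV) mul1n muln1 det_diag.
  rewrite (big_morph _ abszM (erefl : `|1%Z|%N = 1%N)).
  by apply: eq_bigr => i _; rewrite mxE.
have d0 (i : 'I_n) : d`_i != 0.
  by apply: contraNneq dA => di0; rewrite -absz_eq0 ddet (bigD1 i) //= /e di0 absz0 mul0n.
have e0 i : e i != 0 by apply: d0.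
pose dn (i : 'I_n) := `|e i|.-1; have Ddn i : (dn i).+1 = `|e i|%N.
  by rewrite /dn prednK // absz_gt0 d0.
pose zz (z : {dffun forall j : 'I_n, 'I_(K j).+1}) : 'rV[int]_n := \row_j (z j : nat)%:Z.
(* The class of [z] modulo the lattice: in the coordinates of the Smith form, lattice vectors are
   those whose [i]-th coordinate is divisible by [e i]. *)
pose f (z : {dffun forall j : 'I_n, 'I_(K j).+1}) : {dffun forall i : 'I_n, 'I_(dn i).+1} :=
  [ffun i => inord `|((zz z *m invmx V) 0%R i %% e i)%Z|%N].
have /injectivePn[z1 [z2 z12 fz]] : ~~ injectiveb f.
  apply: contraTN ltA => /injectiveP/leq_card; rewrite !card_dffun_ord -leqNgt ddet.
  by move/leq_trans; apply; apply: leq_prod => i _; rewrite Ddn.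
have [y Dyz] : exists y, y = (zz z1 - zz z2) *m invmx V by eexists.
have dvy i : (e i %| y 0%R i)%Z.
  have := congr1 (fun g : {dffun forall i : 'I_n, 'I_(dn i).+1} => nat_of_ord (g i)) fz.
  have ltm z : (`|((zz z *m invmx V) 0%R i %% e i)%Z| < (dn i).+1)%N.
    by rewrite Ddn -ltz_nat gez0_abs ?modz_ge0 ?abszE ?ltz_mod ?d0 //; apply: d0.
  rewrite !ffunE !inordK // => /(congr1 Posz); rewrite !gez0_abs ?modz_ge0 ?e0 // => E.
  by rewrite Dyz mulmxBl mxE [X in _ + X]mxE -eqz_mod_dvd; apply/eqP.
pose t : 'rV[int]_n := \row_i (y 0%R i %/ e i)%Z.
have Dy : y = t *m diag_mx (\row_(i < n) d`_i).
  by apply/rowP => i; rewrite mul_mx_diag !mxE divzK.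
exists (t *m invmx U); last first.
  move=> j; have -> : t *m invmx U *m A = zz z1 - zz z2.
    by rewrite DA Dd !mulmxA mulmxKV // -Dy Dyz mulmxKV.
  rewrite !mxE; have := ltn_ord (z1 j); have := ltn_ord (z2 j).
  by move: (z1 j : nat) (z2 j : nat) => a b; clear; lia.
apply: contraNneq z12 => w0; apply/eqP/ffunP => j.
have z0 : zz z1 - zz z2 = 0.
  have -> : zz z1 - zz z2 = t *m invmx U *m A by rewrite DA Dd !mulmxA mulmxKV // -Dy Dyz mulmxKV.
  by rewrite w0 mul0mx.
apply: val_inj; have := congr1 (fun r : 'rV[int]_n => r 0%R j) (subr0_eq z0).
by rewrite !mxE => -[].
Qed.

Section LinearForms.
Variable R : archiRealFieldType.
Implicit Types (n : nat) (eta : R).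

(** The right-hand side is a product of row sums; expanded, it runs over all maps of the indices, of
    which the determinant retains the permutations. *)
Lemma det_near_id_le n (H : 'M[R]_n) eta : (forall i j, `|H i j| <= eta) -> 0 <= eta ->
  `|\det (1%:M - H)| <= (1 + n%:R * eta) ^+ n.
Proof.
move=> He eta0; pose F (i j : 'I_n) : R := (i == j)%:R + eta.
have F0 (i j : 'I_n) : 0 <= F i j by rewrite addr_ge0 ?ler0n.
have -> : (1 + n%:R * eta) ^+ n = \sum_(f : {ffun 'I_n -> 'I_n}) \prod_i F i (f i).
  rewrite -(bigA_distr_bigA F) /=.
  rewrite (eq_bigr (fun=> 1 + n%:R * eta)) => [|i _]; first by rewrite prodr_const card_ord.
  rewrite big_split /= sumr_const card_ord mulr_natl; congr (_ + _).
  by rewrite (bigD1 i) //= eqxx big1 ?addr0 // => j /negPf; rewrite eq_sym => ->.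
rewrite (bigID (fun f : {ffun 'I_n -> 'I_n} => injectiveb f)) /=.
rewrite -[leLHS]addr0 lerD //; last by apply: sumr_ge0 => f _; apply: prodr_ge0.
rewrite (reindex (@pval _)) /=; last first.
  pose in_Sn := insubd (1%g : 'S_n).
  by exists in_Sn => /= f Uf; first apply: val_inj; apply: insubdK.
rewrite /determinant (le_trans (ler_norm_sum _ _ _)) //.
rewrite [leRHS](eq_bigl xpredT) => [|s]; last exact: (valP s).
apply: ler_sum => s _; rewrite normrM normrX normrN1 expr1n mul1r normr_prod.
apply: ler_prod => i _; rewrite normr_ge0 !mxE pvalE /=.
apply: le_trans (ler_normB _ _) _; rewrite /F lerD //.
by case: (i == s i); rewrite ?normr1 ?normr0.
Qed.

Lemma sum_norm_mul_le n (x : 'rV[R]_n) (H : 'M[R]_n) eta j :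
  (forall i j, `|H i j| <= eta) -> `|(x *m H) 0 j| <= eta * \sum_i `|x 0 i|.
Proof.
move=> He; rewrite mxE (le_trans (ler_norm_sum _ _ _)) // mulr_sumr; apply: ler_sum => i _.
by rewrite normrM mulrC ler_wpM2r.
Qed.

(** The matrix [m B] is rounded to an integer matrix, to which the pigeonhole principle applies. The
    factor [t > 1] absorbs the rounding error, for [m] large; [s] splits it between the determinant
    and the final estimate. *)
Lemma minkowski_forms n (B : 'M[R]_n.+1) (c : 'I_n.+1 -> R) (t : R) :
    \det B != 0 -> (forall j, 0 < c j) -> `|\det B| <= \prod_j c j -> 1 < t ->
  exists2 w : 'rV[int]_n.+1, w != 0 & forall j, `|(map_mx intr w *m B) 0 j| <= t * c j.
Proof.
move=> dB c0 ltB t1.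
have [s s1 st] : exists2 s, 1 < s & s < t by exists ((1 + t) / 2); lra.
have s0 : 0 <= s by lra.
have uB : B \in unitmx by rewrite unitmxE unitfE.
pose beta := \sum_i \sum_k `|invmx B i k|.
have beta0 : 0 <= beta by apply: sumr_ge0 => i _; apply: sumr_ge0.
pose C := \sum_j c j; have C0 : 0 <= C by apply: sumr_ge0 => j _; apply: ltW.
pose D := \sum_j (c j)^-1; have D0 : 0 <= D by apply: sumr_ge0 => j _; rewrite invr_ge0 ltW.
(* The three demands on [eta], the bound for the entries of [H]: [T1] gives [(n + 1) eta <= 1 / 2],
   so that [1 - H] is invertible; [T2] keeps the determinant of [1 - H] below [s^(n+1)]; [T3] keeps
   the error in the [j]-th form below [(t - s) c j]. *)
pose T1 : R := 2 * n.+1%:R; pose T2 : R := n.+1%:R / (s - 1); pose T3 := 2 * s * C * D / (t - s).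
have T10 : 0 <= T1 by rewrite mulr_ge0 ?ler0n.
have T20 : 0 <= T2 by rewrite mulr_ge0 ?invr_ge0 ?ler0n // subr_ge0 ltW.
have T30 : 0 <= T3.
  by rewrite !mulr_ge0 ?invr_ge0 ?subr_ge0 ?(ltW st) ?ler0n //.
have [m m0 ltm] : exists2 m : R, 0 < m & beta * (T1 + T2 + T3) < m.
  exists (Num.bound (beta * (T1 + T2 + T3)))%:R.
    by apply: le_lt_trans (archi_boundP _); rewrite mulr_ge0 ?addr_ge0.
  by apply: archi_boundP; rewrite mulr_ge0 ?addr_ge0.
pose eta := beta / m; have eta0 : 0 <= eta by rewrite divr_ge0 // ltW.
have etaT T : 0 <= T -> T <= T1 + T2 + T3 -> eta * T <= 1.
  move=> T0 leT; rewrite /eta mulrAC ler_pdivrMr // mul1r (le_trans _ (ltW ltm)) //.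
  by rewrite ler_wpM2l.
have eta1 : n.+1%:R * eta <= 1 / 2.
  have : eta * T1 <= 1 by apply: etaT => //; lra.
  by rewrite /T1; lra.
have eta4 : 0 <= n.+1%:R * eta by apply: mulr_ge0.
have eta2 : 1 + n.+1%:R * eta <= s.
  have : eta * T2 <= 1 by apply: etaT => //; lra.
  rewrite /T2 mulrA ler_pdivrMr; last by lra.
  by lra.
have eta3 j : eta * (2 * s * C) <= (t - s) * c j.
  have : eta * T3 <= 1 by apply: etaT => //; lra.
  rewrite /T3 !mulrA ler_pdivrMr ?mul1r; last by lra.
  move=> le3; rewrite -ler_pdivrMr //; apply: le_trans le3.
  apply: ler_wpM2l; first by do 3!(apply: mulr_ge0 => //).
  rewrite /D (bigD1 j) //= lerDl; apply: sumr_ge0 => k _.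
  by rewrite invr_ge0 ltW.
pose A : 'M[int]_n.+1 := \matrix_(i, j) Num.floor (m * B i j).
pose E := B - m^-1 *: map_mx intr A.
have leE i j : `|E i j| <= m^-1.
  have -> : E i j = m^-1 * (m * B i j - (Num.floor (m * B i j))%:~R).
    by rewrite !mxE mulrBr mulKf // gt_eqF.
  have /andP[fl fr] := floor_itv (m * B i j).
  rewrite normrM gtr0_norm ?invr_gt0 // ler_piMr ?invr_ge0 ?(ltW m0) //.
  by rewrite ler_norml; move: fr; rewrite rmorphD /=; lra.
pose H := invmx B *m E.
have leH i j : `|H i j| <= eta.
  rewrite mxE (le_trans (ler_norm_sum _ _ _)) //.
  apply: (@le_trans _ _ ((\sum_k `|invmx B i k|) / m)).
    by rewrite mulr_suml; apply: ler_sum => k _; rewrite normrM ler_wpM2l.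
  rewrite /eta ler_wpM2r ?invr_ge0 ?(ltW m0) // /beta [leRHS](bigD1 i) //= lerDl.
  by apply: sumr_ge0 => k _; apply: sumr_ge0.
have DA : map_mx intr A = m *: (B *m (1%:M - H)).
  rewrite mulmxBr mulmx1 mulmxA mulmxV // mul1mx /E subKr scalerA mulfV ?scale1r //.
  by rewrite gt_eqF.
have dH : \det (1%:M - H) != 0.
  apply/negP => /det0P[v v0]; rewrite mulmxBr mulmx1 => /eqP; rewrite subr_eq0 => /eqP Dv.
  pose X := \sum_i `|v 0 i|; have X0 : 0 <= X by apply: sumr_ge0.
  have leX : X <= n.+1%:R * eta * X.
    have -> : n.+1%:R * eta * X = \sum_(j < n.+1) eta * X.
      by rewrite sumr_const card_ord -[RHS]mulr_natl mulrA.
    by apply: ler_sum => j _; rewrite {1}Dv; apply: sum_norm_mul_le.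
  have : X = 0.
    apply/eqP; rewrite eq_le X0 andbT leNgt; apply/negP => Xgt0.
    have : n.+1%:R * eta * X <= 1 / 2 * X by rewrite ler_wpM2r.
    by lra.
  move/eqP; rewrite psumr_eq0 => [/allP v_0|//]; case/eqP: v0; apply/rowP => i.
  by rewrite mxE; apply/normr0_eq0/eqP/v_0; rewrite mem_index_enum.
pose K j := Num.truncn (m * s * c j).
have msc j : 0 < m * s * c j by rewrite !mulr_gt0 //; lra.
have [||w w0 wK] := @lattice_pigeonhole _ A K.
- rewrite -(intr_eq0 R) -det_map_mx DA detZ det_mulmx.
  by apply: mulf_neq0; [rewrite expf_neq0 // gt_eqF|apply: mulf_neq0].
- rewrite -(ltr_nat R) natr_absz intr_norm -det_map_mx DA detZ det_mulmx !normrM.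
  rewrite natr_prod; apply: le_lt_trans (_ : \prod_j (m * s * c j) < _); last first.
    apply: ltr_prod => [|j _]; first by apply/hasP; exists ord0; rewrite ?mem_index_enum.
    by rewrite (ltW (msc j)) /= truncnS_gt.
  rewrite !big_split /= !prodr_const card_ord normrX gtr0_norm // -mulrA ler_wpM2l ?exprn_ge0 ?(ltW m0) //.
  rewrite mulrC; apply: ler_pM => //; apply: le_trans (det_near_id_le leH eta0) _.
  by rewrite lerXn2r ?nnegrE //; lra.
exists w => // j.
pose y := map_mx intr w *m (m^-1 *: map_mx intr A) : 'rV[R]_n.+1.
pose x := map_mx intr w *m B.
have ley i : `|y 0 i| <= s * c i.
  have -> : y 0 i = m^-1 * ((w *m A) 0%R i)%:~R.
    by rewrite /y -scalemxAr mxE -map_mxM mxE.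
  rewrite normrM gtr0_norm ?invr_gt0 // mulrC ler_pdivrMr // -intr_norm -abszE.
  rewrite (le_trans (_ : _ <= (K i)%:R)) ?ler_nat ?wK //.
  by rewrite mulrC mulrA truncn_le // ltW.
have Dx : x = y + x *m H.
  by rewrite /y DA scalerA mulVf ?gt_eqF // scale1r mulmxA mulmxBr mulmx1 subrK.
pose X := \sum_i `|x 0 i|; have X0 : 0 <= X by apply: sumr_ge0.
have lexy i : `|x 0 i| <= s * c i + eta * X.
  by rewrite {1}Dx mxE (le_trans (ler_normD _ _)) // lerD // sum_norm_mul_le.
have leX : X <= 2 * s * C.
  have : X <= s * C + n.+1%:R * eta * X.
    have -> : s * C + n.+1%:R * eta * X = \sum_(i < n.+1) (s * c i + eta * X).
      rewrite big_split /= -mulr_sumr sumr_const card_ord; congr (_ + _).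
      by rewrite -[RHS]mulr_natl; exact: (esym (mulrA _ _ _)).
    by apply: ler_sum => i _; apply: lexy.
  have : n.+1%:R * eta * X <= 1 / 2 * X by rewrite ler_wpM2r.
  by lra.
have := lexy j; have := eta3 j; have : eta * X <= eta * (2 * s * C) by rewrite ler_wpM2l.
by rewrite -/x; lra.
Qed.

End LinearForms.

(** * Discriminants of cyclic fields of prime degree *)

Section CyclicFixedField.
Variables (L : splittingFieldType rat) (iota : {rmorphism L -> algC}).
Local Notation gT := (gal_of {:L}).
Variables (N : {group gT}) (s : gT) (q : nat).
Hypotheses (nN : forall g : gT, g \in 'N(N)%g) (q1 : (1 < q)%N).
Hypotheses (sqN : (s ^+ q)%g \in N) (sN : forall i, (0 < i < q)%N -> (s ^+ i)%g \notin N).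
Hypothesis (gen : forall g : gT, exists i n, n \in N /\ g = (n * s ^+ i)%g).
Local Notation ON := (fixO iota N).

Lemma fixO_gal (g : gT) x : x \in ON -> g x \in ON.
Proof.
move=> /fixOP[Ox fx]; apply/fixOP; split=> [|n Nn]; first exact: intO_gal.
rewrite -galM ?memvf // -[(g * n)%g](mulgKV g) galM ?memvf //.
congr (g _); apply: fx.
by rewrite -{1}[g]invgK -mulgA -conjgE memJ_norm // groupV nN.
Qed.

Lemma sumr_cyclic (f : nat -> L) : f q = f 0%N -> \sum_(i < q) f i.+1 = \sum_(i < q) f i.
Proof.
move=> fq; case: q fq => [|m] fq; first by rewrite !big_ord0.
by rewrite big_ord_recr big_ord_recl /= fq addrC.
Qed.

Lemma prodr_cyclic (f : nat -> L) : f q = f 0%N -> \prod_(i < q) f i.+1 = \prod_(i < q) f i.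
Proof.
move=> fq; case: q fq => [|m] fq; first by rewrite !big_ord0.
by rewrite big_ord_recr big_ord_recl /= fq mulrC.
Qed.

Lemma fixO_int x : x \in ON -> s x = x -> exists z : int, x = z%:~R.
Proof.
move=> /fixOP[Ox fx] sx; apply: (intO_fixed Ox) => g.
have [i [n [Nn ->]]] := gen g; rewrite galM ?memvf // fx //.
elim: i => [|i IH]; first by rewrite gal_id.
by rewrite expgSr galM ?memvf // IH.
Qed.

Lemma fixO_sqK x : x \in ON -> (s ^+ q)%g x = x.
Proof. by case/fixOP => _ ->. Qed.

Lemma trace_int x : x \in ON -> exists z : int, \sum_(i < q) (s ^+ i)%g x = z%:~R.
Proof.
move=> fx; apply: fixO_int; first by apply: rpred_sum => i _; apply: fixO_gal.
rewrite rmorph_sum /= -(sumr_cyclic (f := fun i => (s ^+ i)%g x)) ?gal_id ?fixO_sqK //.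
by apply: eq_bigr => i _; rewrite expgSr galM ?memvf.
Qed.

Lemma norm_int x : x \in ON -> exists z : int, \prod_(i < q) (s ^+ i)%g x = z%:~R.
Proof.
move=> fx; apply: fixO_int; first by apply: rpred_prod => i _; apply: fixO_gal.
rewrite rmorph_prod /= -(prodr_cyclic (f := fun i => (s ^+ i)%g x)) ?gal_id ?fixO_sqK //.
by apply: eq_bigr => i _; rewrite expgSr galM ?memvf.
Qed.

(** The square of its determinant is the discriminant of the family [c], and its transpose times
    itself is the Gram matrix of the trace form. *)
Definition conj_mx (c : 'I_q -> L) : 'M[L]_q := \matrix_(i, j) (s ^+ i)%g (c j).

Lemma gram_int (c : 'I_q -> L) : (forall j, c j \in ON) ->
  exists G : 'M[int]_q, (conj_mx c)^T *m conj_mx c = map_mx intr G.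
Proof.
move=> Oc; have /fin_all_exists[g Dg] (ij : 'I_q * 'I_q) :
    exists z : int, ((conj_mx c)^T *m conj_mx c) ij.1 ij.2 = z%:~R.
  have [z Dz] := trace_int (rpredM (Oc ij.1) (Oc ij.2)); exists z; rewrite -Dz mxE.
  by apply: eq_bigr => k _; rewrite !mxE rmorphM.
by exists (\matrix_(i, j) g (i, j)); apply/matrixP => i j; rewrite (Dg (i, j)) !mxE.
Qed.

Lemma disc_int (c : 'I_q -> L) : (forall j, c j \in ON) ->
  exists d : int, \det (conj_mx c) ^+ 2 = d%:~R.
Proof.
move=> /gram_int[G DG]; exists (\det G).
by rewrite -det_map_mx -DG det_mulmx det_tr expr2.
Qed.

Hypothesis (q_pr : prime q).

(** Powers of an integer [x] moved by [s]. As [q] is prime, the [q] conjugates of [x] are distinct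
    and the Vandermonde determinant does not vanish. *)
Lemma basis_exists : exists c : 'I_q -> L, (forall j, c j \in ON) /\ \det (conj_mx c) != 0.
Proof.
have [x Ox sx] : exists2 x, x \in ON & s x != x.
  apply: contrapT => nex; have := sN (i := 1); rewrite q1 expg1 => /(_ isT)/negP; apply.
  rewrite -(gal_fixedField N) gal_kHom ?subvf //; apply/kAHomP => y.
  move/fixedFieldP; rewrite memvf => /(_ isT) fy; apply/eqP.
  have [k k0 Oky] := intO_nat_mul iota y.
  have kn0 : k%:R != 0 :> L by rewrite (natr_num_eq0 iota) -lt0n.
  have Oy : k%:R * y \in ON.
    by apply/fixOP; split=> // n Nn; rewrite rmorphM rmorph_nat /= fy.
  apply: contrapT => nsy; apply: nex; exists (k%:R * y) => //.
  by rewrite rmorphM rmorph_nat (inj_eq (mulfI kn0)); apply/eqP => E; apply: nsy; rewrite E.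
exists (fun j : 'I_q => x ^+ j); split=> [j|]; first exact: rpredX.
have sx_nz k : (s ^+ k)%g x = x -> (q %| k)%N.
  move=> kx; apply: contraT => nqk.
  have co : coprime k q by rewrite coprime_sym prime_coprime.
  have skm m : (s ^+ (m * k))%g x = x.
    elim: m => [|m IH]; first by rewrite gal_id.
    by rewrite mulSn expgD galM ?memvf // kx.
  have sqm m : (s ^+ (m * q))%g x = x.
    elim: m => [|m IH]; first by rewrite gal_id.
    by rewrite mulSn expgD galM ?memvf // fixO_sqK.
  have k0 : (0 < k)%N by rewrite lt0n; apply: contraNneq nqk => ->.
  have [u w Duw _] := egcdnP q k0; move: co Duw; rewrite /coprime => /eqP-> Duw.
  have := skm u; rewrite Duw expgD galM ?memvf // sqm expg1 => E.
  by rewrite E eqxx in sx.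
have -> : conj_mx (fun j : 'I_q => x ^+ j) = (Vandermonde q (\row_(i < q) (s ^+ i)%g x))^T.
  by apply/matrixP => i j; rewrite !mxE rmorphXn.
rewrite det_tr det_Vandermonde prodf_seq_neq0; apply/allP => i _ /=.
rewrite prodf_seq_neq0; apply/allP => j _ /=; apply/implyP => ltij.
rewrite !mxE subr_eq0; apply/eqP => E.
have /sx_nz : (s ^+ (j - i))%g x = x.
  have : (s ^+ i)%g ((s ^+ (j - i))%g x) = (s ^+ i)%g x.
    by rewrite -galM ?memvf // -expgD subnK ?(ltnW ltij).
  exact: fmorph_inj.
by rewrite gtnNdvd ?subn_gt0 // (leq_ltn_trans (leq_subr _ _)).
Qed.

End CyclicFixedField.

(** Cramer's rule, read as a formula for the new determinant. *)
Lemma det_replace_col (F : fieldType) n (T T' : 'M[F]_n) (k : 'I_n) (r : 'cV[F]_n) :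
    (forall i, T' i k = (T *m r) i 0) -> (forall i j, j != k -> T' i j = T i j) ->
  \det T' = r k 0 * \det T.
Proof.
move=> Tk Tj; rewrite (expand_det_col _ k).
transitivity (\sum_i (T *m r) i 0 * cofactor T i k).
  apply: eq_bigr => i _; rewrite Tk /cofactor; congr (_ * (_ * \det _)).
  by apply/matrixP => a b; rewrite !mxE Tj // eq_sym neq_lift.
have <- : (\adj T *m (T *m r)) k 0 = \sum_i (T *m r) i 0 * cofactor T i k.
  by rewrite mxE; apply: eq_bigr => i _; rewrite !mxE mulrC.
by rewrite mulmxA mul_adj_mx mul_scalar_mx mxE mulrC.
Qed.

Section UnimodularBasis.
Variables (L : splittingFieldType rat) (iota : {rmorphism L -> algC}).
Local Notation gT := (gal_of {:L}).
Local Notation O := (intO iota).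
Variables (N : {group gT}) (s : gT) (q : nat).
Hypotheses (nN : forall g : gT, g \in 'N(N)%g) (q1 : (1 < q)%N).
Hypotheses (sqN : (s ^+ q)%g \in N) (sN : forall i, (0 < i < q)%N -> (s ^+ i)%g \notin N).
Hypothesis (gen : forall g : gT, exists i n, n \in N /\ g = (n * s ^+ i)%g).
Hypothesis (q_pr : prime q).
Local Notation ON := (fixO iota N).
Local Notation T := (conj_mx s).

(** Pairing [x] with the family by the trace gives an integer linear system, whose Gram matrix is
    invertible over the rationals. *)
Lemma rat_coordinates (c : 'I_q -> L) x : (forall j, c j \in ON) -> \det (T c) != 0 ->
    x \in ON -> exists r : 'I_q -> rat, forall i : 'I_q, (s ^+ i)%g x = \sum_j r j *: (s ^+ i)%g (c j).
Proof.
move=> Oc dT Ox; have [G DG] := gram_int nN sqN gen Oc.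
have /fin_all_exists[b Db] (i : 'I_q) : exists z : int, \sum_(k < q) (s ^+ k)%g (c i * x) = z%:~R.
  exact: (trace_int nN sqN gen (rpredM (Oc i) Ox)).
pose bz : 'cV[int]_q := \col_i b i.
pose X : 'cV[L]_q := \col_i (s ^+ i)%g x.
have mapQ m n (A : 'M[int]_(m, n)) : map_mx (in_alg L) (map_mx intr A) = map_mx intr A.
  by apply/matrixP => i j; rewrite !mxE rmorph_int.
have TX : (T c)^T *m X = map_mx intr bz.
  by apply/colP => i; rewrite !mxE -Db; apply: eq_bigr => k _; rewrite !mxE rmorphM.
have uT : T c \in unitmx by rewrite unitmxE unitfE.
have uG : (map_mx intr G : 'M[L]_q) \in unitmx.
  by rewrite -DG unitmx_mul unitmx_tr uT.
pose r := invmx (map_mx intr G) *m map_mx intr bz : 'cV[rat]_q.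
have Dr : T c *m map_mx (in_alg L) r = X.
  have uTt : (T c)^T \in unitmx by rewrite unitmx_tr.
  apply: (can_inj (mulKmx uTt)); rewrite TX mulmxA DG /r map_mxM map_invmx !mapQ.
  by rewrite mulmxA mulmxV ?mul1mx.
exists (fun j => r j 0) => i; have := congr1 (fun Y : 'cV[L]_q => Y i 0) Dr.
by rewrite !mxE => <-; apply: eq_bigr => j _; rewrite !mxE mulrC mulr_algl.
Qed.

(** A family of integers with least nonzero discriminant is an integral basis. By self-duality the
    dual basis is integral too, so the Gram matrix is invertible over the integers. *)
Lemma unimodular_basis :
    (forall y, (forall n, n \in N -> n y = y) ->
      (forall b, b \in ON -> exists z : int, \sum_(i < q) (s ^+ i)%g (y * b) = z%:~R) -> y \in O) ->
  exists c : 'I_q -> L, (forall j, c j \in ON) /\ (\det (T c) ^+ 2 = 1 \/ \det (T c) ^+ 2 = -1).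
Proof.
move=> dual.
pose P (m : nat) := `[< exists c : 'I_q -> L, exists d : int,
  [/\ forall j, c j \in ON, \det (T c) != 0, \det (T c) ^+ 2 = d%:~R & `|d|%N = m] >].
have exP : exists m, P m.
  have [c [Oc dc]] := basis_exists iota q1 sqN sN q_pr.
  have [d Dd] := disc_int nN sqN gen Oc; exists `|d|%N; apply/asboolP; by exists c, d.
case: (ex_minnP exP) => m /asboolP[c [d [Oc dc Dd dm]]] minm.
have uT : T c \in unitmx by rewrite unitmxE unitfE.
have rat_in (r : 'I_q -> rat) : (forall j, r j \is a Num.int) -> exists z : 'I_q -> int, forall j, r j = (z j)%:~R.
  by move=> ri; exists (fun j => Num.floor (r j)) => j; rewrite floorK.
have coords_int x (r : 'I_q -> rat) : x \in ON ->
    (forall i : 'I_q, (s ^+ i)%g x = \sum_j r j *: (s ^+ i)%g (c j)) -> forall j, r j \is a Num.int.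
  move=> Ox Dx k; apply: contraT => nint.
  (* Replacing [c k] by [x - floor (r k) c k] multiplies the discriminant by [f^2], which is less
     than 1: a coordinate that is not an integer contradicts minimality. *)
  pose f := r k - (Num.floor (r k))%:~R.
  have /andP[f0 f1] : 0 < f < 1.
    have /andP[fl fr] := floor_itv (r k); rewrite /f subr_gt0 lt_neqAle fl andbT.
    rewrite ltrBlDl [_ + 1]addrC -{2}[1]/(1%:~R) -rmorphD /= [(1 + _)%R]addrC fr andbT.
    by apply: contraNneq nint => <-; rewrite intr_int.
  pose x' := x - (Num.floor (r k))%:~R * c k.
  pose c' j := if j == k then x' else c j.
  have Oc' j : c' j \in ON.
    by rewrite /c'; case: eqP => _; [rewrite /x' rpredB // rpredM ?rpred_int //; apply: Oc|apply: Oc].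
  pose rr : 'cV[L]_q := \col_j (in_alg L (r j) - (Num.floor (r k))%:~R *+ (j == k)).
  have dT' : \det (T c') = in_alg L f * \det (T c).
    rewrite (@det_replace_col _ _ (T c) (T c') k rr).
    - by congr (_ * _); rewrite mxE eqxx mulr1n /f rmorphB rmorph_int.
    - move=> i; rewrite [LHS]mxE [RHS]mxE /c' eqxx /x' rmorphB rmorphM rmorph_int /= Dx.
      under [RHS]eq_bigr => j _ do rewrite !mxE mulrBr mulrC mulr_algl.
      rewrite sumrB; congr (_ - _); rewrite (bigD1 k) //= eqxx big1 ?addr0 1?mulrC // => j /negPf->.
      by rewrite mulr0n mulr0.
    - by move=> i j jk; rewrite !mxE /c' (negPf jk).
  have [d' Dd'] := disc_int nN sqN gen Oc'.
  have fn0 : in_alg L f != 0 by rewrite fmorph_eq0 gt_eqF.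
  have dc' : \det (T c') != 0 by rewrite dT' mulf_neq0.
  have : (m <= `|d'|)%N by apply: minm; apply/asboolP; exists c', d'.
  have Ddd : d'%:~R = f ^+ 2 * d%:~R :> rat.
    apply: (fmorph_inj (in_alg L)); rewrite rmorphM rmorphXn !rmorph_int /=.
    by rewrite -Dd' dT' exprMn Dd.
  rewrite -dm -(ler_nat rat) !natr_absz !intr_norm Ddd normrM.
  rewrite leNgt => /negP; case; rewrite gtr_pMl.
    by rewrite ger0_norm ?sqr_ge0 // expr_lt1 // ltW.
  rewrite normr_gt0 intr_eq0; apply: contraNneq dc => d0.
  by move: Dd; rewrite d0 => /eqP; rewrite expf_eq0.
have coords x : x \in ON -> exists z : 'I_q -> int, x = \sum_j (z j)%:~R * c j.
  move=> Ox; have [r Dr] := rat_coordinates Oc dc Ox.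
  have [z Dz] := rat_in _ (coords_int _ _ Ox Dr); exists z.
  have := Dr (Ordinal (ltnW q1)); rewrite !gal_id => ->.
  apply: eq_bigr => j _; rewrite gal_id Dz -mulr_algl; congr (_ * _).
  by rewrite -in_algE rmorph_int.
have [G DG] := gram_int nN sqN gen Oc.
have uG : (map_mx intr G : 'M[L]_q) \in unitmx.
  by rewrite -DG unitmx_mul unitmx_tr uT.
(* The columns of [W] hold the conjugates of the dual basis [e] for the trace form. *)
pose W := T c *m invmx (map_mx intr G).
have W0 : (T c)^T *m W = 1%:M by rewrite mulmxA DG mulmxV.
pose D : 'M[rat]_q := invmx (map_mx intr G).
have mapD : map_mx (in_alg L) D = invmx (map_mx intr G).
  by rewrite map_invmx; congr invmx; apply/matrixP => i j; rewrite !mxE rmorph_int.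
pose e j := \sum_k D k j *: c k.
have We (i j : 'I_q) : W i j = (s ^+ i)%g (e j).
  rewrite /W -mapD mxE rmorph_sum; apply: eq_bigr => k _; rewrite !mxE /= linearZ /=.
  by rewrite mulrC mulr_algl.
have Oe j : e j \in ON.
  have fe n : n \in N -> n (e j) = e j.
    move=> Nn; rewrite rmorph_sum; apply: eq_bigr => k _; rewrite /= linearZ /=.
    by congr (_ *: _); have /fixOP[_ ->] := Oc k.
  apply/fixOP; split=> //; apply: dual => // b /coords[z ->].
  exists (z j); transitivity (\sum_i \sum_k (z k)%:~R * ((s ^+ (nat_of_ord i))%g (c k) * W i j)).
    apply: eq_bigr => i _; rewrite mulr_sumr rmorph_sum; apply: eq_bigr => k _.
    by rewrite We !rmorphM rmorph_int; ring.
  rewrite exchange_big /= (bigD1 j) //= -mulr_sumr [X in _ + X]big1 => [|k kj].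
    rewrite addr0 -[RHS]mulr1; congr (_ * _).
    have := congr1 (fun A : 'M[L]_q => A j j) W0; rewrite /= mxE [RHS]mxE eqxx => E.
    by apply: (etrans _ E); apply: eq_bigr => i _; rewrite !mxE.
  rewrite -mulr_sumr -[RHS](mulr0 (z k)%:~R); congr (_ * _).
  have := congr1 (fun A : 'M[L]_q => A k j) W0; rewrite /= mxE [RHS]mxE (negPf kj) => E.
  by apply: (etrans _ E); apply: eq_bigr => i _; rewrite !mxE.
have /fin_all_exists[Z DZ] (j : 'I_q) : exists z : 'I_q -> int, e j = \sum_k (z k)%:~R * c k.
  exact: coords.
pose Zm : 'M[int]_q := \matrix_(k, j) Z j k.
have WZ : W = T c *m map_mx intr Zm.
  apply/matrixP => i j; rewrite We DZ mxE rmorph_sum; apply: eq_bigr => k _.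
  by rewrite !mxE rmorphM rmorph_int mulrC.
have GZ : G *m Zm = 1%:M.
  have EL : map_mx intr (G *m Zm) = map_mx intr 1%:M :> 'M[L]_q.
    by rewrite map_mxM map_mx1 -DG -mulmxA -WZ W0.
  apply/matrixP => i j; have /matrixP/(_ i j) := EL.
  by rewrite [LHS]mxE [RHS]mxE => /(intr_inj_num iota).
have := congr1 determinant GZ; rewrite det_mulmx det1 => dGZ.
exists c; split=> //; have -> : \det (T c) ^+ 2 = (\det G)%:~R.
  by rewrite -det_map_mx -DG det_mulmx det_tr expr2.
have : \det G \is a GRing.unit by apply/unitrP; exists (\det Zm); rewrite mulrC dGZ.
by case/orP => /eqP->; [left|right].
Qed.

End UnimodularBasis.

Section Bounds.
Variable R : realFieldType.

Lemma expr1D_le (a : R) m : 0 <= a -> m%:R * a <= 1 -> (1 + a) ^+ m * (1 - m%:R * a) <= 1.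
Proof.
move=> a0; elim: m => [|m IH] ma; first by rewrite expr0 mul0r subr0 mulr1.
have ma' : m%:R * a <= 1 by move: ma; rewrite -natr1; lra.
apply: le_trans (IH ma'); rewrite exprSr -mulrA ler_wpM2l ?exprn_ge0 //; first by lra.
have m0 : 0 <= m%:R :> R by apply: ler0n.
rewrite -natr1; have : 0 <= a * a by rewrite mulr_ge0.
have : 0 <= m%:R * (a * a) by rewrite !mulr_ge0.
by lra.
Qed.

(* A box of volume 1 that excludes 1 and -1. *)
Definition unit_box n (i : 'I_n.+2) : R := if i == 0 then 10 / 9 else if i == 1 then 9 / 10 else 1.

Lemma unit_box_prod n : \prod_(i : 'I_n.+2) unit_box i = 1.
Proof.
rewrite !big_ord_recl big1 => [|i _]; last by rewrite /unit_box.
by rewrite /unit_box /=; lra.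
Qed.

(** The box bounds each coordinate above; a product of absolute value at least 1 then bounds each
    below. With [t <= 20 / 19] all lie between [171 / 200] and [200 / 171], whose squares differ
    from 1 by less than 1, while the side [9 / 10] still gives a bound [18 / 19 < 1]. *)
Lemma unit_box_bound n (x : 'I_n.+2 -> R) t : 1 <= t -> t ^+ n.+2 <= 20 / 19 ->
    (forall i, `|x i| <= t * unit_box i) -> 1 <= `|\prod_i x i| ->
  `|x 1| < 1 /\ forall i, `|x i ^+ 2 - 1| < 1.
Proof.
move=> t1 tn lex; rewrite normr_prod => nx.
have t20 : t <= 20 / 19 by apply: le_trans tn; apply: ler_eXnr.
have c0 (i : 'I_n.+2) : 9 / 10 <= unit_box i <= 10 / 9.
  by rewrite /unit_box; case: eqP => _; [|case: eqP => _]; lra.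
split.
  apply: le_lt_trans (lex 1) _; rewrite /unit_box /=; lra.
move=> i; have /andP[ci1 ci2] := c0 i.
pose P := \prod_(j | j != i) (t * unit_box j).
have P0 : 0 <= P by apply: prodr_ge0 => j _; have /andP[cj _] := c0 j; rewrite mulr_ge0; lra.
have leP : t * unit_box i * P <= 20 / 19.
  have : \prod_(j : 'I_n.+2) (t * unit_box j) = t ^+ n.+2.
    by rewrite big_split /= prodr_const card_ord unit_box_prod mulr1.
  by rewrite (bigD1 i) //= => ->.
have leP2 : P <= 200 / 171.
  have : 9 / 10 * P <= t * unit_box i * P by rewrite ler_wpM2r //; nra.
  by lra.
have lex1 : 1 <= `|x i| * P.
  apply: le_trans nx _; rewrite (bigD1 i) //= ler_wpM2l //.
  by apply: ler_prod => j _; rewrite normr_ge0 lex.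
have x1 : 171 / 200 <= `|x i|.
  have : `|x i| * P <= `|x i| * (200 / 171) by rewrite ler_wpM2l.
  by lra.
have x2 : `|x i| <= 200 / 171 by apply: le_trans (lex i) _; nra.
rewrite -real_normK ?num_real // ltr_norml.
have : (171 / 200) * (171 / 200) <= `|x i| ^+ 2 by rewrite expr2; apply: ler_pM => //; lra.
have : `|x i| ^+ 2 <= (200 / 171) * (200 / 171) by rewrite expr2; apply: ler_pM.
by move: (`|x i| ^+ 2) => y; lra.
Qed.

Lemma expr_near1 m : exists2 t : R, 1 < t & t ^+ m.+1 <= 20 / 19.
Proof.
(* The choice makes [1 - (m + 1) a = 19 / 20], the inverse of the bound to be reached. *)
pose a : R := (20 * m.+1%:R)^-1.
have m0 : 0 < m.+1%:R :> R by rewrite ltr0n.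
have a0 : 0 < a by rewrite invr_gt0 mulr_gt0 // ltr0n.
have ma : m.+1%:R * a = 1 / 20 by rewrite /a; field; rewrite nat1r pnatr_eq0.
exists (1 + a); first by lra.
have := @expr1D_le a m.+1 (ltW a0); rewrite ma => /(_ _) H.
have : (1 + a) ^+ m.+1 * (1 - 1 / 20) <= 1 by apply: H; lra.
by lra.
Qed.

End Bounds.

Lemma det_mx_2x2 (R : comNzRingType) (A : 'M[R]_2) :
  \det A = A 0 0 * A 1 1 - A 0 1 * A 1 0.
Proof.
rewrite (expand_det_row A 0) !big_ord_recl big_ord0 addr0 /cofactor !det_mx11 !mxE /=.
rewrite expr0 expr1 mul1r mulN1r mulrN.
by congr (_ * A _ _ - A _ _ * A _ _); apply/val_inj.
Qed.

Section NoUnramified.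
Variables (L : splittingFieldType rat) (iota : {rmorphism L -> algC}).
Local Notation gT := (gal_of {:L}).
Local Notation O := (intO iota).
Variables (N : {group gT}) (s : gT) (q : nat).
Hypotheses (nN : forall g : gT, g \in 'N(N)%g) (q1 : (1 < q)%N).
Hypotheses (sqN : (s ^+ q)%g \in N) (sN : forall i, (0 < i < q)%N -> (s ^+ i)%g \notin N).
Hypothesis (gen : forall g : gT, exists i n, n \in N /\ g = (n * s ^+ i)%g).
Hypothesis (q_pr : prime q).
Local Notation ON := (fixO iota N).
Hypothesis dual : forall y, (forall n, n \in N -> n y = y) ->
  (forall b, b \in ON -> exists z : int, \sum_(i < q) (s ^+ i)%g (y * b) = z%:~R) -> y \in O.

(** Reality serves twice: it excludes discriminant -1, since the determinant is real, and it turns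
    all conjugates into real linear forms. *)
Lemma no_real_unramified : (forall x, x \in ON -> iota x \is Num.real) -> False.
Proof.
move=> realN; have [c [Oc dc]] := unimodular_basis nN q1 sqN sN gen q_pr dual.
move: q1 c Oc dc; case Dq: q => [|[|n]] // _ c Oc dc.
pose B : 'M[algR]_n.+2 := \matrix_(j, i) insubd (0 : algR) (iota ((s ^+ i)%g (c j))).
have valB j i : algRval (B j i) = iota ((s ^+ i)%g (c j)).
  by rewrite mxE; apply: insubdK; apply: realN; apply: (fixO_gal nN); exact: Oc.
have dB : algRval (\det B) = iota (\det (conj_mx s c)).
  rewrite -!det_map_mx -det_tr; congr (\det _); apply/matrixP => i j.
  by transitivity (algRval (B j i)); [rewrite !mxE|rewrite valB !mxE].
have dB1 : \det B ^+ 2 = 1.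
  have : algRval (\det B ^+ 2) = iota (\det (conj_mx s c) ^+ 2) by rewrite !rmorphXn /= dB.
  case: dc => ->; rewrite ?rmorphN rmorph1 => E; first by apply: val_inj.
  have : \det B ^+ 2 = -1 by apply: val_inj.
  by move=> E2; have := sqr_ge0 (\det B); rewrite E2 oppr_ge0 ler10.
have ndB : `|\det B| = 1.
  by apply/eqP; rewrite -sqrp_eq1 ?normr_ge0 // real_normK ?num_real // dB1.
have [t t1 tn] := expr_near1 algR n.+1.
have dB0 : \det B != 0 by rewrite -normr_eq0 ndB oner_eq0.
have box0 (j : 'I_n.+2) : 0 < unit_box algR j.
  by rewrite /unit_box; case: eqP => _; [|case: eqP => _]; lra.
have leB : `|\det B| <= \prod_(j : 'I_n.+2) unit_box algR j :> algR by rewrite ndB unit_box_prod.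
have [w w0 lew] := minkowski_forms dB0 box0 leB t1.
pose X := \sum_j (w 0 j)%:~R * c j.
have OX : X \in ON by apply: rpred_sum => j _; apply: rpredM; [exact: rpred_int|exact: Oc].
pose x (i : 'I_n.+2) := (map_mx intr w *m B) 0 i.
have valx i : algRval (x i) = iota ((s ^+ i)%g X).
  rewrite /x mxE !rmorph_sum /=; apply: eq_bigr => j _.
  by rewrite !rmorphM /= valB !mxE !rmorph_int.
have nonzero_norm Y : Y \in ON -> Y != 0 -> exists z : int,
    [/\ z != 0 & \prod_(i < n.+2) (s ^+ i)%g Y = z%:~R].
  move=> OY Y0; have := norm_int nN sqN gen OY; rewrite Dq => -[z Dz].
  exists z; split=> //; rewrite -(intr_num_eq0 iota) -Dz prodf_seq_neq0.
  by apply/allP => i _ /=; rewrite fmorph_eq0.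
have X0 : X != 0.
  apply: contraNneq w0 => X0; apply/eqP.
  have wB : map_mx intr w *m B = 0.
    by apply/rowP => i; apply: val_inj; rewrite [LHS]valx X0 rmorph0 mxE rmorph0.
  have uB : B \in unitmx by rewrite unitmxE unitfE.
  have : map_mx intr w = 0 :> 'rV[algR]_n.+2 by rewrite -(mulmxK uB (map_mx intr w)) wB mul0mx.
  move=> /rowP w_0; apply/rowP => j; have := w_0 j; rewrite !mxE => /eqP.
  by rewrite intr_eq0 => /eqP.
have prodx (y : 'I_n.+2 -> algR) Y (z : int) : (forall i, algRval (y i) = iota ((s ^+ i)%g Y)) ->
    \prod_(i < n.+2) (s ^+ i)%g Y = z%:~R -> \prod_i y i = z%:~R.
  move=> valy Dz; apply: val_inj; rewrite /= rmorph_prod /= rmorph_int -(rmorph_int iota) -Dz rmorph_prod.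
  by apply: eq_bigr.
have [z [z0 /(prodx _ _ _ valx) Dz]] := nonzero_norm X OX X0.
have nx : 1 <= `|\prod_i x i|.
  by rewrite Dz -intr_norm -[1]/(1%:~R) ler_int; move: z0; clear; lia.
have [x1 xi] := unit_box_bound (ltW t1) tn lew nx.
have {}x1 : `|x 1| < 1 by [].
pose Y := X ^+ 2 - 1; have OY : Y \in ON by rewrite rpredB ?rpredX ?rpred1.
have valy i : algRval (x i ^+ 2 - 1) = iota ((s ^+ i)%g Y).
  by rewrite !rmorphB !rmorphXn /= !rmorph1 valx.
have [Y0|Y0] := eqVneq Y 0; last first.
  have [y [y0 /(prodx _ _ _ valy) Dy]] := nonzero_norm Y OY Y0.
  have : `|\prod_i (x i ^+ 2 - 1)| < 1.
    rewrite normr_prod; apply: (@lt_le_trans _ _ (\prod_(i < n.+2) 1)); last by rewrite big1_eq.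
    apply: ltr_prod => [|i _]; first by apply/hasP; exists ord0; rewrite ?mem_index_enum.
    by rewrite normr_ge0 xi.
  by rewrite Dy -intr_norm -[1]/(1%:~R) ltr_int; move: y0; clear; lia.
have : x 1 ^+ 2 - 1 = 0 by apply: val_inj; rewrite [LHS]valy Y0 !rmorph0.
move/eqP; rewrite subr_eq0 sqrf_eq1 => /orP[]/eqP E; move: x1; rewrite E ?normrN normr1 ltxx //.
Qed.

Lemma no_imaginary_quadratic_unramified : q = 2%N ->
  (forall x, x \in ON -> iota (s x) = (iota x)^*) -> False.
Proof.
move=> Dq conjs; have [c [Oc dc]] := unimodular_basis nN q1 sqN sN gen q_pr dual.
have int_fix x : x \in ON -> s x = x -> exists z : int, x = z%:~R by apply: fixO_int.
have ss x : x \in ON -> s (s x) = x.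
  by move=> Ox; rewrite -galM ?memvf // -expg2 -Dq (fixO_sqK sqN Ox).
move: c Oc dc; rewrite Dq => c Oc dc.
have Os x : x \in ON -> s x \in ON by apply: (fixO_gal nN).
pose a := c 0; pose b := c 1; have [Oa Ob] : a \in ON /\ b \in ON by split; apply: Oc.
have dT : \det (conj_mx s c) = a * s b - b * s a.
  by rewrite det_mx_2x2 !mxE /= !gal_id !expg1 /a /b; ring.
have [n0 Dn0] : exists z : int, a * s a = z%:~R.
  by apply: int_fix; rewrite ?rpredM ?Os // rmorphM /= ss // mulrC.
have [n1 Dn1] : exists z : int, b * s b = z%:~R.
  by apply: int_fix; rewrite ?rpredM ?Os // rmorphM /= ss // mulrC.
have [m Dm] : exists z : int, a * s b + b * s a = z%:~R.
  apply: int_fix; rewrite ?rpredD ?rpredM ?Os // rmorphD !rmorphM /= !ss //; ring.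
rewrite dT in dc; set D := a * s b - b * s a in dc.
have sD : s D = - D by rewrite rmorphB !rmorphM /= !ss // /D; ring.
have OD : D \in ON by rewrite rpredB ?rpredM ?Os.
(* Conjugation sends [D] to [- D], so [D] is purely imaginary and [D^2 = 1] is excluded. *)
case: dc => D2.
  have : 0 <= - (iota D ^+ 2).
    by rewrite -mulrN -rmorphN -sD conjs // mul_conjC_ge0.
  by rewrite -rmorphXn D2 rmorph1 oppr_ge0 ler10.
have : (m ^+ 2 - 4 * (n0 * n1))%:~R = (-1)%:~R :> L.
  rewrite rmorphB rmorphXn !rmorphM !rmorphN !rmorph1 /= -Dm -Dn0 -Dn1 -D2 /D; ring.
move/(intr_inj_num iota) => E.
have Dm2 := divz_eq m 2; move: (m %/ 2)%Z Dm2 => k Dm2.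
have r01 : (m %% 2)%Z = 0 \/ (m %% 2)%Z = 1.
  by have := modz_ge0 m (isT : (2 : int) != 0); have := ltz_pmod m (isT : 0 < (2 : int)); clear; lia.
have {}E : m * m - 4 * (n0 * n1) = -1 by rewrite -expr2.
move: (n0 * n1) E => u E; case: r01 Dm2 => -> Dm2; rewrite {}Dm2 in E.
  have Ek : (k * 2 + 0) * (k * 2 + 0) = 4 * (k * k) by ring.
  by rewrite Ek in E; move: E; move: (k * k) => kk; clear; lia.
have Ek : (k * 2 + 1) * (k * 2 + 1) = 4 * (k * k) + 4 * k + 1 by ring.
by rewrite Ek in E; move: E; move: (k * k) => kk; clear; lia.
Qed.

End NoUnramified.

Section Generation.
Variables (L : splittingFieldType rat) (iota : {rmorphism L -> algC}).
Local Notation gT := (gal_of {:L}).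

Lemma lrmorphism_gal (nu : {lrmorphism L -> L}) : exists g : gT, forall x, g x = nu x.
Proof.
have kh : kAut 1 {:L} (linfun nu).
  rewrite kAutfE; apply/kHom_monoid_morphism.
  by split=> [|x y]; rewrite !lfunE ?rmorph1 //= rmorphM.
have [g _ Dg] := kAut_to_gal kh; exists g => x.
by rewrite -Dg ?memvf // lfunE.
Qed.

Lemma conj_gal : exists g : gT, forall x, iota (g x) = (iota x)^*.
Proof.
have [nu Dnu] := restrict_aut_to_normal_num_field iota (Num.conj : {rmorphism algC -> algC}).
by have [g Dg] := lrmorphism_gal nu; exists g => x; rewrite Dg Dnu.
Qed.

(* Minkowski's theorem for abelian extensions of Q. *)
Lemma abelian_unramified_trivial (N : {group gT}) :
    ([~: [set: gT], [set: gT]] \subset N)%g ->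
    (forall l Q, prime l -> l%:R \in Q -> primeO iota Q -> inertia iota Q \subset N) ->
  forall g, g \in N.
Proof.
move=> sDN IN g0; apply: contrapT => /negP nNg0.
have nsN : (N <| [set: gT])%g by apply: sub_der1_normal; rewrite ?subsetT.
have nN1 : ([set: gT] / N != 1)%g.
  apply: contra nNg0 => /eqP E; have : coset N g0 \in ([set: gT] / N)%g by apply: mem_quotient; rewrite inE.
  have nNg : g0 \in 'N(N)%g by apply: (subsetP (normal_norm nsN)); rewrite inE.
  by rewrite E => /set1P/(coset_idr nNg).
have abN : abelian ([set: gT] / N)%g by apply: sub_der1_abelian.
have [H nsH pr_q] := sol_prime_factor_exists (abelian_sol abN) nN1.
set q := #|_ : _|%g in pr_q.
have nNT g : g \in 'N(N)%g by apply: (subsetP (normal_norm nsN)); rewrite inE.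
have nHT g : coset N g \in 'N(H)%g.
  by apply: (subsetP (normal_norm nsH)); apply: mem_quotient; rewrite inE.
pose f g := coset H (coset N g).
have fM g h : f (g * h)%g = (f g * f h)%g by rewrite /f morphM ?nNT // morphM ?nHT.
have f1 : f 1%g = 1%g by rewrite /f !morph1.
have fX g i : f (g ^+ i)%g = (f g ^+ i)%g.
  by elim: i => [|i IH]; rewrite ?f1 // !expgS fM IH.
have N1_set : group_set [set g | f g == 1%g].
  apply/group_setP; split=> [|g h]; rewrite !inE ?f1 // fM => /eqP-> /eqP->.
  by rewrite mulg1.
pose N1 := group N1_set.
have N1E g : (g \in N1) = (f g == 1%g) by rewrite inE.
have sNN1 : N \subset N1 by apply/subsetP => n Nn; rewrite N1E /f (coset_id Nn) morph1.
have cardq : #|([set: gT] / N) / H|%g = q by rewrite card_quotient ?normal_norm.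
have fT g : f g \in (([set: gT] / N) / H)%g by do 2!apply: mem_quotient; rewrite ?inE.
have ordf g : g \notin N1 -> #[f g]%g = q.
  rewrite N1E -order_eq1 => o1; apply/eqP; have := order_dvdG (fT g); rewrite cardq.
  by case/primeP: pr_q => _ H2 /H2; rewrite (negPf o1).
have nN1T (g : gT) : g \in 'N(N1)%g.
  apply: (subsetP (_ : [set: gT] \subset 'N(N1))%g); last by rewrite inE.
  by apply/normal_norm/sub_der1_normal; rewrite ?subsetT ?(subset_trans sDN).
have q1 : (1 < q)%N by apply: prime_gt1.
have sqN s : (s ^+ q)%g \in N1.
  by rewrite N1E fX -order_dvdn -cardq order_dvdG.
have sN s : s \notin N1 -> forall i, (0 < i < q)%N -> (s ^+ i)%g \notin N1.
  move=> nNs i /andP[i0 ltiq]; rewrite N1E fX -order_dvdn (ordf s nNs).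
  by rewrite gtnNdvd.
have gen s : s \notin N1 -> forall g, exists i n, n \in N1 /\ g = (n * s ^+ i)%g.
  move=> nNs g; have : f g \in <[f s]>%g.
    suffices -> : <[f s]>%g = (([set: gT] / N) / H)%g by [].
    by apply/eqP; rewrite eqEcard cycle_subG fT cardq -orderE (ordf s nNs) leqnn.
  case/cycleP => i Di; exists i, (g * s ^- i)%g; rewrite mulgKV; split=> //.
  have fV h : f h^-1%g = (f h)^-1%g by apply: (mulgI (f h)); rewrite -fM !mulgV f1.
  by rewrite N1E fM fV fX Di mulgV.
have IN1 l Q : prime l -> l%:R \in Q -> primeO iota Q -> inertia iota Q \subset N1.
  by move=> pl lQ prQ; apply: subset_trans (IN l Q pl lQ prQ) sNN1.
have dual s (nNs : s \notin N1) := unramified_self_dual nN1T IN1 (sN s nNs) (ltnW q1).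
have [c Dc] := conj_gal.
(* If complex conjugation [c] lies in [N1], the fixed field of [N1] is real. Otherwise its image has
   order 2 and generates the quotient, so [q = 2] and [c] can serve as [s]. *)
have [Nc|nNc] := boolP (c \in N1).
  have [s nNs] : exists s, s \notin N1.
    have := prime_gt1 pr_q; rewrite -cardq cardG_gt1 => /trivgPn[y /morphimP[x _ /morphimP[s _ _ ->] ->] y1].
    by exists s; rewrite N1E.
  apply: (no_real_unramified nN1T q1 (sqN s) (sN s nNs) (gen s nNs) pr_q (dual s nNs)) => x /fixOP[_ fx].
  by rewrite CrealE -Dc fx.
have q2 : q = 2%N.
  have : (#[f c]%g %| 2)%N.
    rewrite order_dvdn -fX; suffices -> : (c ^+ 2 = 1)%g by rewrite f1.
    apply/eqP/gal_eqP => x _; rewrite expg2 galM ?memvf // gal_id.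
    by apply: (fmorph_inj iota); rewrite !Dc conjCK.
  by rewrite (ordf c nNc) dvdn_prime2 // => /eqP.
apply: (no_imaginary_quadratic_unramified nN1T q1 (sqN c) (sN c nNc) (gen c nNc) pr_q (dual c nNc) q2).
by move=> x _; rewrite Dc.
Qed.

End Generation.

(** * Tame meta-abelian number fields *)

Section CyclicQuotient.
Variables (gT : finGroupType) (A : {group gT}) (t : gT).
Hypotheses (defA : ([~: [set: gT], [set: gT]] = A)%g) (abA : abelian A).
Hypothesis (genT : forall g : gT, exists i a, a \in A /\ g = (t ^+ i * a)%g).

(* As G' = [A, t], the map a |-> [a, t] is an automorphism of A; it kills the powers of t lying in A. *)
Lemma cyclic_derived_complement k : (t ^+ k)%g \in A -> (t ^+ k)%g = 1%g.
Proof.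
move=> Atk; have nAT (g : gT) : g \in 'N(A)%g.
  by apply: (subsetP (_ : [set: gT] \subset _)); rewrite ?inE // -defA commg_normr.
have AJ a g : a \in A -> (a ^ g)%g \in A by move=> Aa; rewrite memJ_norm.
have cA a b : a \in A -> b \in A -> (a * b = b * a)%g by move=> Aa Ab; apply: (centsP abA).
pose phi a := (a^-1 * a ^ t)%g.
have phiA a : a \in A -> phi a \in A by move=> Aa; rewrite groupM ?groupV ?AJ.
have phiM : {in A &, {morph phi : a b / (a * b)%g}}.
  move=> a b Aa Ab; rewrite /phi invMg conjMg (cA b^-1%g) ?groupV //.
  move: (a ^ t)%g (AJ a t Aa) (b ^ t)%g => x Ax y; rewrite -!mulgA.
  by congr (_ * _)%g; rewrite mulgA (cA b^-1%g) ?groupV // -mulgA.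
(* The group of the commutators [[a, t]]. It is normal, and modulo it [t] commutes with [A]; hence
   the quotient is abelian and [B] contains the derived group [A]. So [phi] is onto [A], and
   injective by finiteness. *)
pose phim := Morphism phiM; pose B := (phim @* A)%G.
have sBA : B \subset A by apply/subsetP => _ /morphimP[a Aa _ ->]; apply: phiA.
have phiJ a g : a \in A -> (phi a ^ (g : gT))%g \in B.
  move=> Aa; have [i [b [Ab ->]]] := genT g; rewrite conjgM.
  have -> : (phi a ^ (t ^+ i) = phi (a ^ (t ^+ i)))%g.
    by rewrite /phi conjMg conjVg -!conjgM (commuteX i (erefl : commute t t)).
  have Aai : (a ^ (t ^+ i))%g \in A by apply: AJ.
  have -> : (phi (a ^ (t ^+ i)) ^ b = phi (a ^ (t ^+ i)))%g.
    by rewrite conjgE (cA _ b) ?phiA // mulKg.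
  by apply: (mem_morphim phim).
have nBT (g : gT) : g \in 'N(B)%g.
  by apply/normP/eqP; rewrite eqEcard cardJg leqnn andbT; apply/subsetP => _ /imsetP[_ /morphimP[a Aa _ ->] ->]; apply: phiJ.
have comt a : a \in A -> commute (coset B a) (coset B t).
  move=> Aa; apply/commgP; rewrite /commg -morphV // -morphJ // -morphM //.
  by apply/eqP/coset_id; apply: (mem_morphim phim).
have coma a b : a \in A -> b \in A -> commute (coset B a) (coset B b).
  by move=> Aa Ab; rewrite /commute -!morphM // cA.
have sAB : A \subset B.
  rewrite -defA; apply: der1_min; first by apply/subsetP.
  apply/centsP => _ /morphimP[g _ _ ->] _ /morphimP[h _ _ ->] /=.
  have [i [a [Aa ->]]] := genT g; have [j [b [Ab ->]]] := genT h.
  rewrite !morphM ?morphX //.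
  have ct : commute (coset B t ^+ i)%g (coset B t ^+ j)%g by apply: commuteX2.
  apply/commute_sym/commuteM; apply/commute_sym/commuteM => //.
  - exact/commute_sym/commuteX/comt.
  - exact/commuteX/comt.
  - exact/coma.
have injphi : ('ker phim \subset [1 gT])%g.
  by rewrite -card_im_injm eqn_leq subset_leq_card ?subset_leq_card.
apply: (injmP injphi (t ^+ k)%g 1%g Atk (group1 A)) => /=; rewrite /phi !conjgE invg1 !mul1g.
by rewrite -expgSr expgS mulKg mulVg mulVg.
Qed.

End CyclicQuotient.

(** The value at 1 of [(X^p - 1) / (X - 1)], computed from its roots and from its coefficients. *)
Lemma prod_one_sub_prim_root (F : fieldType) (p : nat) (z : F) : prime p -> p.-primitive_root z ->
  \prod_(1 <= i < p) (1 - z ^+ i) = p%:R.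
Proof.
move=> pr_p prim_z; have X1 : 'X - 1 != 0 :> {poly F} by rewrite -[1]/(1%:P) polyXsubC_eq0.
have := factor_Xn_sub_1 prim_z; rewrite big_ltn ?prime_gt0 // expr0 subrX1.
move=> /(mulfI X1)/(congr1 (fun f => f.[1])); rewrite horner_prod horner_sum.
under eq_bigr => i _ do rewrite !hornerE.
by move=> ->; under eq_bigr => i _ do rewrite !hornerE expr1n; rewrite sumr_const card_ord.
Qed.

(** * Galois action on roots of unity *)

Section RootsOfUnity.
Variables (L : splittingFieldType rat) (iota : {rmorphism L -> algC}).
Local Notation gT := (gal_of {:L}).
Local Notation O := (intO iota).
Variables (p : nat) (pr_p : prime p).

Lemma unity_root_intO x : x ^+ p = 1 -> x \in O.
Proof.
move=> xp; apply: (@intO_root _ _ ('X^p - 1)).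
- by rewrite -[1]/(1%:P) monicXnsubC // prime_gt0.
- by rewrite rpredB ?rpredX ?polyOverX // rpred1.
- by rewrite rootE !hornerE xp subrr.
Qed.

Lemma sum_unity_root x : x ^+ p = 1 -> x != 1 -> \sum_(i < p) x ^+ i = 0 :> L.
Proof.
move=> xp x1; have := subrX1 x p; rewrite xp subrr => /esym/eqP.
by rewrite mulf_eq0 subr_eq0 (negPf x1) => /eqP.
Qed.

(** Modulo [Q] each term of the vanishing sum of the [x^i] becomes 1, so the sum becomes [p]. *)
Lemma unity_root_congr Q x : primeO iota Q -> x ^+ p = 1 -> x != 1 -> x - 1 \in Q -> p%:R \in Q.
Proof.
move=> prQ xp x1 Qx; have Ox := unity_root_intO xp.
have -> : p%:R = - \sum_(i < p) (x ^+ i - 1) :> L.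
  by rewrite sumrB sum_unity_root // sumr_const card_ord sub0r opprK.
apply: (primeO_N prQ); apply: (primeO_sum prQ) => i _.
rewrite subrX1 mulrC; apply: (primeO_M prQ) => //.
by apply: rpred_sum => j _; rewrite rpredX.
Qed.

Variables (z : L) (prim_z : p.-primitive_root z).

Lemma gal_unity_root (g : gT) : exists k, g z = z ^+ k.
Proof.
have : (g z) ^+ p = 1 by rewrite -rmorphXn /= (prim_expr_order prim_z) rmorph1.
by case/(prim_rootP prim_z) => k ->; exists k.
Qed.

Lemma gal_unity_root_comm (g h : gT) : g (h z) = h (g z).
Proof.
have [[i Di] [j Dj]] := (gal_unity_root g, gal_unity_root h).
by rewrite Di Dj !rmorphXn /= Di Dj -!exprM mulnC.
Qed.

Lemma gal_unity_root_exists k : (0 < k < p)%N -> exists g : gT, g z = z ^+ k.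
Proof.
move=> k0; have cop : coprime k p.
  by rewrite coprime_sym prime_coprime // gtnNdvd; case/andP: k0.
have [u Du] := Qn_aut_exists cop.
have [nu Dnu] := restrict_aut_to_normal_num_field iota u.
have [g Dg] := lrmorphism_gal nu; exists g; apply: (fmorph_inj iota).
by rewrite Dg Dnu [RHS]rmorphXn Du // -rmorphXn /= (prim_expr_order prim_z) rmorph1.
Qed.

(** If [g z = z^k], then [k^p] is congruent to 1 modulo [p], and by Fermat's little theorem it is
    congruent to [k]. *)
Lemma gal_order_unity_root (g : gT) : (g ^+ p = 1)%g -> g z = z.
Proof.
move=> gp; have [k Dk] := gal_unity_root g.
have Dn n : (g ^+ n)%g z = z ^+ (k ^ n).
  elim: n => [|n IH]; first by rewrite gal_id expn0 expr1.
  by rewrite expgSr galM ?memvf // IH rmorphXn /= Dk -exprM expnS.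
have := Dn p; rewrite gp gal_id -{1}[z]expr1 => /eqP.
rewrite (eq_prim_root_expr prim_z) => /eqP E.
apply/eqP; rewrite Dk -{2}[z]expr1 (eq_prim_root_expr prim_z); apply/eqP.
by rewrite E fermat_little.
Qed.

End RootsOfUnity.

Lemma int_digits_inj (k k' : int) (n a b : nat) :
  k * n%:Z + a%:Z = k' * n%:Z + b%:Z -> (b < n)%N -> (a < n)%N -> a = b.
Proof.
move=> E ltb lta; have D : (k - k') * n%:Z = b%:Z - a%:Z by move: E; clear; lia.
move: D; move: (k - k') => c D.
suffices c0 : c = 0 by move: D; rewrite c0 mul0r; clear; lia.
have [c0|c0|//] := ltgtP c 0.
  have : (c + 1) * n%:Z <= 0 by apply: mulr_le0_ge0; [move: c0; clear; lia|].
  by move: D ltb lta; rewrite mulrDl mul1r; move: (c * n%:Z) => d; clear; lia.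
have : 0 <= (c - 1) * n%:Z by apply: mulr_ge0; [move: c0; clear; lia|].
by move: D ltb lta; rewrite mulrBl mul1r; move: (c * n%:Z) => d; clear; lia.
Qed.

Section Structure.
Variables (L : splittingFieldType rat) (iota : {rmorphism L -> algC}).
Local Notation gT := (gal_of {:L}).
Local Notation O := (intO iota).

Record adic (l : nat) (Q : {pred L}) (v : L -> int) : Prop := Adic {
  adic_prime : prime l;
  adic_primeO : primeO iota Q;
  adic_mem : l%:R \in Q;
  adic_val : valuation v;
  adic_gt0 : 0 < v l%:R;
  adic_loc : forall x, x != 0 -> (0 <= v x <-> locO iota Q x);
  adic_pos : forall x, x \in O -> vge v 1 x = (x \in Q) }.

Lemma adic_exists l Q : prime l -> primeO iota Q -> l%:R \in Q -> exists v, adic l Q v.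
Proof. by move=> pl prQ lQ; have [v []] := valuation_exists prQ pl lQ; exists v. Qed.

Lemma adic_uniformizer l Q v (F : divringClosed L) : adic l Q v -> exists pi, uniformizer v F pi.
Proof.
move=> [pl prQ Ql hv v_l v_loc v_Q].
have [pi [/andP[_ Fpi] pi0 vpi mpi]] := uniformizer_exists prQ pl Ql hv v_l v_loc v_Q F.
by exists pi.
Qed.

Lemma primeO_above l : prime l -> exists2 Q, primeO iota Q & l%:R \in Q.
Proof.
move=> pl; have [|||||Q prQ JQ] := @primeO_exists _ iota (fun x => exists2 y, y \in O & x = l%:R * y).
- by move=> _ [y Oy ->]; rewrite rpredM ?rpred_nat.
- by exists 0; rewrite ?mulr0 // rpred0.
- by move=> _ _ [x Ox ->] [y Oy ->]; exists (x + y); rewrite ?mulrDr // rpredD.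
- by move=> a _ Oa [y Oy ->]; exists (a * y); rewrite ?rpredM // mulrCA.
- move=> [y Oy Dy]; have l0 : l%:R != 0 :> L by rewrite (natr_num_eq0 iota) -lt0n prime_gt0.
  have [g|c Dc] := intO_fixed Oy.
    by apply: (mulfI l0); rewrite -Dy -(rmorph_nat g) -rmorphM /= -Dy rmorph1.
  have : l%:Z * c = 1 by apply: (intr_inj_num iota); rewrite rmorphM /= -Dc -Dy.
  by move=> E; have : (l%:Z %| 1)%Z; [apply/dvdzP; exists c; rewrite mulrC|rewrite dvdz1 => /eqP; case: (l) pl => [|[]]].
- by exists Q => //; apply: JQ; exists 1; rewrite ?mulr1 ?rpred1.
Qed.

Variables (p : nat) (pr_p : prime p) (z : L) (prim_z : p.-primitive_root z).
Variables (F0 : divringClosed L) (stF0 : forall (h : gT) x, x \in F0 -> h x \in F0).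
(** This says that [L = F0(z)], on the side of the Galois group. *)
Hypothesis F0z_gen : forall g : gT, (forall x, x \in F0 -> g x = x) -> g z = z -> g = 1%g.
Hypothesis unr : forall l Q v pi, l != p -> adic l Q v -> uniformizer v F0 pi -> v l%:R = v pi.
Hypothesis tame : forall Q v pi, adic p Q v -> uniformizer v F0 pi ->
  exists2 e : nat, v p%:R = e%:Z * v pi & ~~ (p %| e)%N.

(** The prime [l] is a uniformizer of [F0] fixed by [g], so the tame character of [g] is 1 and [g]
    fixes [F0]. It fixes [z] too: otherwise [g z / z] is a root of unity congruent to 1 modulo [Q],
    which puts [p] in [Q]. *)
Lemma inertia_trivial_away l Q g : prime l -> l != p -> primeO iota Q -> l%:R \in Q ->
  g \in inertia iota Q -> g = 1%g.
Proof.
move=> pl lp prQ Ql Ig; have [v av] := adic_exists pl prQ Ql.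
have [pi upi] := adic_uniformizer F0 av; have vl := unr lp av upi.
have [_ _ _ hv v_l v_loc v_Q] := av; have [Fpi pi0 vpi mpi] := upi.
have l0 : l%:R != 0 :> L by rewrite (natr_num_eq0 iota) -lt0n prime_gt0.
have ul : uniformizer v F0 l%:R.
  by split=> [|//|//|x Fx vx]; rewrite ?rpred_nat // vl; apply: mpi.
apply: F0z_gen.
  apply: (inertia_tame_index prQ pl Ql v_l v_loc v_Q stF0 ul (e := 1)) => //.
  - by rewrite mul1r.
  - by rewrite gtnNdvd ?prime_gt1.
  - by rewrite /theta rmorph_nat mulfV // residue1.
apply: contraNeq lp => gz; have zp := prim_expr_order prim_z.
have Oz := unity_root_intO iota pr_p zp.
have z0 : z != 0 by apply: contraTneq (oner_neq0 L) => z0; rewrite -zp z0 expr0n gtn_eqF ?prime_gt0 ?eqxx.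
have Qp : p%:R \in Q.
  apply: (unity_root_congr pr_p prQ (x := g z / z)).
  - by rewrite expr_div_n -rmorphXn /= zp rmorph1 divr1.
  - by rewrite -subr_eq0 -(inj_eq (mulIf z0)) mul0r mulrBl divfK // mul1r subr_eq0.
  have -> : g z / z - 1 = z ^+ p.-1 * (g z - z).
    by apply: (mulIf z0); rewrite mulrBl divfK // mulrAC -exprSr prednK ?prime_gt0 // zp !mul1r.
  by apply: (primeO_M prQ); [apply: rpredX | move/inertiaP: Ig; apply].
have := primeO_int prQ pl Ql p; rewrite [_ \in Q]Qp => /esym.
by rewrite dvdzE /= dvdn_prime2.
Qed.

Section AtP.
Variables (Q : {pred L}) (v : L -> int) (av : adic p Q v).
Let prQ := adic_primeO av.
Let Qp := adic_mem av.
Let hv := adic_val av.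
Let v_p := adic_gt0 av.
Let v_loc := adic_loc av.
Let v_Q := adic_pos av.
Local Notation I := (inertia iota Q).
Local Notation I_group := (inertia_group prQ).
Local Notation chp := (residue_pchar pr_p Qp hv v_Q).

Lemma thetaX pi (g : gT) n : pi != 0 -> g \in I -> theta hv pi (g ^+ n)%g = theta hv pi g ^+ n.
Proof.
move=> pi0 Ig; have IX m : (g ^+ m)%g \in I by apply: (@groupX _ I_group).
elim: n => [|n IH]; first by rewrite /theta gal_id divff // residue1.
by rewrite expgS exprS -IH (thetaM prQ pr_p hv v_p v_loc v_Q pi0 Ig (IX n)).
Qed.

(** An element of order [p] has trivial tame character, as the residue field has characteristic [p].
    It thus fixes the tame field [F0]; it fixes [z] by its order, hence all of [L]. *)
Lemma inertia_order_coprime : ~~ (p %| #|I|)%N.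
Proof.
apply/negP => /(Cauchy (G := I_group) pr_p)[g Ig og].
have [pi upi] := adic_uniformizer F0 av; have [Fpi pi0 vpi mpi] := upi.
have [e ve ne] := tame av upi.
have gp : (g ^+ p = 1)%g by rewrite -og expg_order.
suffices g1 : g = 1%g by move: (prime_gt1 pr_p); rewrite -og g1 order1.
apply: F0z_gen; last exact: (gal_order_unity_root pr_p prim_z).
apply: (inertia_tame_index prQ pr_p Qp v_p v_loc v_Q stF0 upi ve ne Ig).
apply: (expr_pchar_inj (n := 1) chp).
by rewrite expn1 -thetaX // gp /theta gal_id divff // residue1 expr1n.
Qed.

Lemma inertia_order_elt (g : gT) : g \in I -> ~~ (p %| #[g]%g)%N.
Proof.
by move=> Ig; apply: contra inertia_order_coprime => /dvdn_trans; apply; apply: (@order_dvdG _ I_group).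
Qed.

(** The tame character for [L] itself is injective on [I], because orders in [I] are prime to [p];
    so [I] embeds in the multiplicative group of a field. *)
Lemma inertia_cyclic : cyclic I.
Proof.
have [pi upi] := adic_uniformizer {:L}%AS av; have [Fpi pi0 vpi mpi] := upi.
apply: (@field_mul_group_cyclic _ I_group _ (theta hv pi)).
  exact: (thetaM prQ pr_p hv v_p v_loc v_Q pi0).
move=> g Ig; split=> [th|->]; last by rewrite /theta gal_id divff // residue1.
apply/eqP/gal_eqP => x Lx; rewrite gal_id.
by apply: (inertia_tame_order prQ pr_p Qp v_p v_loc v_Q _ upi) => //; [move=> *; apply: memvf|apply: inertia_order_elt].
Qed.

Lemma inertia_derived_generate (g : gT) :
  exists i a, [/\ i \in I, a \in [~: [set: gT], [set: gT]]%g & g = (i * a)%g].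
Proof.
set D := [~: _, _]%g; pose N := (I_group <*> [group of D])%G.
have DE : N = (I_group * D)%g :> {set gT}.
  apply: norm_joinEl; apply: (subset_trans (subsetT _)); exact: commg_normr.
suffices : g \in N by rewrite DE => /mulsgP[i a Ii Da ->]; exists i, a.
apply: (abelian_unramified_trivial (iota := iota)); first by rewrite /= joing_subr.
move=> l Q' pl lQ' prQ'; apply/subsetP => h Ih.
have [El|nl] := eqVneq l p; last by rewrite (inertia_trivial_away pl nl prQ' lQ' Ih) group1.
(* An automorphism [k] that carries [Q'] into [Q] conjugates the inertia group of [Q'] into [I], and
   [h] differs from [h ^ k] by a commutator. *)
rewrite El in lQ'; have [|||||k Dk] := conj_prime prQ pr_p Qp (F := {:L}%AS) (P := Q') _ _ _ _ _ lQ'.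
- by move=> x /(primeO_sub prQ') Ox; apply/andP; rewrite memvf.
- exact: (primeO_0 prQ').
- exact: (primeO_D prQ').
- by move=> a x /andP[Oa _]; apply: (primeO_M prQ').
- exact: (primeO_1 prQ').
have Ihk : (h ^ k)%g \in I.
  apply/inertiaP => x Ox; rewrite conjgE !galM ?memvf //.
  have Oy : (k^-1)%g x \in O by apply: intO_gal.
  have -> : x = k ((k^-1)%g x) by rewrite -galM ?memvf // mulVg gal_id.
  rewrite -[(k^-1)%g (k _)]galM ?memvf // mulgV gal_id -rmorphB; apply: Dk.
  by move/inertiaP: Ih; apply.
have -> : h = (h ^ k * [~ h ^ k, k^-1])%g by rewrite -conjg_mulR conjgK.
by rewrite groupM //; [apply: (subsetP (joing_subl _ _))|apply: (subsetP (joing_subr _ _)); apply: mem_commg; rewrite inE].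
Qed.

Local Notation D := [~: [set: gT], [set: gT]]%g.
Hypothesis abD : abelian D.

Lemma inertia_derived_trivial (g : gT) : g \in I -> g \in D -> g = 1%g.
Proof.
move=> Ig Dg; have /cyclicP[t It] := inertia_cyclic.
have /cycleP[k Dk] : g \in <[t]>%g by rewrite -It.
rewrite Dk; apply: (@cyclic_derived_complement _ [group of D] t erefl abD); last by rewrite /= -Dk.
move=> h; have [i [a [Ii Da ->]]] := inertia_derived_generate h.
by move: Ii; rewrite It => /cycleP[m ->]; exists m, a.
Qed.

Lemma residue_rat (r : rat) : vge v 0 (ratr r) ->
  residue hv (ratr r) ^+ p = residue hv (ratr r).
Proof.
set x := ratr r => vx; have resX (n : int) : residue hv n%:~R ^+ p = residue hv n%:~R.
  by rewrite residue_int -[_ ^+ p]/(pFrobenius_aut chp _) rmorph_int.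
have b0 : (denq r)%:~R != 0 :> L by rewrite (intr_num_eq0 iota) denq_neq0.
have Dx : x * (denq r)%:~R = (numq r)%:~R by rewrite /x /ratr divfK.
have vb : ~~ vge v 1 (denq r)%:~R.
  apply/negP => vb; have va : vge v 1 (numq r)%:~R by rewrite -Dx (vgeMl hv).
  move: va vb; rewrite !v_Q ?rpred_int // !(primeO_int prQ pr_p Qp) !dvdzE /= => pa pb.
  have := coprime_num_den r; rewrite /coprime => /eqP E.
  by have := prime_gt1 pr_p; rewrite ltnNge dvdn_leq // -E dvdn_gcd pa.
have rb : residue hv (denq r)%:~R != 0 by rewrite residue_eq0 ?(vge_int hv).
apply: (mulIf rb); rewrite -[in LHS](resX (denq r)) -exprMn -residueM ?(vge_int hv) //.
by rewrite Dx resX.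
Qed.

(* The trace over I of a unit g pi / pi is rational, so its residue lies in the prime field. *)
Lemma inertia_pow_derived (g : gT) : g \in I -> (g ^+ p.-1)%g \in D.
Proof.
move=> Ig; pose F := fixedField D.
have FP x : reflect (forall a, a \in D -> a x = x) (x \in F) by apply: fixedFieldP (memvf x).
have stF (h : gT) x : x \in F -> h x \in F.
  move/FP => fx; apply/FP => a Da; rewrite -galM ?memvf //.
  have -> : (h * a = (a ^ h^-1) * h)%g by rewrite conjgE invgK !mulgA mulgKV.
  rewrite galM ?memvf // (fx (a ^ h^-1)%g) // memJ_norm //.
  by apply: (subsetP (commg_normr [set: gT] [set: gT])); rewrite inE.
have [pi upi] := adic_uniformizer F av; have [Fpi pi0 vpi mpi] := upi.
pose r := g pi / pi; have Fr : r \in F by rewrite rpred_div ?stF.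
have vr : vge v 0 r by apply: (theta_unit prQ pr_p hv v_p v_loc).
(* This trace is fixed by [I] and by [D], hence by the whole group. Its residue is [n] times that of
   [r], since inertia acts trivially on residues, and [n = #|I|] is prime to [p]. *)
pose c := \sum_(s in I) s r.
have Fc : c \in F by apply: rpred_sum => s _; apply: stF.
have [q Dq] : exists q : rat, c = ratr q.
  apply: gal_fixed_rat => h; have [i [a [Ii /(FP _ Fc) fa ->]]] := inertia_derived_generate h.
  rewrite galM ?memvf // -[RHS]fa; congr (a _).
  rewrite /c rmorph_sum /= [RHS](reindex_inj (mulIg i)) /=.
  under [RHS]eq_bigl => s do rewrite (@groupMr _ I_group _ _ Ii).
  by apply: eq_bigr => s _; rewrite galM ?memvf.
pose n := #|I|; have vc1 : vge v 1 (c - n%:R * r).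
  rewrite mulr_natl -sumr_const -sumrB; apply: (vge_sum hv) => s Is.
  exact: (inertia_vge prQ hv v_loc v_Q Is vr).
have vnr : vge v 0 (n%:R * r) by rewrite (vge0M hv) ?(vge_nat hv).
have vc : vge v 0 c by rewrite -(subrK (n%:R * r) c) (vgeD hv) // (vge_le _ vc1).
have rc : residue hv c = n%:R * residue hv r.
  by rewrite -residue_nat -residueM ?(vge_nat hv) //; apply/eqP; rewrite residue_eq.
have rn : n%:R != 0 :> {ideal_quot @max_ideal _ _ hv}.
  by rewrite -(dvdn_pcharf chp) inertia_order_coprime.
have rr0 : residue hv r != 0.
  rewrite residue_eq0 // /vge negb_or /r mulf_neq0 ?invr_neq0 ?fmorph_eq0 //= (valM hv) ?invr_neq0 ?fmorph_eq0 //.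
  by rewrite (valV hv) // (val_inertia prQ pr_p hv v_p v_loc Ig) // subrr.
have th1 : residue hv r ^+ p.-1 = 1.
  apply: (mulIf rr0); rewrite mul1r -exprSr prednK ?prime_gt0 //; apply: (mulfI rn).
  have := @residue_rat q; rewrite -Dq rc => /(_ vc); rewrite exprMn.
  by rewrite -[n%:R ^+ p]/(pFrobenius_aut chp _) rmorph_nat.
have Igp : (g ^+ p.-1)%g \in I by apply: (@groupX _ I_group).
have fixF : forall x, x \in F -> (g ^+ p.-1)%g x = x.
  apply: (inertia_tame_order prQ pr_p Qp v_p v_loc v_Q stF upi) => //; first exact: inertia_order_elt.
  by rewrite thetaX.
suffices : (g ^+ p.-1)%g \in 'Gal({:L} / F)%g by rewrite (gal_fixedField [group of D]).
by rewrite gal_kHom ?subvf //; apply/kAHomP.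
Qed.

Lemma derived_fix_root (g : gT) : g \in D -> g z = z.
Proof.
pose S := [set h : gT | h z == z]; have S_group : group_set S.
  apply/group_setP; split=> [|h k]; rewrite !inE ?gal_id // => /eqP hz /eqP kz.
  by rewrite galM ?memvf // hz kz.
suffices sDS : D \subset group S_group by move/(subsetP sDS); rewrite inE => /eqP.
rewrite gen_subG; apply/subsetP => _ /imset2P[a b _ _ ->]; rewrite inE; apply/eqP.
have : (b * a)%g ([~ a, b]%g z - z) == 0.
  have -> : (b * a)%g ([~ a, b]%g z - z) = (b * a * [~ a, b])%g z - (b * a)%g z.
    by rewrite rmorphB /= [in RHS]galM ?memvf // (gal_unity_root_comm prim_z).
  by rewrite -commgC !galM ?memvf // (gal_unity_root_comm prim_z a b) subrr eqxx.
by rewrite fmorph_eq0 subr_eq0 => /eqP.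
Qed.

(** A count: every automorphism is [t^i a] with [i < p - 1] and [a] in [D], and [a] fixes the powers
    of [z]. All [p - 1] conjugates of [z] occur among the [t^i z], so these are distinct and [z]
    itself comes from [i = 0] only. *)
Lemma derived_fixP (g : gT) : reflect (g z = z) (g \in D).
Proof.
apply: (iffP idP); first exact: derived_fix_root; have /cyclicP[t It] := inertia_cyclic.
have It1 : t \in I by rewrite It cycle_id.
have tp := inertia_pow_derived It1.
have p1 : (0 < p.-1)%N by rewrite -ltnS prednK ?prime_gt1 ?prime_gt0.
have decomp h : exists i : 'I_p.-1, exists2 a, a \in D & h = (t ^+ i * a)%g.
  have [x [a [+ Da ->]]] := inertia_derived_generate h; rewrite It => /cycleP[i ->].
  exists (Ordinal (ltn_pmod i p1)), ((t ^+ p.-1) ^+ (i %/ p.-1) * a)%g.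
    by apply: (@groupM _ [group of D]) => //; apply: (@groupX _ [group of D]).
  by rewrite mulgA -expgM -expgD /= addnC mulnC -divn_eq.
have fixt i a : a \in D -> (t ^+ i * a)%g z = (t ^+ i)%g z.
  move=> Da; rewrite galM ?memvf //; have [k ->] := gal_unity_root prim_z (t ^+ i)%g.
  by rewrite rmorphXn /= derived_fix_root.
have lep (j : 'I_p.-1) : (j.+1 < p)%N by rewrite -[p in X in (_ < X)%N]prednK ?prime_gt0 // ltnS.
have exs (j : 'I_p.-1) : exists i : 'I_p.-1, (t ^+ i)%g z = z ^+ j.+1.
  have [h Dh] := gal_unity_root_exists iota pr_p prim_z (k := j.+1) (lep j).
  have [i [a Da Eh]] := decomp h; exists i; by rewrite -Dh Eh fixt.
have [s Ds] := fin_all_exists exs.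
have zinj (i j : 'I_p.-1) : z ^+ i.+1 = z ^+ j.+1 -> i = j.
  move/eqP; rewrite (eq_prim_root_expr prim_z) !modn_small ?lep // eqSS => /eqP.
  exact: val_inj.
have injs : injective s by move=> i j E; apply: zinj; rewrite -!Ds E.
have uniq0 (i : 'I_p.-1) : (t ^+ i)%g z = z -> i = s (Ordinal p1).
  rewrite -(f_invF injs i); set j := invF injs i; rewrite Ds -[X in _ = X -> _]expr1 => E.
  by congr (s _); apply: zinj.
move=> gz; have [i [a Da Dg]] := decomp g.
have ti : (t ^+ i)%g z = z by rewrite -(fixt _ _ Da) -Dg.
have : i = Ordinal p1.
  by rewrite (uniq0 _ ti); apply/esym/uniq0; rewrite expg0 gal_id.
by move=> i0; rewrite Dg i0 /= expg0 mul1g.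
Qed.

Lemma val_rat (r : rat) : r != 0 -> exists k : int, v (ratr r) = k * v p%:R.
Proof.
move=> r0; have [k [u0 lu luV]] := loc_unit_rat prQ pr_p Qp r0; exists k.
have p0 : p%:R != 0 :> L by rewrite (natr_num_eq0 iota) -lt0n prime_gt0.
have vu : v (ratr r / p%:R ^ k) = 0.
  apply/eqP; rewrite eq_le; apply/andP; split; last exact/(v_loc u0).
  by rewrite -oppr_ge0 -(valV hv) //; apply/v_loc; rewrite ?invr_neq0.
have vpk : v (p%:R ^ k) = k * v p%:R.
  case: (k) => m; first by rewrite -exprnP (valX hv) // mulrC.
  by rewrite NegzE -exprnN (valV hv) ?expf_neq0 // (valX hv) // mulrC mulNr.
have r0' : ratr r != 0 :> L by rewrite -(fmorph_eq_rat (in_alg L)) fmorph_eq0.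
have pk0 := expfz_neq0 k p0.
rewrite -vpk -[RHS]add0r -vu -(valM hv) // ?mulf_neq0 ?invr_neq0 //.
by rewrite divfK.
Qed.

(** The product of the [1 - z^i] is [p], and these [p - 1] factors have the same value, since each
    of [z] and [z^i] is a power of the other. *)
Lemma val_one_sub_root : v p%:R = p.-1%:Z * v (1 - z).
Proof.
have z1 i : (0 < i < p)%N -> 1 - z ^+ i != 0.
  case/andP=> i0 ltip; rewrite subr_eq0 eq_sym -[1](expr0 z) (eq_prim_root_expr prim_z).
  by rewrite mod0n modn_small // -lt0n.
have vroot x : x ^+ p = 1 -> vge v 0 x.
  by move=> xp; apply: (vge_intO prQ v_loc); exact: (unity_root_intO iota pr_p xp).
have le_v x m : x ^+ p = 1 -> 1 - x != 0 -> 1 - x ^+ m != 0 -> v (1 - x) <= v (1 - x ^+ m).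
  move=> xp x1 xm1; have E : 1 - x ^+ m = (1 - x) * \sum_(i < m) x ^+ i.
    by rewrite -opprB subrX1 -mulNr opprB.
  have s0 : \sum_(i < m) x ^+ i != 0 by move: xm1; rewrite E mulf_eq0 negb_or => /andP[].
  rewrite E (valM hv) // lerDl; apply: val_ge => //.
  by apply: (vge_sum hv) => i _; apply: (vge0X hv); apply: vroot.
have zp := prim_expr_order prim_z.
have z1' : 1 - z != 0 by have := z1 1%N; rewrite expr1; apply; rewrite prime_gt1.
have vz i : (0 < i < p)%N -> v (1 - z ^+ i) = v (1 - z).
  move=> ip; apply/eqP; rewrite eq_le; apply/andP; split; last by apply: le_v => //; apply: z1.
  have prim_zi : p.-primitive_root (z ^+ i).
    rewrite (prim_root_exp_coprime _ prim_z) coprime_sym prime_coprime // gtnNdvd //; by case/andP: ip.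
  have [m Dm] := prim_rootP prim_zi zp; rewrite [in leRHS]Dm; apply: le_v; rewrite ?z1 //.
    by rewrite exprAC zp expr1n.
  by rewrite -Dm.
rewrite -(prod_one_sub_prim_root pr_p prim_z).
have : (p.-1 < p)%N by rewrite prednK // prime_gt0.
rewrite -[X in \prod_(1 <= i < X) _]prednK ?prime_gt0 //.
suffices H n : (n < p)%N -> \prod_(1 <= i < n.+1) (1 - z ^+ i) != 0 /\ v (\prod_(1 <= i < n.+1) (1 - z ^+ i)) = n%:Z * v (1 - z).
  by case/H.
elim: n => [|n IH] ltn; first by rewrite big_geq // oner_neq0 (val1 hv) mul0r.
have [n0 vn] := IH (ltnW ltn); rewrite big_nat_recr //= (valM hv) ?z1 // vn vz //.
by rewrite mulf_neq0 ?z1 //; split=> //; rewrite intS mulrDl mul1r addrC.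
Qed.

(** The fixed field of [D] is generated by [z]. A polynomial in [z] is reduced modulo
    [1 + X + ... + X^(p-1)], and the variable is then shifted to [1 - z], whose value is known. *)
Lemma fixed_poly_root w : (forall g, g \in D -> g w = w) ->
  exists2 q : {poly rat}, (size q <= p.-1)%N & w = (map_poly (in_alg L) q).[1 - z].
Proof.
move=> fw; have : w \in <<1; z>>%VS.
  have /galois_fixedField <- : galois <<1; z>>%AS {:L}.
    by apply: (galoisS (K := 1%AS)) (galois_rat L); rewrite sub1v subvf.
  apply/fixedFieldP; rewrite ?memvf // => g; rewrite gal_kHom ?subvf // => /kAHomP fg.
  by apply: fw; apply/derived_fixP; apply: fg; apply: memv_adjoin.
case/Fadjoin_polyP => q0 /polyOver1P[q ->] Dw.
have p0 := prime_gt0 pr_p; have zp := prim_expr_order prim_z.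
pose m : {poly rat} := \poly_(i < p) 1.
have sm : size m = p by rewrite /m size_poly_eq ?oner_eq0.
have m0 : m != 0 by rewrite -size_poly_gt0 sm.
have z1 : z != 1.
  by rewrite -[z]expr1 -(expr0 z) (eq_prim_root_expr prim_z) mod0n modn_small ?prime_gt1.
have mz : (map_poly (in_alg L) m).[z] = 0.
  rewrite (@horner_coef_wide _ p) ?size_map_poly ?sm //.
  rewrite -[RHS](sum_unity_root zp z1); apply: eq_bigr => i _.
  by rewrite coef_map coef_poly ltn_ord /= scale1r mul1r.
have X1 : size (1 - 'X : {poly rat}) = 2%N.
  by rewrite -size_polyN opprB -[1]/(1%:P) size_XsubC.
exists ((q %% m) \Po (1 - 'X)).
  have := ltn_modpN0 q m0; rewrite sm => lt; rewrite size_comp_poly2 // -ltnS prednK //.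
have -> : map_poly (in_alg L) ((q %% m) \Po (1 - 'X)) = map_poly (in_alg L) (q %% m) \Po (1 - 'X).
  by rewrite map_comp_poly rmorphB rmorph1 /= map_polyX.
rewrite horner_comp !hornerE subKr Dw.
by rewrite {1}(divp_eq q m) rmorphD rmorphM /= hornerD hornerM mz mulr0 add0r.
Qed.

(** As [I] meets [D] trivially, only the fixed field of [D] has to be examined. There, with
    [d = v (1 - z)], rational coefficients have values in [(p - 1) d Z], so the terms in different
    powers of [1 - z] have different values, all multiples of [d]. *)
Lemma min_val_one_sub_root y : vge v 1 y -> vge v (v (1 - z)) y.
Proof.
have vp := val_one_sub_root; set d := v (1 - z) in vp *.
have p1 : (0 < p.-1)%N by rewrite -ltnS prednK ?prime_gt1 ?prime_gt0.
have d0 : 0 < d by have := v_p; rewrite vp pmulr_rgt0 ?ltz_nat.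
have u0 : 1 - z != 0.
  rewrite subr_eq0 eq_sym -[z]expr1 -(expr0 z) (eq_prim_root_expr prim_z) mod0n.
  by rewrite modn_small ?prime_gt1.
apply: (unramified_min_val prQ hv v_loc v_Q (A := [group of D])).
  by move=> g Dg Ig; apply: inertia_derived_trivial.
move=> w /fixOP[Ow /fixed_poly_root[q sq Dw]]; rewrite /vge; have [//|w0 /= vw] := eqVneq w 0.
suffices [k Dk] : exists k : int, v w = k * d.
  rewrite Dk -[d in d <= _]mul1r ler_pM2r //; have : 0 < k by rewrite -(pmulr_lgt0 _ d0) -Dk; lia.
  by clear; lia.
(* The expansion of [w] in powers of [1 - z], as a vanishing sum with [- w] in front. Two terms have
   equal value; one of them must be [- w], for the others differ modulo [(p - 1) d]. *)
pose f (i : 'I_p.-1.+1) := oapp (fun j : 'I_p.-1 => (q`_j)%:A * (1 - z) ^+ j) (- w) (unlift ord0 i) : L.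
have f0 : f ord0 != 0 by rewrite /f unlift_none /= oppr_eq0.
have sf : \sum_i f i = 0.
  rewrite big_ord_recl {1}/f unlift_none /= Dw (@horner_coef_wide _ p.-1) ?size_map_poly //.
  rewrite addrC -sumrB big1 // => i _; by rewrite /f liftK /= coef_map /= subrr.
have vf j : f (lift ord0 j) != 0 -> exists k : int, v (f (lift ord0 j)) = (k * p.-1%:Z + j%:Z) * d.
  rewrite /f liftK /= mulf_eq0 negb_or => /andP[q0 _].
  have qj0 : q`_j != 0 by apply: contraNneq q0 => ->; rewrite scale0r.
  have [k Dk] := val_rat qj0; exists k.
  rewrite (valM hv) ?expf_neq0 // (valX hv) // -/d.
  have -> : v (q`_j)%:A = k * v p%:R by rewrite -Dk -(fmorph_eq_rat (in_alg L)).
  by rewrite vp; ring.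
have [i [j [ij fi fj]]] := val_sum_eq hv f0 sf.
case: (unliftP ord0 i) ij fi => [i' ->|->]; case: (unliftP ord0 j) fj => [j' ->|->] fj ij fi E.
- have [[k Dk] [k' Dk']] := (vf _ fi, vf _ fj); case/eqP: ij; congr lift; apply: val_inj => /=.
  move: E; rewrite Dk Dk' => /(mulIf (lt0r_neq0 d0)) E.
  exact: int_digits_inj E (ltn_ord j') (ltn_ord i').
- have [k Dk] := vf _ fi; exists (k * p.-1%:Z + i'%:Z); rewrite -Dk E /f unlift_none /=.
  by rewrite -mulN1r (valM hv) ?(valN1 hv) ?add0r // oppr_eq0 oner_eq0.
- have [k Dk] := vf _ fj; exists (k * p.-1%:Z + j'%:Z); rewrite -Dk -E /f unlift_none /=.
  by rewrite -mulN1r (valM hv) ?(valN1 hv) ?add0r // oppr_eq0 oner_eq0.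
- by case/eqP: ij.
Qed.

End AtP.

(** Inertia is trivial in the whole Galois group, so it suffices to look at rational integers, where
    [Q] contains only multiples of [l]. *)
Lemma min_val_away l Q v : l != p -> adic l Q v -> forall y, vge v 1 y -> vge v (v l%:R) y.
Proof.
move=> lp [pl prQ Ql hv v_l v_loc v_Q].
apply: (unramified_min_val prQ hv v_loc v_Q (A := [group of [set: gT]])).
  by move=> g _; apply: (inertia_trivial_away pl lp prQ Ql).
move=> w /fixOP[Ow fw]; have [|c ->] := intO_fixed Ow; first by move=> g; apply: fw; rewrite inE.
rewrite v_Q ?rpred_int // (primeO_int prQ pl Ql) => /dvdzP[m ->].
rewrite rmorphM /= (vgeMl hv) ?(vge_int hv) // /vge; by rewrite lexx orbT.
Qed.

Hypothesis abD : abelian [~: [set: gT], [set: gT]]%g.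

Theorem tame_metabelian_stab_abelian (g h : gT) : g z = z -> h z = z -> (g * h = h * g)%g.
Proof.
have [Q prQ Qp] := primeO_above pr_p; have [v av] := adic_exists pr_p prQ Qp.
move=> /(derived_fixP av) Dg /(derived_fixP av) Dh; exact: (centsP abD).
Qed.

(** In both cases [w] lies in the field generated by [z]: the least positive value on [L] is
    attained there. *)
Theorem tame_metabelian_min_val l Q v : adic l Q v -> exists w,
  [/\ w = l%:R \/ l = p /\ w = 1 - z, 0 < v w & forall y, vge v 1 y -> vge v (v w) y].
Proof.
move=> av; have [El|lp] := eqVneq l p; last first.
  by exists l%:R; split; [left|apply: (adic_gt0 av)|apply: (min_val_away lp av)].
rewrite El in av; exists (1 - z); split; [by right| |exact: (min_val_one_sub_root av abD)].
by have := adic_gt0 av; rewrite (val_one_sub_root av) pmulr_rgt0 // ltz_nat -ltnS prednK ?prime_gt1 ?prime_gt0.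
Qed.

End Structure.

(** * Subfields of the algebraic numbers *)

Section SubfieldPolynomials.
Variable F : divringClosed algC.
Local Notation "f ^v" := (map_poly (val : fieldOf F -> algC) f) (at level 2).

Lemma fieldOf_poly (m : {poly algC}) : m \is a polyOver F -> exists f : {poly fieldOf F}, f^v = m.
Proof.
move=> Fm; exists (\poly_(i < size m) insubd (0 : fieldOf F) m`_i).
apply/polyP => i; rewrite coef_map coef_poly /=; have [lti|gei] := ltnP i (size m).
  by rewrite insubdK //; apply: (polyOverP Fm).
by rewrite nth_default.
Qed.

Lemma irreducible_root (m : {poly algC}) x : m != 0 -> m \is a polyOver F -> root m x ->
  exists2 f : {poly fieldOf F}, irreducible_poly f & root f^v x.
Proof.
move=> m0 /fieldOf_poly[f Df] mx.
pose P n := `[< exists f : {poly fieldOf F}, [/\ f != 0, root f^v x & size f = n] >].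
have exP : exists n, P n.
  exists (size f); apply/asboolP; exists f; split; rewrite ?Df //.
  by apply: contraNneq m0 => f0; rewrite -Df f0 rmorph0.
case: (ex_minnP exP) => n /asboolP[{m m0 mx Df} {}f [f0 fx sf]] minn.
have minP (q : {poly fieldOf F}) : q != 0 -> root q^v x -> (size f <= size q)%N.
  by move=> q0 qx; rewrite sf; apply: minn; apply/asboolP; exists q.
exists f => //; split.
  rewrite ltnNge; apply/negP => /size1_polyC Df; move: f0 fx; rewrite Df map_polyC rootC polyC_eq0 /=.
  by rewrite -(rmorph0 (val : fieldOf F -> algC)) (inj_eq val_inj) => /negPf->.
move=> q sq qf; rewrite -dvdp_size_eqp //; apply/eqP.
case/dvdpP: qf => r Df; move: (f0) fx; rewrite Df mulf_eq0 negb_or => /andP[r0 q0].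
have s0 (u : {poly fieldOf F}) : u != 0 -> (0 < size u)%N by rewrite size_poly_gt0.
have sqf : (size q <= size (r * q)%R)%N by rewrite size_mul // -(prednK (s0 r r0)) addSn leq_addl.
rewrite rmorphM rootM => /orP[rx|qx].
  have := minP r r0 rx; rewrite Df size_mul //; have := s0 r r0; have := s0 q q0.
  by move: sq; move: (size _) (size _) => a b; clear; lia.
by apply/eqP; rewrite eqn_leq sqf -Df minP.
Qed.

Lemma irreducible_root_dvd (f m : {poly fieldOf F}) x : irreducible_poly f ->
  root f^v x -> root m^v x -> f %| m.
Proof.
move=> [sf irr] fx mx; have gx : root (gcdp f m)^v x by rewrite gcdp_map root_gcd fx.
have : gcdp f m %= f.
  apply: irr; last exact: dvdp_gcdl.
  apply/negP => /size_poly1P[c c0 Dg]; move: gx; rewrite Dg map_polyC rootC /=.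
  by rewrite -(rmorph0 (val : fieldOf F -> algC)) (inj_eq val_inj) (negPf c0).
by move/eqp_dvdl <-; apply: dvdp_gcdr.
Qed.

End SubfieldPolynomials.

Lemma Crat_sub (F : divringClosed algC) : {subset Crat <= F}.
Proof. by move=> _ /CratP[a ->]; rewrite /ratr rpred_div // rpred_int. Qed.

Lemma Crat_poly (m : {poly algC}) : m \is a polyOver Crat -> exists q : {poly rat}, m = map_poly ratr q.
Proof.
move=> Cm; have /fin_all_exists[c Dc] (i : 'I_(size m)) : exists a : rat, m`_i = ratr a.
  by apply/CratP; apply: (polyOverP Cm).
exists (\poly_(i < size m) oapp c 0 (insub i)); apply/polyP => i; rewrite coef_map coef_poly /=.
have [lti|gei] := ltnP i (size m); last by rewrite nth_default // rmorph0.
by rewrite insubT; exact: (Dc (Ordinal lti)).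
Qed.

Lemma galois_conj_mem (K : divringClosed algC) x y :
  galois_extension Crat K -> x \in K -> root (minCpoly x) y -> y \in K.
Proof.
move=> [_ galK] Kx xy; have [q [Dq mq] minq] := minCpolyP x.
have Cq : minCpoly x \is a polyOver Crat by rewrite Dq; apply/polyOverP => i; rewrite coef_map Crat_rat.
have [f irr fx] := irreducible_root (monic_neq0 (minCpoly_monic x)) Cq (root_minCpoly x).
apply: (galK f irr x Kx fx); have [|f' Df] := @Crat_poly (map_poly val f).
  by apply/polyOverP => i; rewrite coef_map; apply: (valP (f`_i)).
move: fx; rewrite Df minq => /dvdpP[r ->]; rewrite rmorphM rootM /= -Dq.
by rewrite xy orbT.
Qed.

Lemma galois_aut_mem (K : divringClosed algC) (nu : {rmorphism algC -> algC}) x :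
  galois_extension Crat K -> x \in K -> nu x \in K.
Proof.
move=> galK Kx; apply: galois_conj_mem galK Kx _.
by rewrite -(minCpoly_aut nu) root_minCpoly.
Qed.

Lemma splitting_number_field (f : {poly rat}) : f \is monic ->
  exists (L : splittingFieldType rat) (iota : {rmorphism L -> algC}) (rs : seq L),
    map_poly ratr f = \prod_(r <- rs) ('X - (iota r)%:P) /\ <<1 & rs>>%VS = fullv.
Proof.
move=> mf; have [s Df] := closed_field_poly_normal (map_poly ratr f : {poly algC}).
rewrite (monicP _) ?map_monic // scale1r in Df.
have [Qs [QsC [rs Drs genQs]]] := num_field_exists s.
have DfC : map_poly ratr f = \prod_(r <- rs) ('X - (QsC r)%:P).
  by rewrite Df -Drs big_map.
have DQs : map_poly (in_alg Qs) f = \prod_(r <- rs) ('X - r%:P).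
  apply: (map_poly_inj QsC); rewrite -map_poly_comp rmorph_prod /=.
  under [RHS]eq_bigr => r _ do rewrite rmorphB /= map_polyX map_polyC /=.
  rewrite -DfC; apply: eq_map_poly => c /=; exact: (fmorph_eq_rat (QsC \o in_alg Qs) c).
have ax : FieldExt_isSplittingField _ Qs.
  constructor; exists (map_poly (in_alg Qs) f); first by apply/polyOver1P; exists f.
  by exists rs => //; rewrite DQs eqpxx.
by exists (HB.pack_for (splittingFieldType rat) Qs ax), QsC, rs.
Qed.

(* A subspace of maximal dimension contained in F exhausts F. *)
Lemma divring_vspace (L : splittingFieldType rat) (F : divringClosed L) : exists U : {vspace L}, forall x, (x \in U) = (x \in F).
Proof.
have ZF (c : rat) x : x \in F -> c *: x \in F.
  move=> Fx; rewrite -mulr_algl rpredM // -[c%:A]/(in_alg L c) (fmorph_eq_rat (in_alg L)).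
  by rewrite rpred_div // rpred_int.
pose P n := `[< exists U : {vspace L}, \dim U = n /\ {subset U <= F} >].
have exP : exists n, P n.
  by exists 0%N; apply/asboolP; exists 0%VS; rewrite dimv0; split=> // x; rewrite memv0 => /eqP->; apply: rpred0.
have bP n : P n -> (n <= \dim {:L})%N by case/asboolP => U [<- _]; rewrite dimvS ?subvf.
case: (ex_maxnP exP bP) => n /asboolP[U [dU sUF]] maxn.
exists U => x; apply/idP/idP => [/sUF//|Fx]; apply: contraT => nUx.
have /maxn : P (\dim (U + <[x]>)).
  apply/asboolP; exists (U + <[x]>)%VS; split=> // _ /memv_addP[u Uu [_ /vlineP[c ->] ->]].
  by apply: rpredD; [apply: sUF | apply: ZF].
have x0 : x != 0 by apply: contraNneq nUx => ->; rewrite mem0v.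
rewrite leqNgt -dU dimv_disjoint_sum ?dim_vline ?x0 ?addn1 ?leqnn //.
apply/eqP; rewrite -subv0; apply/subvP => y; rewrite memv_cap memv0 => /andP[Uy /vlineP[c Dy]].
apply: contraNT nUx => y0; have c0 : c != 0 by apply: contraNneq y0 => c0; rewrite Dy c0 scale0r.
by rewrite -[x]scale1r -(mulVf c0) -scalerA -Dy memvZ.
Qed.

Section Lifting.
Variables (L : splittingFieldType rat) (iota : {rmorphism L -> algC}) (K : divringClosed algC).
Hypothesis galK : galois_extension Crat K.
Local Notation gT := (gal_of {:L}).

(** Since [K] and the image of [L] need not be comparable, neither group restricts to the other; [g]
    and [s] are compared on the intersection of the two fields. *)
Definition lifts (g : gT) (s : fieldOf K -> fieldOf K) : Prop :=
  forall k y, val k = iota y -> val (s k) = iota (g y).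

Lemma gal_mem (g : gT) y : iota y \in K -> iota (g y) \in K.
Proof.
move=> Ky; have [nu ->] := extend_algC_subfield_aut iota g; exact: galois_aut_mem.
Qed.

Lemma lifts_comp g h s t : lifts g s -> lifts h t -> lifts (g * h)%g (t \o s).
Proof. by move=> gs ht k y Dk; rewrite galM ?memvf //=; apply/ht/gs. Qed.

Lemma lifts_inv g s s' : cancel s' s -> cancel s s' -> lifts g s -> lifts g^-1%g s'.
Proof.
move=> sK s'K gs k y Dk; have Ky : iota (g^-1%g y) \in K by apply: gal_mem; rewrite -Dk (valP k).
pose k0 : fieldOf K := Sub (iota (g^-1%g y)) Ky.
suffices <- : s k0 = k by rewrite s'K SubK.
by apply: val_inj; rewrite (gs k0 (g^-1%g y)) ?SubK // -galM ?memvf // mulVg gal_id Dk.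
Qed.

(** An inverse in [G] is carried along because the constructors of [derived] ask for explicit
    inverses. *)
Definition liftable (G : (fieldOf K -> fieldOf K) -> Prop) (g : gT) : Prop :=
  exists s s', [/\ G s, G s', cancel s s', cancel s' s & lifts g s].

Lemma liftable_derived G (A : {group gT}) :
  (forall g, g \in A -> liftable G g) -> forall g, g \in [~: A, A]%g -> liftable (derived G) g.
Proof.
move=> lA; pose S := [set g : gT | `[< liftable (derived G) g >]].
have lcomm a b : a \in A -> b \in A -> liftable (derived G) [~ a, b]%g.
  move=> /lA[s [s' [Gs Gs' sK s'K ls]]] /lA[t [t' [Gt Gt' tK t'K lt]]].
  exists (t \o s \o t' \o s'), (s \o t \o s' \o t'); split.
  - exact: derived_commutator.
  - exact: derived_commutator.
  - by move=> k /=; rewrite tK sK t'K s'K.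
  - by move=> k /=; rewrite sK tK s'K t'K.
  rewrite /commg conjgE; do !apply: lifts_comp => //; apply: lifts_inv; [| |exact: ls| | |exact: lt]; by [].
have S_group : group_set S.
  apply/group_setP; split=> [|g h].
    (* [derived] has no constructor for the identity, which is obtained as a commutator. *)
    by rewrite inE; apply/asboolP; rewrite -(comm1g (1 : gT)%g); apply: lcomm.
  rewrite !inE => /asboolP[s [s' [Gs Gs' sK s'K ls]]] /asboolP[t [t' [Gt Gt' tK t'K lt]]].
  apply/asboolP; exists (t \o s), (s' \o t'); split; try exact: derived_comp.
  - by move=> k /=; rewrite tK sK.
  - by move=> k /=; rewrite s'K t'K.
  - exact: lifts_comp.
suffices sDS : [~: A, A]%g \subset group S_group.
  by move=> g /(subsetP sDS); rewrite inE => /asboolP.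
by rewrite gen_subG; apply/subsetP => _ /imset2P[a b Aa Ab ->]; rewrite inE; apply/asboolP/lcomm.
Qed.

(** An automorphism of [L] extends to [algC] and then restricts to [K], which is normal. *)
Lemma liftable_galois g : liftable (@Galois Crat K) g.
Proof.
have [nu Dnu] := extend_algC_subfield_aut iota g.
have Km (mu : {rmorphism algC -> algC}) (k : fieldOf K) : mu (val k) \in K.
  exact: galois_aut_mem galK (valP k).
pose r (mu : {rmorphism algC -> algC}) (k : fieldOf K) : fieldOf K := Sub (mu (val k)) (Km mu k).
have rK (mu mu' : {rmorphism algC -> algC}) : cancel mu mu' -> cancel (r mu) (r mu').
  by move=> muK k; apply: val_inj; rewrite /r !SubK muK.
have Gr (mu mu' : {rmorphism algC -> algC}) : cancel mu mu' -> cancel mu' mu -> Galois Crat (r mu).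
  move=> muK mu'K; split; first by exists (r mu'); apply: rK.
  - by move=> x y; apply: val_inj; rewrite /r !(SubK, rmorphB).
  - by split=> [|x y]; apply: val_inj; rewrite /r !(SubK, rmorph1, rmorphM).
  - by move=> k /CratP[c Dc]; apply: val_inj; rewrite /r SubK Dc fmorph_rat.
have [nuK nu'K] := (algC_autK nu, algC_invautK nu).
exists (r nu), (r (algC_invaut nu)); split; try by [exact: rK | exact: (Gr _ _ nuK nu'K) | exact: (Gr _ _ nu'K nuK)].
by move=> k y Dk; rewrite /r SubK Dk Dnu.
Qed.

Lemma derived2_fix : meta_abelian_extension Crat K ->
  forall g, g \in [~: [~: [set: gT], [set: gT]], [~: [set: gT], [set: gT]]]%g ->
  forall y, iota y \in K -> g y = y.
Proof.
move=> [_ der2] g Dg y Ky.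
have [|s [_ [/der2 s1 _ _ _ ls]]] := @liftable_derived (derived (@Galois Crat K)) [group of [~: [set: gT], [set: gT]]%g] _ g Dg.
  by apply: (@liftable_derived (@Galois Crat K) [group of [set: gT]]) => h _; apply: liftable_galois.
pose k : fieldOf K := Sub (iota y) Ky.
by apply: (fmorph_inj iota); rewrite -(ls k y) ?SubK // s1 SubK.
Qed.

End Lifting.

(** * Powers of prime ideals and ramification indices *)

Section IdealPowers.
Variables (R : comNzRingType) (P : {pred R}) (m : nat).

Lemma ideal_powD x y : ideal_pow P m x -> ideal_pow P m y -> ideal_pow P m (x + y).
Proof.
move=> [n1 [c1 [a1 [Pa1 ->]]]] [n2 [c2 [a2 [Pa2 ->]]]].
exists (n1 + n2)%N, (fun i => match split i with inl j => c1 j | inr j => c2 j end).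
exists (fun i => match split i with inl j => a1 j | inr j => a2 j end); split.
  by move=> i j; case: split.
rewrite big_split_ord /=; congr (_ + _); apply: eq_bigr => i _.
  by rewrite -[lshift _ _]/(unsplit (inl i)) unsplitK.
by rewrite -[rshift _ _]/(unsplit (inr i)) unsplitK.
Qed.

Lemma ideal_powMl b x : ideal_pow P m x -> ideal_pow P m (b * x).
Proof.
move=> [n [c [a [Pa ->]]]]; exists n, (fun i => b * c i), a; split=> //.
by rewrite mulr_sumr; apply: eq_bigr => i _; rewrite mulrA.
Qed.

Lemma ideal_pow_expr x : x \in P -> ideal_pow P m (x ^+ m).
Proof.
move=> Px; exists 1%N, (fun=> 1), (fun _ _ => x); split=> //.
by rewrite big_ord1 mul1r prodr_const card_ord.
Qed.

End IdealPowers.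

Section ValueOfIdealPower.
Variables (L : splittingFieldType rat) (iota : {rmorphism L -> algC}).
Variables (l : nat) (Q : {pred L}) (v : L -> int) (av : adic iota l Q v).
Variable M : divringClosed algC.
Hypothesis sub_M : forall a, a \in M -> exists y, a = iota y.
Local Notation R := (ringOfIntegers M).
Variable P : prime_idealr R.
Let prQ := adic_primeO av.
Let hv := adic_val av.

Lemma integers_down (Y : R) : exists2 y, y \in intO iota & val Y = iota y.
Proof.
have /andP[/sub_M[y Dy] Ay] := valP Y; exists y => //.
by rewrite inE -Dy.
Qed.

Lemma ideal_pow_val (d : int) m :
    (forall X x, X \in P -> val X = iota x -> vge v d x) ->
  forall Y y, ideal_pow P m Y -> val Y = iota y -> vge v (d * m%:Z) y.
Proof.
pose T k (X : R) := forall x, val X = iota x -> vge v k x.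
move=> PT; rewrite -/(T d) in PT.
have T0 k : T k 0 by move=> x; rewrite rmorph0 -(rmorph0 iota) => /(fmorph_inj iota) <-; rewrite vge0.
have TD k X Y : T k X -> T k Y -> T k (X + Y).
  have [[x _ Dx] [y _ Dy]] := (integers_down X, integers_down Y).
  move=> TX TY s; rewrite rmorphD /= Dx Dy -rmorphD => /(fmorph_inj iota) <-.
  exact: (vgeD hv (TX _ Dx) (TY _ Dy)).
have TM k j X Y : T k X -> T j Y -> T (k + j) (X * Y).
  have [[x _ Dx] [y _ Dy]] := (integers_down X, integers_down Y).
  move=> TX TY s; rewrite rmorphM /= Dx Dy -rmorphM => /(fmorph_inj iota) <-.
  exact: (vgeM hv (TX _ Dx) (TY _ Dy)).
have TO X : T 0 X.
  have [x Ox Dx] := integers_down X; move=> s; rewrite Dx => /(fmorph_inj iota) <-.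
  exact: (vge_intO prQ (adic_loc av)).
have Tprod n (a : 'I_n -> R) : (forall j, T d (a j)) -> T (d * n%:Z) (\prod_(j < n) a j).
  elim: n a => [|n IH] a Ta; first by rewrite big_ord0 mulr0; apply: TO.
  by rewrite big_ord_recl intS mulrDr mulr1; apply: TM => //; apply: IH.
move=> Y y [n [c [a [Pa ->]]]]; apply: (_ : T _ _).
elim/big_ind: _ => [|X1 X2|i _]; [exact: T0|exact: TD|].
rewrite -[d * _]add0r; apply: TM => //; apply: Tprod => j x.
exact: PT (Pa i j).
Qed.

End ValueOfIdealPower.

Section SubfieldImage.
Variables (L : splittingFieldType rat) (iota : {rmorphism L -> algC}).
Local Notation O := (intO iota).

Definition preim_field (K : divringClosed algC) : {pred L} := [pred y | iota y \in K].

Lemma preim_field_divring_closed K : divring_closed (preim_field K).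
Proof.
split=> [|x y|x y]; rewrite !inE ?rmorph1 ?rmorphB ?fmorph_div ?rpred1 //.
  exact: rpredB.
exact: rpred_div.
Qed.
HB.instance Definition _ K :=
  GRing.isDivringClosed.Build L (preim_field K) (preim_field_divring_closed K).

Variable F : divringClosed L.

Definition image_field : {pred algC} := fun a => `[< exists2 y, y \in F & a = iota y >].

Lemma image_fieldP a : reflect (exists2 y, y \in F & a = iota y) (a \in image_field).
Proof. exact: asboolP. Qed.

Lemma image_field_divring_closed : divring_closed image_field.
Proof.
split=> [|_ _ /image_fieldP[x Fx ->] /image_fieldP[y Fy ->]|_ _ /image_fieldP[x Fx ->] /image_fieldP[y Fy ->]].
- by apply/image_fieldP; exists 1; rewrite ?rpred1 ?rmorph1.
- by apply/image_fieldP; exists (x - y); rewrite ?rpredB ?rmorphB.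
- by apply/image_fieldP; exists (x / y); rewrite ?rpred_div ?fmorph_div.
Qed.
HB.instance Definition _ :=
  GRing.isDivringClosed.Build algC image_field image_field_divring_closed.

Lemma image_field_mem y : (iota y \in image_field) = (y \in F).
Proof.
by apply/image_fieldP/idP => [[x Fx /(fmorph_inj iota) ->]|Fy] //; exists y.
Qed.

Lemma image_field_finite : finite_extension Crat image_field.
Proof.
have [U DU] := divring_vspace F; pose b := vbasis U.
have Fb (i : 'I_(\dim U)) : iota b`_i \in image_field.
  by rewrite image_field_mem -DU (vbasis_mem (mem_nth _ _)) // size_tuple.
exists (\dim U), (fun i : 'I_(\dim U) => Sub (iota b`_i) (Fb i)) => x.
have /image_fieldP[y] := valP x; rewrite -DU => Uy Dx.
have cC (c : rat) : (ratr c : algC) \in Crat by apply: Crat_rat.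
exists (fun i : 'I_(\dim U) => Sub (ratr (coord b i y)) (cC _)); rewrite Dx {1}(coord_vbasis Uy) rmorph_sum.
apply: eq_bigr => i _; rewrite !SubK /= -mulr_algl rmorphM; congr (_ * _).
exact: (fmorph_eq_rat (iota \o in_alg L)).
Qed.

Local Notation R := (ringOfIntegers image_field).

Lemma ring_lift y : y \in O -> y \in F -> exists Y : R, val Y = iota y.
Proof.
move=> Oy Fy; have Ry : iota y \in integers image_field.
  by apply/andP; rewrite image_field_mem.
by exists (Sub (iota y) Ry); rewrite SubK.
Qed.

Lemma ring_down (Y : R) : exists y, [/\ y \in O, y \in F & val Y = iota y].
Proof.
have /andP[/image_fieldP[y Fy Dy] Ay] := valP Y; exists y; split=> //.
by rewrite inE -Dy.
Qed.

Lemma contraction_prime Q : primeO iota Q -> exists P : prime_idealr R,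
  forall Y y, val Y = iota y -> (Y \in P) = (y \in Q).
Proof.
move=> prQ; pose P : {pred R} := fun Y => `[< exists2 y, y \in Q & val Y = iota y >].
have PE Y y : val Y = iota y -> (Y \in P) = (y \in Q).
  move=> DY; apply/asboolP/idP => [[x Qx]|Qy]; last by exists y.
  by rewrite DY => /(fmorph_inj iota) ->.
have idP : idealr_closed P.
  split=> [||A X Y]; first by rewrite (PE _ 0) ?rmorph0 // (primeO_0 prQ).
    by rewrite (PE _ 1) ?rmorph1 // (primeO_1 prQ).
  have [[[a [Oa _ Da]] [x [_ _ Dx]]] [y [_ _ Dy]]] := (ring_down A, ring_down X, ring_down Y).
  have DS : val (A * X + Y) = iota (a * x + y) by rewrite !rmorphD !rmorphM /= -Da -Dx -Dy.
  rewrite (PE _ _ Dx) (PE _ _ Dy) (PE _ _ DS) => Qx Qy.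
  by rewrite (primeO_D prQ) // (primeO_M prQ).
have prP : prime_idealr_closed P.
  move=> X Y; have [[x [Ox _ Dx]] [y [Oy _ Dy]]] := (ring_down X, ring_down Y).
  rewrite (PE _ (x * y)); last by rewrite !rmorphM /= -Dx -Dy.
  by rewrite (PE _ _ Dx) (PE _ _ Dy) => /(primeO_P prQ Ox Oy)[->|->]; rewrite ?orbT.
by exists (HB.pack_for (prime_idealr R) P (isIdealr.Build R P idP) (isPrimeIdealrClosed.Build R P prP)).
Qed.

Section Ramification.
Variables (l : nat) (Q : {pred L}) (v : L -> int) (av : adic iota l Q v).
Variable P : prime_idealr R.
Let prQ := adic_primeO av.
Let hv := adic_val av.

Variable pi : L.
Hypotheses (upi : uniformizer v F pi) (PQ : forall X x, val X = iota x -> (X \in P) = (x \in Q)).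

(** With [Pi] an integral uniformizer, [y / Pi^m] is a fraction [A / S] with [S] outside [P], so
    [S Y = A Pi^m] lies in [P^m]. To remove [S], note that [T = 1 - S^(q-1)] lies in [P], and that
    [1 = T^m + (1 - T) (1 + T + ... + T^(m-1))]. *)
Lemma mem_ideal_pow m Y y : val Y = iota y -> vge v (v pi * m%:Z) y -> ideal_pow P m Y.
Proof.
move=> DY vy; have [pl _ Ql _ v_l v_loc v_Q] := av; have [Fpi pi0 vpi mpi] := upi.
have [x [_ Fy Dx]] := ring_down Y; have {x Dx} Fy : y \in F.
  by move: Dx; rewrite DY => /(fmorph_inj iota) ->.
have [y0|y0] := eqVneq y 0.
  have -> : Y = 0 * 0 ^+ m by apply: val_inj; rewrite DY y0 mul0r !rmorph0.
  by apply/ideal_powMl/ideal_pow_expr; rewrite (PQ (x := 0)) ?rmorph0 // (primeO_0 prQ).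
have [pi' [/andP[Opi' Fpi'] pi'0 vpi' mpi']] := uniformizer_exists prQ pl Ql hv v_l v_loc v_Q F.
have Epi : v pi' = v pi.
  have := mpi _ Fpi'; have := mpi' _ Fpi; rewrite /vge (negPf pi0) (negPf pi'0) /=.
  by move: vpi vpi'; move: (v pi) (v pi') => b c; clear; lia.
pose u := y / pi' ^+ m; have u0 : u != 0 by rewrite mulf_neq0 ?invr_neq0 ?expf_neq0.
have Fu : u \in F by rewrite rpred_div ?rpredX.
have vu : 0 <= v u.
  rewrite (valM hv) ?invr_neq0 ?expf_neq0 // (valV hv) ?expf_neq0 // (valX hv) // Epi subr_ge0.
  exact: val_ge vy.
have [a [s [/andP[Oa Fa] /andP[Os Fs] nQs Das]]] : locF iota Q F u.
  have [//|[a [s [OFa OFs nQs Das]]]] := locF_total prQ pl Ql Fu u0.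
  have [[/andP[Oa _] /andP[Os _]] Dsu] : (a \in [predI O & F] /\ s \in [predI O & F]) /\ u * a = s.
    by split=> //; rewrite -Das mulVKf.
  have [s0 vs] := notin_val prQ v_loc v_Q Os nQs.
  exists s, a; split=> //; rewrite -v_Q // -Das /vge (valM hv) ?invr_neq0 // (valV hv) // vs.
  by rewrite negb_or mulf_neq0 ?invr_neq0 //; move: vu; move: (v u) => c; clear; lia.
have [[[A DA] [S DS]] [Pi DPi]] := (ring_lift Oa Fa, ring_lift Os Fs, ring_lift Opi' Fpi').
have DSY : S * Y = A * Pi ^+ m.
  apply: val_inj; rewrite !rmorphM rmorphXn /= DS DY DA DPi -rmorphXn -!rmorphM -Das /u.
  by congr (iota _); rewrite mulrAC divfK ?expf_neq0 // mulrC.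
have PPi : Pi \in P by rewrite (PQ DPi) -v_Q // /vge -gtz0_ge1 vpi' orbT.
have [q [q1 _ resq]] := residue_finite prQ pl Ql hv v_loc v_Q.
pose T := 1 - S ^+ q.-1.
have PT : T \in P.
  rewrite (PQ (x := 1 - s ^+ q.-1)); last by rewrite /T !rmorphB !rmorphXn !rmorph1 /= DS.
  rewrite -opprB; apply: (primeO_N prQ).
  have Osq : s ^+ q.-1 - 1 \in O by rewrite rpredB ?rpredX ?rpred1.
  have : s * (s ^+ q.-1 - 1) \in Q.
    rewrite mulrBr mulr1 -exprS prednK ?(ltnW q1) // -v_Q ?rpredB ?rpredX //.
    exact: resq (vge_intO prQ v_loc Os).
  by case/(primeO_P prQ Os Osq) => //; rewrite (negPf nQs).
pose W := \sum_(i < m) T ^+ i.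
have -> : Y = Y * T ^+ m + S ^+ q.-2 * W * (S * Y).
  have Sq : S ^+ q.-2 * S = 1 - T.
    by rewrite -exprSr /T subKr; case: (q) q1 => [|[]].
  transitivity (Y * (T ^+ m + (1 - T) * W)); last by rewrite -Sq; ring.
  by rewrite -(opprB T 1) mulNr -subrX1 opprB addrC subrK mulr1.
apply: ideal_powD; first exact/ideal_powMl/ideal_pow_expr.
by rewrite DSY mulrA; apply/ideal_powMl/ideal_pow_expr.
Qed.

(** Let [v l = k v pi]. Membership of [l] in [P^e] gives [e <= k]. If [e < k], then [l], and with it
    every rational integer in [P], would lie in [P^(e+1)]. *)
Lemma ramification_index_val e : ramification_index Crat P e -> v l%:R = e%:Z * v pi.
Proof.
have [pl _ Ql _ v_l v_loc v_Q] := av; have [Fpi pi0 vpi mpi] := upi.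
have l0 : l%:R != 0 :> L by rewrite (natr_num_eq0 iota) -lt0n prime_gt0.
have DlR n : val (n%:R : R) = iota n%:R by rewrite !rmorph_nat.
move=> [cP ncP]; have [k Dk] := uniformizer_dvd pl Ql hv v_l Fpi pi0 vpi mpi (rpred_nat F l) l0.
rewrite Dk; congr (_ * _); apply/eqP; rewrite eq_le; apply/andP; split; last first.
  have lP : ideal_pow P e (l%:R : R).
    by apply: cP; rewrite ?(PQ (DlR l)) // DlR rmorph_nat rpred_nat.
  have sM a : a \in image_field -> exists y, a = iota y by case/image_fieldP=> y _ ->; exists y.
  have := ideal_pow_val av sM (d := v pi) _ lP (DlR l); rewrite /vge (negPf l0) /= Dk mulrC ler_pM2r //.
  apply=> X x PX Dx; have [x' [Ox Fx Dx']] := ring_down X.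
  move: Dx; rewrite Dx' => /(fmorph_inj iota) Exx; rewrite -Exx.
  by apply: mpi => //; rewrite v_Q // -(PQ Dx').
rewrite leNgt; apply/negP => lt_ek; apply: ncP => X PX CX.
have [x [Ox Fx Dx]] := ring_down X.
have [c Dc] : exists c : int, x = c%:~R.
  apply: (intO_fixed Ox) => g; have /CratP[r Dr] := CX.
  have -> : x = in_alg L r.
    by apply: (fmorph_inj iota); rewrite -Dx Dr -(fmorph_eq_rat (iota \o in_alg L)).
  by rewrite /= linearZ /= rmorph1.
have : (l %| c)%Z by rewrite -(primeO_int prQ pl Ql) -Dc -(PQ Dx).
case/dvdzP=> b Db; have -> : X = b%:~R * l%:R.
  apply: val_inj; rewrite Dx Dc Db [in RHS]rmorphM /= (DlR l) [in LHS]rmorphM [in LHS]rmorphM /=.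
  by rewrite -[sval _]/(val (b%:~R : R)) !rmorph_int.
apply: ideal_powMl; apply: (mem_ideal_pow (DlR l)).
by rewrite /vge (negPf l0) /= Dk mulrC ler_pM2r //; move: lt_ek; clear; lia.
Qed.


End Ramification.
End SubfieldImage.

Section Image.
Variables (L : splittingFieldType rat) (iota : {rmorphism L -> algC}).
Local Notation gT := (gal_of {:L}).
Local Notation E := (image_field iota {:L}%AS).

Lemma image_mem y : iota y \in E.
Proof. by rewrite image_field_mem memvf. Qed.

Lemma image_elim a : a \in E -> exists y, a = iota y.
Proof. by case/image_fieldP => y _ ->; exists y. Qed.

(** An irreducible polynomial with a root [iota u] divides the image of [gal_poly u], which has
    rational coefficients and all its roots in the image of [L]. *)
Lemma galois_image (F : divringClosed algC) : {subset F <= E} -> galois_extension F E.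
Proof.
move=> sFE; split=> // f irr _ /image_elim[u ->] fx y fy.
pose m := map_poly iota (gal_poly u).
have [|m' Dm] := @fieldOf_poly F m.
  apply/polyOverP => i; rewrite coef_map /=.
  have [|r ->] := gal_fixed_rat (x := (gal_poly u)`_i).
    by move=> g; rewrite -coef_map gal_poly_fixed.
  rewrite -(fmorph_eq_rat (in_alg L)) [iota _](fmorph_eq_rat (iota \o in_alg L) r).
  exact/Crat_sub/Crat_rat.
have /dvdpP[q Dq] : f %| m'.
  by apply: irreducible_root_dvd irr fx _; rewrite Dm fmorph_root gal_poly_root.
have : root m y by rewrite -Dm Dq rmorphM rootM fy orbT.
rewrite /m /gal_poly rmorph_prod rootE horner_prod => /prodf_eq0[g _] /=.
by rewrite rmorphB /= map_polyX map_polyC -rootE root_XsubC => /eqP->; apply: image_mem.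
Qed.

Lemma galois_image_lift (F : divringClosed algC) s : Galois F s ->
  exists g : gT, forall (k : fieldOf E) y, val k = iota y -> val (s k) = iota (g y).
Proof.
move=> [_ sB [s1 sM] _].
have /choice[f Df] y : exists w, val (s (Sub (iota y) (image_mem y))) = iota w.
  exact/image_elim/valP.
have fE (k : fieldOf E) y : val k = iota y -> val (s k) = iota (f y).
  by move=> Dk; rewrite -Df; congr (val (s _)); apply: val_inj; rewrite SubK.
pose e y : fieldOf E := Sub (iota y) (image_mem y).
have De y : val (e y) = iota y by rewrite SubK.
have fB : zmod_morphism f.
  move=> x y; have De' : val (e x - e y) = iota (x - y) by rewrite !rmorphB /= -!De.
  by apply: (fmorph_inj iota); rewrite -(fE _ _ De') sB !rmorphB /= -!(fE _ _ (De _)).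
have fM : monoid_morphism f.
  split=> [|x y].
    have De' : val (1 : fieldOf E) = iota 1 by rewrite !rmorph1.
    by apply: (fmorph_inj iota); rewrite -(fE _ _ De') s1 !rmorph1.
  have De' : val (e x * e y) = iota (x * y) by rewrite !rmorphM /= -!De.
  by apply: (fmorph_inj iota); rewrite -(fE _ _ De') sM !rmorphM /= -!(fE _ _ (De _)).
have fZ : scalable f by apply: rat_linear.
pose nu : {lrmorphism L -> L} := HB.pack f (GRing.isZmodMorphism.Build L L f fB)
  (GRing.isMonoidMorphism.Build L L f fM) (GRing.isScalable.Build rat L L *:%R f fZ).
by have [g Dg] := lrmorphism_gal nu; exists g => k y /fE->; rewrite Dg.
Qed.

End Image.

(** * Places of the image of [L] over the cyclotomic field *)

Section PrimeInIdeal.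
Variables (M : divringClosed algC).
Local Notation R := (ringOfIntegers M).
Variable P : prime_idealr R.

Lemma prime_idealr_prod (I : eqType) (r : seq I) (f : I -> R) :
  \prod_(i <- r) f i \in P -> exists2 i, i \in r & f i \in P.
Proof.
elim: r => [|i r IH]; first by rewrite big_nil idealr1.
rewrite big_cons prime_idealrM => /orP[Pi|/IH[j rj Pj]]; first by exists i; rewrite ?mem_head.
by exists j; rewrite ?in_cons ?rj ?orbT.
Qed.

(** The constant term of an integer relation of [x], once powers of [X] are divided out, is a
    multiple of [x]. *)
Lemma prime_idealr_int (x : R) : x \in P -> x != 0 -> exists2 c : int, c != 0 & c%:~R \in P.
Proof.
move=> Px x0; have /andP[_ Ax] := valP x.
have := Ax; rewrite unfold_in => /floorpP[q Dq].
have q0 : q != 0.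
  by apply: contraTneq (monic_neq0 (minCpoly_monic (val x))) => q0; rewrite Dq q0 map_poly0 eqxx.
have : (map_poly intr q).[x] = 0.
  apply: val_inj; rewrite rmorph0 -horner_map -map_poly_comp /=.
  have := root_minCpoly (val x); rewrite Dq rootE => /eqP E; rewrite -[RHS]E.
  by congr (_.[_]); apply: eq_map_poly => c; exact: (rmorph_int (val : R -> algC) c).
elim/poly_ind: q q0 {Dq} => [|q c IH]; first by rewrite eqxx.
rewrite rmorphD rmorphM /= map_polyX map_polyC /= !hornerE => qc0 E.
have [c0|c0] := eqVneq c 0; last first.
  exists c => //; have -> : c%:~R = - ((map_poly intr q).[x] * x) :> R.
    by apply/eqP; rewrite -addr_eq0 addrC E.
  by rewrite rpredN idealMr.
have q0 : q != 0 by apply: contraNneq qc0 => ->; rewrite c0 mul0r addr0.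
apply: IH => //; move: E; rewrite c0 addr0 => /(congr1 val); rewrite rmorphM rmorph0 => /eqP.
rewrite mulf_eq0 => /orP[/eqP E|/eqP E]; first by apply: val_inj; rewrite E rmorph0.
by case/eqP: x0; apply: val_inj; rewrite E rmorph0.
Qed.

Lemma prime_idealr_prime (x : R) : x \in P -> x != 0 -> exists2 l, prime l & l%:R \in P.
Proof.
move=> Px /(prime_idealr_int Px)[c c0 Pc].
have Pn : (`|c|%N)%:R \in P.
  by move: Pc; case: (c) => n //; rewrite NegzE mulrNz rpredN.
have n0 : (0 < `|c|)%N by rewrite absz_gt0.
elim/ltn_ind: `|c|%N n0 Pn => n IH n0 Pn; have [n1|n1] := leqP n 1.
  by move: Pn; have -> : n = 1%N; [apply/eqP; rewrite eqn_leq n1|rewrite idealr1].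
move: Pn; rewrite -(divnK (pdiv_dvd n)) natrM prime_idealrM => /orP[|]; last first.
  by exists (pdiv n); rewrite ?pdiv_prime.
apply: IH; last by rewrite divn_gt0 ?pdiv_gt0 // dvdn_leq ?pdiv_dvd.
by rewrite ltn_Pdiv // prime_gt1 ?pdiv_prime.
Qed.

End PrimeInIdeal.

Section UnramifiedPlaces.
Variables (L : splittingFieldType rat) (iota : {rmorphism L -> algC}).
Local Notation O := (intO iota).
Local Notation E := (image_field iota {:L}%AS).
Variables (p : nat) (pr_p : prime p) (z : L) (prim_z : p.-primitive_root z).

(** As [p] is the product of the [1 - Z^i], one of these is in [P]; it divides [1 - Z], because [Z]
    is a power of [Z^i]. *)
Lemma one_sub_root_mem (M : divringClosed algC) (P : prime_idealr (ringOfIntegers M)) Z :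
  val Z = iota z -> p%:R \in P -> 1 - Z \in P.
Proof.
move=> DZ Pp; have prim_Z : p.-primitive_root (iota z) by rewrite fmorph_primitive_root.
have : \prod_(1 <= i < p) (1 - Z ^+ i) \in P.
  suffices -> : \prod_(1 <= i < p) (1 - Z ^+ i) = p%:R by [].
  apply: val_inj; rewrite rmorph_nat -(prod_one_sub_prim_root pr_p prim_Z) rmorph_prod.
  by apply: eq_bigr => i _; rewrite rmorphB rmorph1 rmorphXn /= DZ.
case/prime_idealr_prod => i; rewrite mem_index_iota => /andP[i0 ltip] PZi.
have prim_Zi : p.-primitive_root (iota z ^+ i).
  by rewrite (prim_root_exp_coprime _ prim_Z) coprime_sym prime_coprime // gtnNdvd.
have [m Dm] := prim_rootP prim_Zi (prim_expr_order prim_Z).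
have -> : Z = (Z ^+ i) ^+ m by apply: val_inj; rewrite !rmorphXn /= DZ.
by rewrite -opprB subrX1 -mulNr opprB mulrC idealMr.
Qed.

(** Some prime [Q] of [L] contains [P]. The element [w] lies in [P] and in the base field; since it
    has the least positive value at [Q], elements of [P^2] have at least twice that value, and [w]
    is not one of them. *)
Lemma image_unramified_finite :
    (forall l Q v, adic iota l Q v -> exists w,
      [/\ w = l%:R \/ l = p /\ w = 1 - z, 0 < v w & forall y, vge v 1 y -> vge v (v w) y]) ->
  unramified_finite_places (rat_adjoin (iota z)) E.
Proof.
move=> minE M [sFM sME _] P [x Px x0]; have [l pl Pl] := prime_idealr_prime Px x0.
have sM a : a \in M -> exists y, a = iota y by move/sME/image_elim.
pose P' : {pred L} := fun y => `[< exists2 Y, Y \in P & val Y = iota y >].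
have P'E Y y : val Y = iota y -> (Y \in P) = (y \in P').
  move=> DY; apply/idP/asboolP => [PY|[X PX DX]]; first by exists Y.
  by rewrite (_ : Y = X) //; apply: val_inj; rewrite DY.
have [Q0 prQ0 Ql0] := primeO_above iota pl.
have lift y : y \in [predI O & preim_field iota M] -> exists Y : ringOfIntegers M, val Y = iota y.
  move=> /andP[Oy My]; have Ry : iota y \in integers M by apply/andP.
  by exists (Sub (iota y) Ry); rewrite SubK.
have Rl n : val (n%:R : ringOfIntegers M) = iota n%:R by rewrite !rmorph_nat.
have [||||||g Dg] := conj_prime prQ0 pl Ql0 (F := preim_field iota M) (P := P').
- move=> y /asboolP[Y PY DY]; have /andP[MY AY] := valP Y.
  by apply/andP; rewrite !inE -DY.
- by rewrite -(P'E 0) ?rpred0 // !rmorph0.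
- move=> a b /asboolP[A PA DA] /asboolP[B PB DB].
  by rewrite -(P'E (A + B)) ?rpredD // !rmorphD /= DA DB.
- move=> a b /lift[A DA] /asboolP[B PB DB].
  by rewrite -(P'E (A * B)) ?idealMr // !rmorphM /= DA DB.
- by rewrite -(P'E 1) ?idealr1 // !rmorph1.
- by rewrite -(P'E l%:R).
pose Q : {pred L} := [pred y | g y \in Q0]; have prQ : primeO iota Q := primeO_gal g prQ0.
have Ql : l%:R \in Q by apply: Dg; rewrite -(P'E l%:R).
have [v av] := adic_exists pl prQ Ql; have [w [Dw vw minw]] := minE _ _ _ av.
have PQ X y : X \in P -> val X = iota y -> vge v (v w) y.
  move=> PX DX; have P'y : y \in P' by rewrite -(P'E X).
  have Oy : y \in O by have /andP[_] := valP X; rewrite inE -DX.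
  by apply: minw; rewrite (adic_pos av Oy); apply: Dg.
have Fz : iota z \in rat_adjoin (iota z) by apply/asboolP => N; apply.
have Oz : z \in O := unity_root_intO iota pr_p (prim_expr_order prim_z).
have w0 : w != 0.
  case: Dw => [->|[_ ->]]; first by rewrite (natr_num_eq0 iota) -lt0n prime_gt0.
  rewrite subr_eq0 eq_sym -[z]expr1 -(expr0 z) (eq_prim_root_expr prim_z) mod0n.
  by rewrite modn_small ?prime_gt1.
have [W [DW PW FW]] : exists W : ringOfIntegers M,
    [/\ val W = iota w, W \in P & val W \in rat_adjoin (iota z)].
  case: Dw => [->|[lp ->]].
    by exists l%:R; split; rewrite ?Rl // rmorph_nat rpred_nat.
  have [Z DZ] : exists Z : ringOfIntegers M, val Z = iota z.
    by apply: lift; apply/andP; split=> //; apply: sFM.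
  exists (1 - Z); split; first by rewrite [RHS]rmorphB rmorph1 -DZ rmorphB rmorph1.
    by apply: one_sub_root_mem DZ _; rewrite -lp.
  by rewrite rmorphB rmorph1 /= DZ rpredB ?rpred1.
split=> [X PX _|cP]; first by have := ideal_pow_expr 1 PX; rewrite expr1.
have := ideal_pow_val av sM PQ (cP W PW FW) DW.
by rewrite /vge (negPf w0) /=; move: vw; clear; lia.
Qed.

Hypothesis p_odd : odd p.

(** The cyclotomic field has no real place: a real root of unity has square 1, which an odd prime
    order forbids. *)
Lemma image_unramified_infinite : unramified_infinite_places (rat_adjoin (iota z)) E.
Proof.
move=> s /(_ (iota z)) real_s; have {real_s} sz : s (iota z) \is Num.real.
  by apply: real_s; apply/asboolP => N; apply.
have prim_s : p.-primitive_root (s (iota z)) by rewrite !fmorph_primitive_root.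
have n1 : `|s (iota z)| = 1.
  by apply/eqP; rewrite -(@pexpr_eq1 _ _ p) ?prime_gt0 // -normrX (prim_expr_order prim_s) normr1.
have sp : s (iota z) ^+ 2 = 1 by rewrite -real_normK // n1 expr1n.
have : (p %| 2)%N by rewrite (prim_order_dvd prim_s) sp.
by rewrite dvdn_prime2 // => /eqP Dp; move: p_odd; rewrite Dp.
Qed.

End UnramifiedPlaces.

(** [M] is the intersection of [K] with the image of [L], a finite subextension of [K], and [P] is
    the contraction of [Q]. This turns the hypotheses on [K] into statements about [v]. *)
Lemma contraction_ramification (K : divringClosed algC) (L : splittingFieldType rat)
    (iota : {rmorphism L -> algC}) l Q v pi :
    adic iota l Q v -> uniformizer v (preim_field iota K) pi ->
  exists M, exists2 P : prime_idealr (ringOfIntegers M), finite_subextension Crat K M /\ l%:R \in P &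
    forall e, ramification_index Crat P e -> v l%:R = e%:Z * v pi.
Proof.
move=> av upi; have [P PQ] := contraction_prime (preim_field iota K) (adic_primeO av).
exists (image_field iota (preim_field iota K) : divringClosed algC), P; last by move=> e; exact: (ramification_index_val av upi PQ).
split; last by rewrite (PQ _ l%:R) ?rmorph_nat // (adic_mem av).
split; [exact: Crat_sub| |exact: image_field_finite].
by move=> _ /image_fieldP[y Ky ->].
Qed.

Theorem corollary1p5 (p : nat) (p_prime : prime p) (p_odd : odd p)
    (zeta : algC) (zeta_prim : p.-primitive_root zeta)
    (K : divringClosed algC)
    (K_meta_abelian : meta_abelian_extension Crat K)
    (K_tame : tamely_ramified_at p K)
    (K_unramified : forall l : nat, prime l -> l != p -> unramified_at l K) :
  {subset K <= hilbert_class_field (rat_adjoin zeta)}.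
Proof.
move=> x Kx; have galK := K_meta_abelian.1.
have [q [Dq mq] _] := minCpolyP x; have p0 := prime_gt0 p_prime.
(* A field containing [x], its conjugates and [zeta], and generated by such elements: the conjugates
   of [x] are in [K], so it is generated by [zeta] and its intersection with [K]. *)
have mf : q * ('X^p - 1) \is monic by rewrite monicMr // -[1]/(1%:P) monicXnsubC.
have [L [iota [rs [Df genL]]]] := splitting_number_field mf.
have {}Df : minCpoly x * ('X^p - 1) = \prod_(r <- rs) ('X - (iota r)%:P).
  by rewrite -Df rmorphM /= Dq rmorphB /= map_polyXn rmorph1.
have root_rs a : root (minCpoly x * ('X^p - 1)) a -> exists2 r, r \in rs & a = iota r.
  by rewrite Df -(big_map iota xpredT (fun y => 'X - y%:P)) root_prod_XsubC => /mapP.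
have [xL _ Dx] : exists2 r, r \in rs & x = iota r.
  by apply: root_rs; rewrite rootM root_minCpoly.
have [z _ Dz] : exists2 r, r \in rs & zeta = iota r.
  by apply: root_rs; rewrite rootM orbC rootE !hornerE (prim_expr_order zeta_prim) subrr eqxx.
have prim_z : p.-primitive_root z by rewrite -(fmorph_primitive_root iota) -Dz.
pose F0 : divringClosed L := preim_field iota K.
have stF0 (h : gal_of {:L}) y : y \in F0 -> h y \in F0 by apply: gal_mem.
have F0z_gen (g : gal_of {:L}) : (forall y, y \in F0 -> g y = y) -> g z = z -> g = 1%g.
  move=> gF gz; suffices fixL y : y \in fixedField [set g].
    by apply/eqP/gal_eqP => y _; rewrite gal_id; apply: (fixedFieldP _ (fixL y)); rewrite ?memvf ?set11.
  suffices /subvP: (<<1 & rs>> <= fixedField [set g])%VS by rewrite genL; apply; apply: memvf.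
  apply/Fadjoin_seqP; split=> [|r rs_r]; first exact: sub1v.
  apply/fixedFieldP; rewrite ?memvf // => _ /set1P->.
  have : root (minCpoly x * ('X^p - 1)) (iota r).
    by rewrite Df -(big_map iota xpredT (fun y => 'X - y%:P)) root_prod_XsubC map_f.
  rewrite rootM => /orP[/(galois_conj_mem galK Kx)|]; first exact: gF.
  rewrite rootE !hornerE subr_eq0 -rmorphXn -(rmorph1 iota) (inj_eq (fmorph_inj iota)) => /eqP.
  by case/(prim_rootP prim_z) => i ->; rewrite rmorphXn /= gz.
have unr l Q v pi : l != p -> adic iota l Q v -> uniformizer v F0 pi -> v l%:R = v pi.
  move=> lp av upi; have [M [P [finM lP] ramP]] := contraction_ramification av upi.
  by rewrite (ramP 1%N) ?mul1r //; apply: (K_unramified l (adic_prime av) lp M finM P lP).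
have tame Q v pi : adic iota p Q v -> uniformizer v F0 pi ->
    exists2 e : nat, v p%:R = e%:Z * v pi & ~~ (p %| e)%N.
  move=> av upi; have [M [P [finM pP] ramP]] := contraction_ramification av upi.
  by have [e /ramP ve ne] := K_tame M finM P pP; exists e.
(* The second derived group fixes [F0], as [K] is meta-abelian, and it fixes [z], as the first one
   does. *)
set G := [set: gal_of {:L}]; have abD : abelian [~: G, G]%g.
  rewrite /abelian; apply/commG1P/eqP; rewrite -subG1; apply/subsetP => g Dg; rewrite inE; apply/eqP.
  apply: F0z_gen => [y|]; first exact: (derived2_fix galK K_meta_abelian Dg).
  apply: (derived_fix_root prim_z); apply: subsetP Dg.
  by rewrite commg_subl normG.
have Ez : zeta \in image_field iota {:L}%AS by rewrite Dz image_mem.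
(* The image of [L] is itself one of the unramified abelian extensions whose compositum is the
   Hilbert class field. *)
apply/asboolP => M SM; apply: SM; exists (image_field iota {:L}%AS : divringClosed algC); split.
- split.
    by apply: galois_image => a /asboolP; apply=> b ->.
  move=> s t gs gt k; have [[g Dg] [h Dh]] := (galois_image_lift gs, galois_image_lift gt).
  have fixz u (gu : Galois (rat_adjoin zeta) u) w :
    (forall (k : fieldOf (image_field iota {:L}%AS)) y, val k = iota y -> val (u k) = iota ((w : gal_of {:L}) y)) -> w z = z.
    move=> Dw; apply: (fmorph_inj iota); rewrite -(Dw (Sub zeta Ez)) ?SubK //.
    by have [_ _ _ ->] := gu; rewrite SubK //; apply/asboolP => N; apply.
  have gz := fixz s gs g Dg; have hz := fixz t gt h Dh.
  have := tame_metabelian_stab_abelian p_prime prim_z stF0 F0z_gen unr tame abD gz hz.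
  have [y Dy] := image_elim (valP k) => cgh.
  apply: val_inj; rewrite [LHS](Dg _ _ (Dh _ _ Dy)) [RHS](Dh _ _ (Dg _ _ Dy)).
  by rewrite -!galM ?memvf // cgh.
- rewrite Dz; split; last exact: (image_unramified_infinite p_prime prim_z p_odd).
  apply: (image_unramified_finite p_prime prim_z) => l Q v.
  exact: (tame_metabelian_min_val p_prime prim_z stF0 F0z_gen unr tame abD).
- by rewrite Dx image_mem.
Qed.
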